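(* Let $\mathbb K$ be algebraically closed of characteristic $0$, $\mathbb V$ a $\mathbb K$-vector space of dimension $n\ge2$, $\mathfrak g=\mathfrak{gl}(\mathbb V)$, $G=GL(\mathbb V)$, and let $e\in\mathfrak g$ be nilpotent with Jordan blocks of sizes $d_1+1\ge d_2+1\ge\dots\ge d_k+1$; put $d_0=0$. Let $F_i=\kappa^{-1}(\Delta_i)$ for $1\le i\le n$. Then $\{F_1,\dots,F_n\}$ is a very good generating system for $e$, $\mathcal S(\mathfrak g_e)^{\mathfrak g_e}=\mathcal S(\mathfrak g_e)^{G_e}=\mathbb K[{}^{e}\!F_1,\dots,{}^{e}\!F_n]$, and for each $0\le i\le k-1$, $\deg({}^{e}\!F_{d_0+\dots+d_i+i+1})=\dots=\deg({}^{e}\!F_{d_0+\dots+d_i+d_{i+1}+i+1})=i+1$.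
   Context: $\Delta_i\in\mathbb K[\mathfrak g]$ is the sum of the principal $i\times i$ minors of the generic matrix. Let $(\cdot,\cdot)$ be a nonzero scalar multiple of the trace form $(x,y)\mapsto\mathrm{tr}(xy)$, and $\kappa:\mathcal S(\mathfrak g)\to\mathbb K[\mathfrak g]$ the algebra isomorphism extending $x\mapsto(x,\cdot)$. If $e\ne0$, include $e$ in an $\mathfrak{sl}_2$-triple $(e,h,f)$ and normalise $(e,f)=1$; if $e=0$ set $f=0$. $\mathfrak g_e,\mathfrak g_f$ are centralisers, $G_e$ the centraliser of $e$ in $G$, and $\kappa_e:\mathcal S(\mathfrak g_e)\to\mathbb K[\mathfrak g_f]$ is the algebra isomorphism extending $x\mapsto(x,\cdot)|_{\mathfrak g_f}$. For homogeneous $F\in\mathcal S(\mathfrak g)$, ${}^{e}\!F:=\kappa_e^{-1}(\mathrm{in}(\psi_F))$ where $\psi_F(x)=\kappa(F)(e+x)$ on $\mathfrak g_f$ and $\mathrm{in}$ takes the nonzero homogeneous component of lowest degree. A homogeneous generating system $F_1,\dots,F_n$ of $\mathcal S(\mathfrak g)^G$ is very good for $e$ if the set of $\gamma\in\mathfrak g_e^*$ where $d_\gamma({}^{e}\!F_1),\dots,d_\gamma({}^{e}\!F_n)$ are linearly dependent has codimension $\ge2$ in $\mathfrak g_e^*$ (viewing $\mathcal S(\mathfrak g_e)=\mathbb K[\mathfrak g_e^*]$). *)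

(* Defs.v *)
From HB Require Import structures.
From mathcomp Require Import all_boot all_order all_algebra.
From mathcomp Require Export mpoly.
Set Implicit Arguments. Unset Strict Implicit. Unset Printing Implicit Defensive.
Import Order.TTheory GRing.Theory.
Local Open Scope ring_scope.

Section Defs.
Variables (K : fieldType) (n : nat).

Definition lie (x y : 'M[K]_n) : 'M[K]_n := x *m y - y *m x.

Definition centraliser (x : 'M[K]_n) (y : 'M[K]_n) : Prop := lie x y = 0.

Definition Gcentraliser (x : 'M[K]_n) (g : 'M[K]_n) : Prop :=
  g \in unitmx /\ g *m x = x *m g.

Definition pminor (A : 'M[K]_n) (S : {set 'I_n}) : 'M[K]_#|S| :=
  \matrix_(a < #|S|, b < #|S|) A (enum_val a) (enum_val b).

Definition Delta (i : nat) (A : 'M[K]_n) : K :=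
  \sum_(S : {set 'I_n} | #|S| == i) \det (pminor A S).

(* nilpotent Jordan matrix with blocks of sizes d_1+1, ..., d_k+1 (in order);
   superdiagonal entry (i,i+1) is 1 unless i+1 starts a new block *)
Definition block_starts (ds : seq nat) : seq nat :=
  [seq sumn (take l (map S ds)) | l <- iota 0 (size ds)].

Definition jordan_nil (ds : seq nat) : 'M[K]_n :=
  \matrix_(i, j) ((nat_of_ord j == i.+1) && (i.+1 \notin block_starts ds))%:R.

Definition nil_jordan_type (e : 'M[K]_n) (ds : seq nat) : Prop :=
  sorted geq ds /\ (sumn ds + size ds)%N = n /\
  exists P : 'M[K]_n, P \in unitmx /\ e = P *m jordan_nil ds *m invmx P.

Definition sl2_triple (e h f : 'M[K]_n) : Prop :=
  lie h e = 2%:R *: e /\ lie h f = - (2%:R *: f) /\ lie e f = h.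

Definition is_basis_of (P : 'M[K]_n -> Prop) (r : nat) (b : 'I_r -> 'M[K]_n) :=
  (forall j, P (b j)) /\
  (forall t : 'I_r -> K, \sum_j t j *: b j = 0 -> forall j, t j = 0) /\
  (forall x, P x -> exists t : 'I_r -> K, x = \sum_j t j *: b j).
End Defs.

Section Poly.
Variables (K : fieldType) (r : nat).

Definition mindeg (p : {mpoly K[r]}) : nat :=
  foldr minn (msize p) [seq mdeg m | m <- msupp p].

Definition mpoly_in (p : {mpoly K[r]}) : {mpoly K[r]} :=
  \sum_(m <- msupp p | mdeg m == mindeg p) p@_m *: 'X_[m].

Definition zclosed (Z : ('I_r -> K) -> Prop) : Prop :=
  exists I : {mpoly K[r]} -> Prop, forall t, Z t <-> (forall p, I p -> p.@[t] = 0).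

Definition zirred (Y : ('I_r -> K) -> Prop) : Prop :=
  zclosed Y /\ (exists t, Y t) /\
  forall Y1 Y2, zclosed Y1 -> zclosed Y2 -> (forall t, Y t <-> Y1 t \/ Y2 t) ->
    (forall t, Y t -> Y1 t) \/ (forall t, Y t -> Y2 t).

Definition subset_proper (A B : ('I_r -> K) -> Prop) : Prop :=
  (forall t, A t -> B t) /\ exists t, B t /\ ~ A t.

(* codim Z >= 2 in K^r: every irreducible closed Y contained in Z sits at the
   bottom of a chain Y < Y1 < Y2 of irreducible closed subsets
   (equivalently: every irreducible component of Z has codimension >= 2;
   the empty set qualifies). *)
Definition codim_ge2 (Z : ('I_r -> K) -> Prop) : Prop :=
  forall Y, zirred Y -> (forall t, Y t -> Z t) ->
    exists Y1 Y2, zirred Y1 /\ zirred Y2 /\ subset_proper Y Y1 /\ subset_proper Y1 Y2.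

Definition jacobian (m : nat) (F : 'I_m -> {mpoly K[r]}) (t : 'I_r -> K) : 'M[K]_(m, r) :=
  \matrix_(i, j) (F i)^`M(j).@[t].
End Poly.

Section eF.
Variables (K : fieldType) (n r : nat).

(* Coordinates, in the basis b of g_e, of the linear form x |-> tr(x y) on g_e. *)
Definition gedual (b : 'I_r -> 'M[K]_n) (y : 'M[K]_n) : 'I_r -> K :=
  fun j => \tr (b j *m y).

(* P in S(g_e) = K[g_e^*] (coordinates w.r.t. basis b of g_e) is ^eF_i,
   where F_i = kappa^{-1}(Delta_i), the form being (x,y) = c tr(xy):
   P = in(Q) where Q = kappa_e^{-1}(psi_{F_i}), i.e.
   kappa_e(Q)(y) = Q(c tr(b_1 y), ..., c tr(b_r y)) = Delta_i(e + y) on g_f.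
   (kappa_e is a graded isomorphism, so kappa_e^{-1}(in psi) = in(kappa_e^{-1} psi).) *)
Definition is_eF (c : K) (e f : 'M[K]_n) (b : 'I_r -> 'M[K]_n) (i : nat)
    (P : {mpoly K[r]}) : Prop :=
  exists Q : {mpoly K[r]},
    (forall y, centraliser f y -> Q.@[fun j => c * \tr (b j *m y)] = Delta i (e + y)) /\
    P = mpoly_in Q.

(* P in S(g_e) is G_e-invariant (coadjoint action; g_e^* elements represented
   as x |-> tr(x y), and g . (tr(- y)) = tr(- (g y g^-1))) *)
Definition Ge_invariant (e : 'M[K]_n) (b : 'I_r -> 'M[K]_n) (P : {mpoly K[r]}) : Prop :=
  forall g y, Gcentraliser e g ->
    P.@[gedual b (g *m y *m invmx g)] = P.@[gedual b y].

(* P in S(g_e) is annihilated by the derivation extending ad x, for all x in g_e *)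
Definition ge_invariant (e : 'M[K]_n) (b : 'I_r -> 'M[K]_n) (P : {mpoly K[r]}) : Prop :=
  forall x y, centraliser e x ->
    \sum_(j < r) (P^`M(j)).@[gedual b y] * \tr (lie x (b j) *m y) = 0.
End eF.

(* Main.v *)
From HB Require Import structures.
From mathcomp Require Import all_boot all_order all_algebra fingroup perm.
From mathcomp Require Import mpoly ring zify.
From Stdlib Require Import Classical.
Require Import Defs.
Set Implicit Arguments. Unset Strict Implicit. Unset Printing Implicit Defensive.
Import GRing.Theory.
Local Open Scope ring_scope.

(** A nilpotent Jordan matrix [J] with blocks of sizes [d_i + 1] satisfies
    [U (X - J) W = diag (X ^ w_a)] with [det U * det W = 1], where [w_a] is [d_i + 1] at the last
    position of block [i] and [0] at the other positions. Expanding [det (X - J - s y)] into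
    principal minors of [U y W] shows that the lowest component of [Delta_j (J + y)] in [y] has
    degree [i + 1] when [j] belongs to the [i]-th block, and is
    [sum_I [X ^ (w I - j)] det_I (U y W)] over sets [I] of [i + 1] block ends; only coefficients of
    [U y W] that pair with the centraliser of [J] occur, so that this component is a function on
    the dual of the centraliser, namely [^eF_j].

    On the affine space of matrices [U y W] with a free first row and a fixed Hessenberg constant
    part with nonzero subdiagonal, the [^eF_j] are affine functions with an invertible (block
    triangular) linear part. Choosing the constant part bidiagonal with distinct diagonal entries,
    this slice is transversal to the orbit through its base point, so an invariant vanishing on it
    vanishes (all its jets at that point do), which gives polynomiality. The differentials are
    independent along the pencil [a (subdiagonal) + b (superdiagonal)] minus [0]; as the maximal
    minors of the Jacobian are homogeneous, a resultant then shows that no hypersurface is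
    contained in the degeneracy locus. *)

(** * Principal minors *)

(** The element [f] enters only through a pairing: [ker (ad e)] meets [im (ad f)] trivially, so
    traces against a basis of [g_e] map [g_f] onto all of [K^r], and a polynomial on [g_e^*] is
    determined by its values on [g_f]. Conjugating [e], [f] and the basis together keeps all
    coordinates, which reduces the problem to [e = J].

    The degrees come from a weight count. The coefficient of [X ^ (n - j)] needs a set [I] of weight
    at least [j], and [q] positions weigh at most as much as the [q] largest blocks together.

    A slice has [n] parameters, one per invariant; solving the affine equations for them writes an
    invariant explicitly as a polynomial in the [^eF_j].

    No single slice covers the pencil. A free first row works where the subdiagonal is nonzero, the
    transposed slice with a free first column where the superdiagonal is nonzero; together they
    reach every nonzero [(a, b)].

    Codimension at least 2 is expressed by chains of irreducible closed sets, and the chain above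
    [Y] is made of the closure of [Y + K v] and the whole space, with [v] the subdiagonal point. *)

Definition prin_minor (R : comNzRingType) n (B : 'M[R]_n) (I : {set 'I_n}) : R :=
  \sum_(s : 'S_n | perm_on I s) (-1) ^+ s * \prod_(i in I) B i (s i).

(** Distribute each product over the set [I] of rows that take the [B] term: a permutation then
    survives only if it fixes every row outside [I]. *)
Lemma det_diag_add (R : comNzRingType) n (d : 'rV[R]_n) (B : 'M[R]_n) :
  \det (diag_mx d + B) =
  \sum_(I : {set 'I_n}) (\prod_(i in ~: I) d 0 i) * prin_minor B I.
Proof.
rewrite /determinant.
under eq_bigr => s _.
  under eq_bigr => i _ do rewrite !mxE addrC.
  rewrite bigA_distr mulr_sumr.
  over.
rewrite exchange_big /=; apply: eq_bigr => I _.
rewrite /prin_minor mulr_sumr [RHS]big_mkcond /=; apply: eq_bigr => s _.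
rewrite (bigID (fun i => i \in I)) /=.
rewrite (eq_bigr (fun i => B i (s i))); last by move=> i ->.
rewrite [X in _ * (_ * X)](eq_bigr (fun i => d 0 i *+ (i == s i))); last first.
  by move=> i /negbTE ->.
case: ifPn => [sI|/subsetPn [i]].
  rewrite [X in _ * (_ * X) = _](eq_bigr (fun i => d 0 i)); last first.
    by move=> i iI; rewrite (out_perm sI iI) eqxx.
  rewrite mulrA mulrC; congr (_ * _).
  by apply: eq_bigl => i; rewrite inE.
rewrite inE => si iI.
by rewrite [X in _ * (_ * X)](bigD1 i) //= eq_sym (negbTE si) mulr0n mul0r !mulr0.
Qed.

Lemma det_reindex (R : comNzRingType) m n (f : 'I_m -> 'I_n) (M : 'M[R]_n) :
  m = n -> injective f -> \det (mxsub f f M) = \det M.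
Proof.
move=> emn; case: n / emn f M => f M injf.
have -> : mxsub f f M = row_perm (perm injf) (col_perm (perm injf) M).
  by apply/matrixP=> i j; rewrite !mxE !permE.
by rewrite row_permE col_permE !det_mulmx !det_perm odd_permV mulrA mulrAC -expr2
  sqrr_sign mul1r.
Qed.

Lemma prin_minor_det (R : comNzRingType) n (B : 'M[R]_n) (I : {set 'I_n}) :
  prin_minor B I = \det (\matrix_(i, j) (if i \in I then B i j else (i == j)%:R)).
Proof.
rewrite /prin_minor big_mkcond; apply: eq_bigr => s _.
rewrite [X in _ = _ * X](bigID (fun i => i \in I)) /=.
rewrite [X in _ = _ * (X * _)](eq_bigr (fun i => B i (s i))); last first.
  by move=> i iI; rewrite mxE iI.
case: ifPn => [sI|/subsetPn [i]].
  rewrite [X in _ = _ * (_ * X)]big1 ?mulr1 // => i iI.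
  by rewrite mxE (negbTE iI) (out_perm sI iI) eqxx.
rewrite inE => si iI.
by rewrite [X in _ = _ * (_ * X)](bigD1 i) //= mxE (negbTE iI) eq_sym (negbTE si) mul0r !mulr0.
Qed.

(** Listing [S] before its complement makes the matrix of [prin_minor_det] block upper triangular
    with an identity block. Working with [prin_minor] keeps the index type fixed while [S]
    varies. *)
Lemma det_pminor (K : fieldType) n (A : 'M[K]_n) (S : {set 'I_n}) :
  \det (pminor A S) = prin_minor A S.
Proof.
rewrite prin_minor_det.
set M := matrix_of_fun _ _.
pose f (i : 'I_(#|S| + #|~: S|)) : 'I_n :=
  match split i with inl a => enum_val a | inr b => enum_val b end.
have injf : injective f.
  move=> i j; rewrite /f; case: splitP => a ia; case: splitP => b ib e.
  - by apply: val_inj; rewrite /= ia ib (enum_val_inj e).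
  - by move: (enum_valP b); rewrite -e inE (enum_valP a).
  - by move: (enum_valP a); rewrite e inE (enum_valP b).
  - by apply: val_inj; rewrite /= ia ib (enum_val_inj e).
rewrite -(@det_reindex _ _ _ f) //; last by rewrite cardsC card_ord.
rewrite -[mxsub _ _ _]submxK.
have -> : ulsubmx (mxsub f f M) = pminor A S.
  apply/matrixP=> i j; rewrite !mxE /f (unsplitK (inl _)) (unsplitK (inl _)).
  by rewrite enum_valP.
have -> : dlsubmx (mxsub f f M) = 0.
  apply/matrixP=> i j; rewrite !mxE /f (unsplitK (inr _)) (unsplitK (inl _)).
  have := enum_valP i; rewrite inE => /negbTE iS; rewrite iS.
  by case: eqP => // e; move: iS; rewrite e enum_valP.
have -> : drsubmx (mxsub f f M) = 1%:M.
  apply/matrixP=> i j; rewrite !mxE /f (unsplitK (inr _)) (unsplitK (inr _)).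
  have := enum_valP i; rewrite inE => /negbTE iS; rewrite iS.
  by rewrite (inj_eq enum_val_inj).
by rewrite det_ublock det1 mulr1.
Qed.

Lemma prin_minorZ (R : comNzRingType) n (c : R) (B : 'M[R]_n) (I : {set 'I_n}) :
  prin_minor (c *: B) I = c ^+ #|I| * prin_minor B I.
Proof.
rewrite /prin_minor mulr_sumr; apply: eq_bigr => s _.
rewrite mulrCA; congr (_ * _).
by under eq_bigr => i _ do rewrite mxE; rewrite big_split /= prodr_const.
Qed.

Lemma prin_minor_tr (R : comNzRingType) n (B : 'M[R]_n) (I : {set 'I_n}) :
  prin_minor B^T I = prin_minor B I.
Proof.
rewrite /prin_minor [RHS](reindex_inj invg_inj) /=.
apply: eq_big => [s|s sI].
  apply/subsetP/subsetP=> h i; have:= h i; rewrite !inE => hi si; apply: hi.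
    by apply: contra si => /eqP {1}<-; rewrite permK.
  by apply: contra si => /eqP e; rewrite -{1}e permKV.
rewrite odd_permV; congr (_ * _).
rewrite [RHS](reindex_inj (@perm_inj _ s)) /=.
by apply: eq_big => [i|i _]; rewrite ?permK ?mxE // perm_closed.
Qed.

Lemma prin_minor_map (R S : comNzRingType) (g : {rmorphism R -> S}) n (B : 'M[R]_n)
    (I : {set 'I_n}) : prin_minor (map_mx g B) I = g (prin_minor B I).
Proof.
rewrite /prin_minor rmorph_sum; apply: eq_bigr => s _.
rewrite rmorphM rmorph_sign rmorph_prod; congr (_ * _).
by apply: eq_bigr => i _; rewrite mxE.
Qed.

Lemma eq_prin_minor (R : comNzRingType) n (B B' : 'M[R]_n) (I : {set 'I_n}) :
  {in I &, forall i j, B i j = B' i j} -> prin_minor B I = prin_minor B' I.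
Proof.
move=> e; apply: eq_bigr => s sI; congr (_ * _).
by apply: eq_bigr => i iI; rewrite e // perm_closed.
Qed.

Lemma char_poly_coef_Delta (K : fieldType) n (A : 'M[K]_n) j : (j <= n)%N ->
  (char_poly A)`_(n - j) = (-1) ^+ j * Delta j A.
Proof.
move=> jn; rewrite /char_poly /char_poly_mx -diag_const_mx det_diag_add coef_sum.
rewrite /Delta mulr_sumr [RHS]big_mkcond; apply: eq_bigr => I _.
rewrite (eq_bigr (fun _ => 'X)); last by move=> i _; rewrite mxE.
rewrite prodr_const -[X in prin_minor X]scaleN1r prin_minorZ prin_minor_map -det_pminor.
rewrite -[(-1)]/(-1%:P) -polyCN -polyC_exp -polyCM coefXnM coefC.
have cI : (#|I| <= n)%N by rewrite -[leqRHS]card_ord max_card.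
rewrite cardsCs setCK card_ord; move: (\det (pminor A I)) => x.
case: ltnP => h.
  by case: eqP => // e; move: h; rewrite e ltnn.
rewrite subn_eq0; case: eqP => e; first by rewrite e leqnn.
by case: leqP => // h2; case: e; lia.
Qed.

(** * Polynomials restricted to lines *)

Lemma natr_inj (K : fieldType) :
  [pchar K] =i pred0 -> injective (fun i : nat => i%:R : K).
Proof.
move=> ch0 i j /eqP.
wlog ij : i j / (i <= j)%N => [hw|].
  by case: (leqP i j) => [|/ltnW] h e; [|symmetry]; apply: hw h _; rewrite // eq_sym.
rewrite eq_sym -subr_eq0 -natrB // (pcharf0P _).1 // subn_eq0 => ji.
by apply/eqP; rewrite eqn_leq ij ji.
Qed.

(** In characteristic 0 the naturals are distinct in [K], hence an infinite test set for polynomial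
    identities. *)
Lemma poly_nonroot_nat (K : fieldType) (p : {poly K}) :
  [pchar K] =i pred0 -> p != 0 -> exists s : nat, p.[s%:R] != 0.
Proof.
move=> ch0 pn0; 
have [rs|/allPn [_ /mapP [s _ ->] ps]] := boolP (all (root p) [seq i%:R : K | i <- iota 0 (size p)]).
  by have := max_poly_roots pn0 rs; rewrite size_map size_iota ltnn map_inj_uniq ?iota_uniq;
    [move/(_ isT)|exact: natr_inj].
by exists s.
Qed.

Lemma poly_eq0_nat (K : fieldType) (p : {poly K}) :
  [pchar K] =i pred0 -> (forall s : nat, p.[s%:R] = 0) -> p = 0.
Proof.
move=> ch0 p0; apply/eqP/negPn/negP=> /(poly_nonroot_nat ch0) [s].
by rewrite p0 eqxx.
Qed.

Section Line.
Variables (K : fieldType) (r : nat).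
Implicit Types (p q : {mpoly K[r]}) (t u : 'I_r -> K).

(** The restriction [s |-> p (t + s u)]. Its coefficient 0 is the value at [t], coefficient 1 the
    derivative along [u]; for [t = 0], coefficient [d] is the homogeneous part of degree [d] at
    [u]. *)
Definition line t u p : {poly K} :=
  mmap (@polyC K) (fun i => (t i)%:P + (u i)%:P * 'X) p.

HB.instance Definition _ t u := GRing.RMorphism.copy (line t u)
  (mmap (@polyC K) (fun i => (t i)%:P + (u i)%:P * 'X)).

Lemma lineC t u c : line t u c%:MP = c%:P.
Proof. exact: mmapC. Qed.

Lemma lineX t u i : line t u 'X_i = (t i)%:P + (u i)%:P * 'X.
Proof. by rewrite /line mmapX mmap1U. Qed.

Lemma horner_line t u p s : (line t u p).[s] = p.@[fun i => t i + u i * s].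
Proof.
rewrite mevalE /line /mmap horner_sum; apply: eq_bigr => m _.
rewrite hornerM hornerC horner_prod; congr (_ * _); apply: eq_bigr => i _.
by rewrite !hornerE.
Qed.

Lemma mpoly_alg_ind (P : {mpoly K[r]} -> Prop) :
  (forall c, P c%:MP) -> (forall i, P 'X_i) ->
  (forall p q, P p -> P q -> P (p + q)) -> (forall p q, P p -> P q -> P (p * q)) ->
  forall p, P p.
Proof.
move=> PC PX PD PM; elim/mpolyind => [|c m p _ _ Pp]; first by rewrite -mpolyC0.
apply: (PD) => //; rewrite -mul_mpolyC; apply: (PM) => //; rewrite mpolyXE_id.
apply: (big_ind P) => [|p' q'|i _]; [by rewrite -mpolyC1; apply: PC|exact: PM|].
by elim: (m i) => [|k IH]; rewrite ?expr0 -?mpolyC1 ?exprS; auto.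
Qed.

Lemma deriv_line t u p :
  (line t u p)^`() = \sum_j (u j)%:P * line t u p^`M(j).
Proof.
elim/mpoly_alg_ind: p => [c|i|p q hp hq|p q hp hq].
- rewrite lineC derivC big1 // => j _.
  by rewrite mderivC rmorph0 mulr0.
- rewrite lineX derivD derivC add0r derivM derivC mul0r add0r derivX mulr1.
  rewrite (bigD1 i) //= mderivX mnm1E eqxx scale1r big1 => [|j ji].
    rewrite addr0 (_ : (_ - _)%MM = 0%MM) ?mpolyX0 ?rmorph1 ?mulr1 //.
    by apply/mnmP=> j; rewrite mnmBE mnm0E subnn.
  by rewrite mderivX mnm1E eq_sym (negbTE ji) scale0r rmorph0 mulr0.
- rewrite rmorphD derivD hp hq -big_split /=; apply: eq_bigr => j _.
  by rewrite -mulrDr mderivD rmorphD.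
- rewrite rmorphM derivM hp hq mulr_suml mulr_sumr -big_split /=; apply: eq_bigr => j _.
  by rewrite mderivM rmorphD !rmorphM; ring.
Qed.

Lemma line_coef0 t u p : (line t u p)`_0 = p.@[t].
Proof. by rewrite -horner_coef0 horner_line; apply: meval_eq => i; rewrite mulr0 addr0. Qed.

Lemma line_coef1 t u p : (line t u p)`_1 = \sum_j u j * (p^`M(j)).@[t].
Proof.
have := coef_deriv (line t u p) 0; rewrite mulr1n => <-.
rewrite deriv_line coef_sum; apply: eq_bigr => j _.
by rewrite coefCM line_coef0.
Qed.

Lemma line_coef_homog u p d :
  (line (fun _ => 0) u p)`_d = (pihomog mdeg d p).@[u].
Proof.
elim/mpolyind: p => [|c m p _ _ hp]; first by rewrite rmorph0 pihomog0 coef0 meval0.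
rewrite rmorphD pihomogD coefD mevalD hp; congr (_ + _).
rewrite [pihomog _ _ _]linearZ mevalZ -mul_mpolyC rmorphM /= lineC coefCM; congr (_ * _).
rewrite /line mmapX /mmap1 pihomogX.
rewrite (eq_bigr (fun i => (u i ^+ m i)%:P * 'X^(m i))); last first.
  by move=> i _; rewrite add0r exprMn rmorphXn.
rewrite big_split /= -rmorph_prod prodrXr -mdegE /= coefCM coefXn.
rewrite eq_sym; case: ifP => _; last by rewrite mulr0 meval0.
by rewrite mulr1 mevalX.
Qed.

Lemma meval_homog d p c t : p \is d.-homog ->
  p.@[fun i => c * t i] = c ^+ d * p.@[t].
Proof.
move=> /dhomogP hp; rewrite !mevalE mulr_sumr !big_seq; apply: eq_bigr => m /hp hm.
rewrite mulrCA; congr (_ * _); rewrite -[d](hm : mdeg m = d) mdegE -prodrXr -big_split /=.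
by apply: eq_bigr => i _; rewrite exprMn.
Qed.


(** Induction on a degree bound: the derivatives vanish by induction, so [p] is constant in
    characteristic 0, and the constant is its value at [t]. The family [S] is abstract to serve both
    identically vanishing functions and jets at a point. *)
Lemma mpoly_eq0_mderiv_closed (S : {mpoly K[r]} -> Prop) t :
  [pchar K] =i pred0 ->
  (forall p j, S p -> S p^`M(j)) -> (forall p, S p -> p.@[t] = 0) ->
  forall p, S p -> p = 0.
Proof.
move=> ch0 dS S0 p.
suff H k : forall p, S p -> (forall m, (k <= mdeg m)%N -> p@_m = 0) -> p = 0.
  move=> Sp; apply: (H (msize p)) => // m /msize_mdeg_ge.
  by rewrite mcoeff_msupp negbK => /eqP.
elim: k => [|k IH] {}p Sp pk; first by apply/mpolyP=> m; rewrite mcoeff0 pk.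
have dp i : p^`M(i) = 0.
  apply: IH (dS _ _ Sp) _ => m km; rewrite mcoeff_mderiv pk ?mul0rn //.
  by rewrite mdegD mdeg1 addn1 ltnS.
suff pc : p = (p@_0)%:MP by have := S0 p Sp; rewrite pc mevalC => ->.
apply/mpolyP=> m; rewrite mcoeffC.
have [->|m0] := eqVneq m 0%MM; first by rewrite mulr1.
rewrite mulr0.
have [i mi] : exists i, m i != 0%N.
  apply/existsP; rewrite -negb_forall; apply: contra m0 => /forallP m0.
  by apply/eqP/mnmP=> i; rewrite mnm0E (eqP (m0 i)).
have := congr1 (mcoeff (m - U_(i))) (dp i); rewrite mcoeff0 mcoeff_mderiv.
rewrite submK ?lep1mP // => /eqP; rewrite -mulr_natr mulf_eq0 (pcharf0P _).1 //.
by rewrite orbF => /eqP.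
Qed.

Lemma mpoly_eq0_meval p :
  [pchar K] =i pred0 -> (forall t, p.@[t] = 0) -> p = 0.
Proof.
move=> ch0; apply: (@mpoly_eq0_mderiv_closed (fun p => forall t, p.@[t] = 0) (fun=> 0)) => //.
move=> {}p j p0 t.
have : line t (fun i => (i == j)%:R) p = 0.
  by apply: (poly_eq0_nat ch0) => s; rewrite horner_line.
move/(congr1 (fun p : {poly K} => p`_1)); rewrite line_coef1 coef0 (bigD1 j) //= eqxx mul1r.
by rewrite big1 ?addr0 // => i /negbTE ->; rewrite mul0r.
Qed.

End Line.

(** * Codimension of cones *)

Lemma coefM_top (R : nzRingType) (p q : {poly R}) a b :
  (size p <= a.+1)%N -> (size q <= b.+1)%N ->
  (size (p * q)%R <= (a + b).+1)%N /\ (p * q)`_(a + b) = p`_a * q`_b.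
Proof.
move=> sp sq; split.
  by apply: leq_trans (size_polyMleq _ _) _; lia.
have lt_a : (a < (a + b).+1)%N by lia.
rewrite coefM (bigD1 (Ordinal lt_a)) //= addKn big1 ?addr0 // => j.
rewrite -val_eqE /= neq_ltn => /orP [] h.
  by rewrite [q`__]nth_default ?mulr0 //; apply: leq_trans sq _; lia.
by rewrite [p`__]nth_default ?mul0r //; apply: leq_trans sp _.
Qed.

Section Taylor.
Variables (K : fieldType) (r : nat) (v : 'I_r -> K).
Implicit Types (p q : {mpoly K[r]}) (t u : 'I_r -> K).

(** Unlike in [line], the base point [x] of [p (x + s v)] stays generic, so that a resultant in [s]
    is again a polynomial function of [x]. *)
Definition taylor p : {poly {mpoly K[r]}} :=
  mmap (@polyC _ \o @mpolyC r K) (fun i => ('X_i)%:P + (v i)%:MP%:P * 'X) p.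

HB.instance Definition _ := GRing.RMorphism.copy taylor
  (mmap (@polyC _ \o @mpolyC r K) (fun i => ('X_i)%:P + (v i)%:MP%:P * 'X)).

Lemma taylorC c : taylor c%:MP = c%:MP%:P.
Proof. exact: mmapC. Qed.

Lemma map_taylor t p : map_poly (meval t) (taylor p) = line t v p.
Proof.
elim/mpoly_alg_ind: p => [c|i|p q hp hq|p q hp hq].
- by rewrite taylorC map_polyC lineC /= mevalC.
- rewrite lineX /taylor mmapX mmap1U rmorphD rmorphM /= map_polyX !map_polyC /=.
  by rewrite mevalXU mevalC.
- have -> : taylor (p + q) = taylor p + taylor q by exact: rmorphD.
  have -> : line t v (p + q) = line t v p + line t v q by exact: rmorphD.
  by rewrite rmorphD -hp -hq.
- have -> : taylor (p * q) = taylor p * taylor q by exact: rmorphM.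
  have -> : line t v (p * q) = line t v p * line t v q by exact: rmorphM.
  by rewrite rmorphM -hp -hq.
Qed.

(** The top coefficient is free of the base point. If [p.@[v]] is nonzero, the degree in [s] is
    therefore [d] at every specialisation, as [resultant_map] requires. *)
Lemma taylor_top d p : p \is d.-homog ->
  (size (taylor p) <= d.+1)%N /\ (taylor p)`_d = (p.@[v])%:MP.
Proof.
have topE i k : (size ((('X_i)%:P + (v i)%:MP%:P * 'X) ^+ k)%R <= k.+1)%N /\
    ((('X_i)%:P + (v i)%:MP%:P * 'X) ^+ k)`_k = ((v i) ^+ k)%:MP :> {mpoly K[r]}.
  elim: k => [|k [IH1 IH2]]; first by rewrite !expr0 size_poly1 coef1.
  have s1 : (size (('X_i)%:P + (v i)%:MP%:P * 'X : {poly {mpoly K[r]}})%R <= 2)%N.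
    apply: leq_trans (size_polyD _ _) _; rewrite geq_max.
    rewrite (leq_trans (size_polyC_leq1 _)) // mul_polyC.
    by rewrite (leq_trans (size_scale_leq _ _)) // size_polyX.
  have [h1 h2] := coefM_top s1 IH1.
  rewrite !exprS -add1n; split; first exact: h1.
  by rewrite h2 IH2 coefD coefC add0r coefCM coefX mulr1 mpolyCM.
move=> /dhomogP hp; rewrite /taylor /mmap mevalE.
have H m : m \in msupp p -> (size ((p@_m)%:MP%:P * mmap1 (fun i => ('X_i)%:P + (v i)%:MP%:P * 'X) m
     : {poly {mpoly K[r]}})%R <= d.+1)%N /\
   ((p@_m)%:MP%:P * mmap1 (fun i => ('X_i)%:P + (v i)%:MP%:P * 'X) m)`_d =
   (p@_m * \prod_i v i ^+ m i)%:MP :> {mpoly K[r]}.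
  move=> /hp hm; rewrite -[d](hm : mdeg m = d) mdegE /mmap1.
  have [h1 h2] : (size (\prod_(i < r) (('X_i)%:P + (v i)%:MP%:P * 'X) ^+ m i
       : {poly {mpoly K[r]}})%R <= (\sum_i m i).+1)%N /\
     (\prod_(i < r) (('X_i)%:P + (v i)%:MP%:P * 'X) ^+ m i)`_(\sum_i m i) =
     (\prod_i v i ^+ m i)%:MP :> {mpoly K[r]}.
    apply: (big_ind3 (fun (a : {poly {mpoly K[r]}}) (b : nat) (c : K) =>
      (size a <= b.+1)%N /\ a`_b = c%:MP)) => [|a1 b1 c1 a2 b2 c2 [h1 h2] [h3 h4]|i _].
    - by rewrite size_poly1 coef1.
    - have [k1 k2] := coefM_top h1 h3; split=> //.
      by rewrite k2 h2 h4 mpolyCM.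
    - exact: topE.
  rewrite mul_polyC coefZ h2 mpolyCM; split=> //.
  by apply: leq_trans (size_scale_leq _ _) _.
split.
  rewrite big_seq; apply: (big_ind (fun a : {poly _} => size a <= d.+1)%N).
  - by rewrite size_poly0.
  - by move=> a b ha hb; apply: leq_trans (size_polyD _ _) _; rewrite geq_max ha.
  - by move=> m /H [].
rewrite coef_sum rmorph_sum /= big_seq [RHS]big_seq; apply: eq_bigr => m mp.
by rewrite (H m mp).2.
Qed.

End Taylor.

(** * Resultants and generic combinations *)

Lemma resultant_map (R S : comNzRingType) (g : {rmorphism R -> S}) (p q : {poly R}) :
  g (lead_coef p) != 0 -> g (lead_coef q) != 0 ->
  g (resultant p q) = resultant (map_poly g p) (map_poly g q).
Proof.
move=> gp gq; rewrite /resultant /Sylvester_mx !size_map_poly_id0 // -det_map_mx.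
rewrite map_col_mx; congr (\det (col_mx _ _)); apply: map_lin1_mx => u;
  by rewrite map_poly_rV rmorphM /= map_rVpoly.
Qed.

Lemma resultant_common_root (R S : comNzRingType) (g : {rmorphism R -> S}) (p q : {poly R}) s :
  (1 < size p)%N -> (1 < size q)%N ->
  (map_poly g p).[s] = 0 -> (map_poly g q).[s] = 0 -> g (resultant p q) = 0.
Proof.
move=> sp sq p0 q0; have [[a b] _ /= e] := resultant_in_ideal sp sq.
have := congr1 (fun p => (map_poly g p).[s]) e.
by rewrite map_polyC hornerC /= rmorphD !rmorphM /= !hornerE p0 q0 !mulr0 addr0.
Qed.

(** Taking successive powers of one unknown [x] as coefficients turns each condition into a nonzero
    polynomial in [x], whose coefficients are the values of the [G i]; finitely many such conditions
    have a common non-root. *)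
Lemma generic_combination (K : fieldType) (r : nat) (I : finType) (G : I -> {mpoly K[r]})
    (w v : 'I_r -> K) (rs : seq K) :
  [pchar K] =i pred0 ->
  (exists i, (G i).@[v] != 0) ->
  (forall s, exists i, (G i).@[fun j => w j + v j * s] != 0) ->
  exists u : I -> K, (\sum_i u i *: G i).@[v] != 0 /\
    forall s, s \in rs -> (\sum_i u i *: G i).@[fun j => w j + v j * s] != 0.
Proof.
move=> ch0 Gv Gw.
pose comb t : {poly K} := \sum_i (G i).@[t] *: 'X^(enum_rank i).
have combE t x : (comb t).[x] = (\sum_i x ^+ (enum_rank i) *: G i).@[t].
  rewrite horner_sum raddf_sum; apply: eq_bigr => i _ /=.
  by rewrite hornerZ hornerXn mevalZ mulrC.
have comb0 t : (exists i, (G i).@[t] != 0) -> comb t != 0.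
  case=> i; apply: contraNneq => /(congr1 (fun p : {poly K} => p`_(enum_rank i))).
  rewrite coef0 coef_sum (bigD1 i) //= coefZ coefXn eqxx mulr1 big1 => [|j ji].
    by rewrite addr0 => ->.
  by rewrite coefZ coefXn (inj_eq val_inj) (inj_eq enum_rank_inj) eq_sym (negbTE ji) mulr0.
have : comb v * \prod_(s <- rs) comb (fun j => w j + v j * s) != 0.
  rewrite mulf_neq0 ?comb0 // prodf_seq_neq0; apply/allP => s _ /=.
  exact: comb0.
case/(poly_nonroot_nat ch0) => x; rewrite hornerM mulf_eq0 negb_or => /andP [xv xs].
exists (fun i => x%:R ^+ enum_rank i); rewrite -combE; split=> // s srs.
rewrite -combE; move: xs; rewrite horner_prod prodf_seq_neq0 => /allP /(_ s srs).
by [].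
Qed.

Opaque line taylor.

Section Cone.
Variables (K : closedFieldType) (r : nat).
Variables (I : finType) (G : I -> {mpoly K[r]}) (d : nat) (v w : 'I_r -> K).
Variable Z : ('I_r -> K) -> Prop.
Hypothesis ch0 : [pchar K] =i pred0.
Hypothesis homG : forall i, G i \is d.-homog.
Hypothesis ZE : forall t, Z t <-> forall i, (G i).@[t] = 0.
Hypothesis Gv : exists i, (G i).@[v] != 0.
Hypothesis Gw : forall s, exists i, (G i).@[fun j => w j + v j * s] != 0.

(** [R] is the resultant in [s] of [g (x + s v)] and [q (x + s v)], where [g] is some [G i] and [q]
    a combination of them. It vanishes at [x] whenever the line [x + K v] meets [Z], since [g] and
    [q] both vanish on [Z]. *)
Lemma cone_projection_not_dense : exists2 R : {mpoly K[r]}, R.@[w] != 0 &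
  forall z s, Z z -> R.@[fun j => z j + v j * s] = 0.
Proof.
have [i0 gv] := Gv; set g := G i0 in gv.
have top t p : p \is d.-homog -> (size (line t v p) <= d.+1)%N /\ (line t v p)`_d = p.@[v].
  move=> hp; have [h1 h2] := taylor_top v hp.
  rewrite -map_taylor; split; last by rewrite coef_map h2 /= mevalC.
  exact: leq_trans (size_poly _ _) h1.
(* In degree 0 there is no resultant to form, but then [g] is the nonzero constant [g.@[v]], so [Z]
   is empty. This is the case of a single Jordan block. *)
have [d0|d_gt0] := posnP d.
  exists 1; first by rewrite meval1 oner_eq0.
  move=> z s /ZE /(_ i0); have [_] := top z g (homG i0).
  by rewrite d0 line_coef0 => -> /eqP; rewrite (negbTE gv).
have szline t p : p \is d.-homog -> p.@[v] != 0 -> size (line t v p) = d.+1.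
  move=> hp pv; have [h1 h2] := top t p hp; apply/eqP; rewrite eqn_leq h1 /=.
  by rewrite ltnNge; apply: contra pv => /leq_sizeP /(_ d (leqnn d)); rewrite h2 => ->.
have [rs hrs] := closed_field_poly_normal (line w v g).
(* [q] avoids the finitely many zeros of [g] on the line [w + K v], so the two restrictions to that
   line are coprime and [R] does not vanish at [w]. *)
have [u [qv qrs]] := generic_combination rs ch0 Gv Gw.
set q := \sum_i _ in qv qrs.
have hq : q \is d.-homog by apply: rpred_sum => i _; apply: rpredZ.
have sz p : p \is d.-homog -> p.@[v] != 0 ->
    size (taylor v p) = d.+1 /\ lead_coef (taylor v p) = (p.@[v])%:MP.
  move=> hp pv; have [h1 h2] := taylor_top v hp.
  suff e : size (taylor v p) = d.+1 by rewrite lead_coefE e /= h2.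
  apply/eqP; rewrite eqn_leq h1 /= ltnNge; apply: contra pv => /leq_sizeP /(_ d (leqnn d)).
  by rewrite h2 => /eqP; rewrite mpolyC_eq0.
have [sg lg] := sz g (homG i0) gv; have [sq lq] := sz q hq qv.
exists (resultant (taylor v g) (taylor v q)).
  have lcg : meval w (lead_coef (taylor v g)) != 0 by rewrite lg mevalC.
  have lcq : meval w (lead_coef (taylor v q)) != 0 by rewrite lq mevalC.
  have -> : (resultant (taylor v g) (taylor v q)).@[w] = resultant (line w v g) (line w v q).
    by rewrite -(map_taylor v w g) -(map_taylor v w q); exact: resultant_map lcg lcq.
  rewrite resultant_eq0.
  have g0 : line w v g != 0 by rewrite -size_poly_eq0 (szline w g (homG i0) gv).
  apply/negP => sgcd.
  have /closed_rootP [s] : size (gcdp (line w v g) (line w v q)) != 1%N.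
    by case: (size _) sgcd => [|[]].
  rewrite root_gcd => /andP [rg /rootP]; rewrite horner_line => /eqP; apply/negP/qrs.
  move: rg; rewrite hrs rootZ ?lead_coef_eq0 // root_prod_XsubC //.
move=> z s /ZE Zz.
have szg : (1 < size (taylor v g))%N by rewrite sg.
have szq : (1 < size (taylor v q))%N by rewrite sq.
(* The line through [x] returns to [z] at parameter [- s], which is thus a common root. *)
pose x j := z j + v j * s.
have Ez p : p.@[fun i => x i + v i * - s] = p.@[z].
  by apply: meval_eq => i; rewrite mulrN addrK.
have h1 : (map_poly (meval x) (taylor v g)).[- s] = 0.
  by rewrite (map_taylor v x g) horner_line Ez; exact: Zz.
have h2 : (map_poly (meval x) (taylor v q)).[- s] = 0.
  rewrite (map_taylor v x q) horner_line Ez raddf_sum big1 // => i _.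
  by rewrite /= mevalZ Zz mulr0.
exact: resultant_common_root szg szq h1 h2.
Qed.

Lemma zirred_full : zirred (fun _ : 'I_r -> K => True).
Proof.
split; first by exists (fun _ => False) => t; split.
split; first by exists (fun=> 0).
move=> A B [IA hA] [IB hB] AB.
apply: NNPP => /not_or_and [nA nB].
have H (C : ('I_r -> K) -> Prop) IC : (forall t, C t <-> forall p, IC p -> p.@[t] = 0) ->
    ~ (forall t : 'I_r -> K, True -> C t) -> exists2 p : {mpoly K[r]}, IC p & p != 0.
  move=> hC nC; apply: NNPP => h; apply: nC => t _; apply/hC => p Ip.
  case: (eqVneq p 0) => [->|pn]; first exact: meval0.
  by case: h; exists p.
have [p Ip pn] := H A IA hA nA; have [q Iq qn] := H B IB hB nB.
have /eqP : p * q != 0 by rewrite mulf_neq0.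
apply; apply: mpoly_eq0_meval => // t; rewrite mevalM.
by case: (proj1 (AB t) Logic.I) => [/hA/(_ p Ip)|/hB/(_ q Iq)] ->; rewrite ?mul0r ?mulr0.
Qed.

Definition shift_mpoly (u : 'I_r -> K) (p : {mpoly K[r]}) : {mpoly K[r]} :=
  p \mPo [tuple 'X_i + (u i)%:MP | i < r].

Lemma meval_shift u p t : (shift_mpoly u p).@[t] = p.@[fun i => t i + u i].
Proof.
rewrite comp_mpoly_meval; apply: meval_eq => i.
by rewrite tnth_mktuple mevalD mevalXU mevalC.
Qed.

Lemma zclosedI_shift (Y A : ('I_r -> K) -> Prop) u : zclosed Y -> zclosed A ->
  zclosed (fun t => Y t /\ A (fun i => t i + u i)).
Proof.
move=> [IY hY] [IA hA].
exists (fun p => IY p \/ exists2 q, IA q & p = shift_mpoly u q) => t; split.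
  by move=> [/hY Yt /hA At] p [/Yt //|[q Iq ->]]; rewrite meval_shift At.
move=> h; split; first by apply/hY => p Ip; apply: h; left.
by apply/hA => p Ip; rewrite -meval_shift; apply: h; right; exists p.
Qed.

(** The Zariski closure of [Y + K v]. *)
Definition cylinder_closure (Y : ('I_r -> K) -> Prop) (t : 'I_r -> K) : Prop :=
  forall p : {mpoly K[r]}, (forall y s, Y y -> p.@[fun i => y i + v i * s] = 0) -> p.@[t] = 0.

Lemma sub_cylinder_closure Y y s : Y y -> cylinder_closure Y (fun i => y i + v i * s).
Proof. by move=> Yy p; apply. Qed.

(** For each [s], irreducibility of [Y] puts the translate [Y + s v] entirely into [A] or entirely
    into [B]. If neither contained the closure, each alternative would hold only at roots of a fixed
    nonzero polynomial in [s], which cannot exhaust the naturals. *)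
Lemma zirred_cylinder_closure Y : zirred Y -> zirred (cylinder_closure Y).
Proof.
move=> [cY [[y0 Yy0] irrY]]; split.
  by exists (fun p => forall y s, Y y -> p.@[fun i => y i + v i * s] = 0) => t; split.
split; first by exists (fun i => y0 i + v i * 0); apply: sub_cylinder_closure.
move=> A B cA cB AB.
have cov s : (forall y, Y y -> A (fun i => y i + v i * s)) \/
             (forall y, Y y -> B (fun i => y i + v i * s)).
  have := irrY _ _ (zclosedI_shift (fun i => v i * s) cY cA)
                   (zclosedI_shift (fun i => v i * s) cY cB).
  case=> [t|h|h].
  - split=> [Yt|[[]|[]]] //.
    by have /AB [] := sub_cylinder_closure s Yt; [left|right].
  - by left=> y /h [].
  - by right=> y /h [].
move: cA cB => [IA hA] [IB hB].
have H (C : ('I_r -> K) -> Prop) IC : (forall t, C t <-> forall p, IC p -> p.@[t] = 0) ->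
    ~ (forall t, cylinder_closure Y t -> C t) ->
    exists2 q : {poly K}, q != 0 &
      forall s, (forall y, Y y -> C (fun i => y i + v i * s)) -> q.[s] = 0.
  move=> hC nC; apply: NNPP => h; apply: nC => t ct; apply/hC => p Ip; apply: ct => y s Yy.
  have [l0|ln] := eqVneq (line y v p) 0; first by rewrite -horner_line l0 horner0.
  by case: h; exists (line y v p) => // s' /(_ y Yy) /hC /(_ p Ip); rewrite horner_line.
apply: NNPP => /not_or_and [/(H A IA hA) [p pn hp] /(H B IB hB) [q qn hq]].
have /eqP : p * q != 0 by rewrite mulf_neq0.
apply; apply: (poly_eq0_nat ch0) => s; rewrite hornerM.
by case: (cov s%:R) => [/hp|/hq] ->; rewrite ?mul0r ?mulr0.
Qed.

(** Both inclusions in the chain are strict: on a line of direction [v] some [G i] has the nonzero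
    top coefficient [(G i).@[v]], so the line leaves [Z]; and [w] lies outside the closure of
    [Y + K v]. *)
Lemma codim_ge2_cone : codim_ge2 Z.
Proof.
move=> Y irrY YZ; exists (cylinder_closure Y), (fun=> True).
split; first exact: zirred_cylinder_closure.
split; first exact: zirred_full.
have [_ [[y0 Yy0] _]] := irrY.
split; split=> //.
- move=> t Yt p hp.
  by rewrite -(hp t 0 Yt); apply: meval_eq => i; rewrite mulr0 addr0.
- have [i gv] := Gv.
  have ln : line y0 v (G i) != 0.
    have [_ h2] := taylor_top v (homG i).
    apply: contraNneq gv => l0; have := congr1 (meval y0) h2.
    by rewrite -(coef_map (meval y0)) /= map_taylor l0 coef0 mevalC => <-.
  have [s sn] := poly_nonroot_nat ch0 ln.
  exists (fun i => y0 i + v i * s%:R); split; first exact: sub_cylinder_closure.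
  by move=> /YZ /ZE /(_ i) /eqP; rewrite -horner_line (negbTE sn).
- have [R Rw RZ] := cone_projection_not_dense.
  exists w; split=> // /(_ R) Rw0; case/eqP: Rw; apply: Rw0 => y s /YZ.
  exact: RZ.
Qed.

End Cone.

(** * Representations of sl2 *)

Section Sl2Module.
Variables (K : fieldType) (V : lmodType K) (E H F : {linear V -> V}) (N : nat).
Hypothesis ch0 : [pchar K] =i pred0.
Hypothesis HE : forall x, H (E x) = E (H x) + 2%:R *: E x.
Hypothesis HF : forall x, H (F x) = F (H x) - 2%:R *: F x.
Hypothesis EF : forall x, E (F x) = F (E x) + H x.
Hypothesis nilE : forall x, iter N E x = 0.
Hypothesis nilF : forall x, iter N F x = 0.

Let natr_neq0 m : (m.+1%:R : K) != 0.
Proof. by rewrite (pcharf0P _).1. Qed.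

(** The products of the [H - i], respectively of the [H + i], for [i < m]. On [ker E], [E^m F^m]
    equals [m!] times the first; on [ker F], [F^m E^m] equals [m!] times the second up to sign. *)
Fixpoint lower_weights m (v : V) : V :=
  if m is m'.+1 then lower_weights m' (H v - m'%:R *: v) else v.
Fixpoint raise_weights m (v : V) : V :=
  if m is m'.+1 then raise_weights m' (H v + m'%:R *: v) else v.

Lemma E_iterF m v : E v = 0 ->
  E (iter m.+1 F v) = m.+1%:R *: iter m F (H v - m%:R *: v).
Proof.
move=> Ev.
have HiF k : H (iter k F v) = iter k F (H v) - (2 * k)%:R *: iter k F v.
  elim: k => [|k IH] /=; first by rewrite muln0 scale0r subr0.
  rewrite HF IH linearB linearZ /= -addrA -opprD -scalerDl; congr (_ - _ *: _).
  by rewrite -natrD; congr _%:R; lia.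
have iB k a b : iter k F (a - b) = iter k F a - iter k F b.
  by elim: k => //= k ->; rewrite linearB.
have iZ k c a : iter k F (c *: a) = c *: iter k F a.
  by elim: k => //= k ->; rewrite linearZ.
rewrite iB iZ; elim: m => [|m IH]; first by rewrite /= EF Ev linear0 add0r scale0r subr0 scale1r.
rewrite iterS EF IH HiF linearZ linearB linearZ /= !scalerBr !scalerA.
set a := F (iter m F (H v)); set b := F (iter m F v).
rewrite -[X in _ + (X - _)]scale1r addrACA -scalerDl -opprD -scalerDl natr1.
by congr (_ - _ *: _); rewrite -!natrM -natrD; congr _%:R; lia.
Qed.

Lemma F_iterE m v : F v = 0 ->
  F (iter m.+1 E v) = - m.+1%:R *: iter m E (H v + m%:R *: v).
Proof.
move=> Fv.
have HiE k : H (iter k E v) = iter k E (H v) + (2 * k)%:R *: iter k E v.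
  elim: k => [|k IH] /=; first by rewrite muln0 scale0r addr0.
  rewrite HE IH linearD linearZ /= -addrA -scalerDl; congr (_ + _ *: _).
  by rewrite -natrD; congr _%:R; lia.
have iD k a b : iter k E (a + b) = iter k E a + iter k E b.
  by elim: k => //= k ->; rewrite linearD.
have iZ k c a : iter k E (c *: a) = c *: iter k E a.
  by elim: k => //= k ->; rewrite linearZ.
have FE x : F (E x) = E (F x) - H x by rewrite EF addrK.
rewrite iD iZ; elim: m => [|m IH].
  by rewrite /= FE Fv linear0 sub0r scale0r addr0 scaleN1r.
rewrite iterS FE IH HiE linearZ linearD linearZ /= !scalerDr !scalerA.
set a := E (iter m E (H v)); set b := E (iter m E v).
rewrite !mulNr !scaleNr -!opprD; congr (- _).
rewrite -[X in _ + (X + _)]scale1r addrACA -!scalerDl natr1.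
by congr (_ + _ *: _); rewrite -!natrM -natrD; congr _%:R; lia.
Qed.

Lemma lower_weights_kerE m v : E v = 0 -> iter m E (iter m F v) = 0 -> lower_weights m v = 0.
Proof.
elim: m v => [|m IH] v Ev // h; apply: IH.
  by rewrite linearB linearZ /= Ev scaler0 subr0; apply: (addIr (2%:R *: E v));
     rewrite -HE Ev linear0 scaler0 addr0.
move: h; rewrite iterSr E_iterF //.
have -> c a : iter m E (c *: a) = c *: iter m E a.
  by elim: (m) => //= k ->; rewrite linearZ.
by move/eqP; rewrite scaler_eq0 (negbTE (natr_neq0 _)) => /eqP.
Qed.

Lemma raise_weights_kerF m v : F v = 0 -> iter m F (iter m E v) = 0 -> raise_weights m v = 0.
Proof.
elim: m v => [|m IH] v Fv // h; apply: IH.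
  by rewrite linearD linearZ /= Fv scaler0 addr0; apply: (addIr (- (2%:R *: F v)));
     rewrite -HF Fv linear0 scaler0 subr0.
move: h; rewrite iterSr F_iterE //.
have -> c a : iter m F (c *: a) = c *: iter m F a.
  by elim: (m) => //= k ->; rewrite linearZ.
by move/eqP; rewrite scaler_eq0 oppr_eq0 (negbTE (natr_neq0 _)) => /eqP.
Qed.

Let lin0 (L : {linear V -> V}) m : iter m L 0 = 0.
Proof. by elim: m => //= m ->; rewrite linear0. Qed.

(* [F (E^(q+1) z)] is a nonzero multiple of [E^q z], so [E^q z = 0] propagates down to [z]. *)
Lemma weight_vector_eq0 (k : nat) z : H z = (k + 2)%:R *: z -> E (F z) = 0 -> z = 0.
Proof.
move=> Hz EFz.
have He q : H (iter q E z) = (k + 2 + 2 * q)%:R *: iter q E z.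
  elim: q => [|q IH] /=; first by rewrite muln0 addn0.
  rewrite HE IH linearZ /= -scalerDl -natrD; congr (_%:R *: _); lia.
have FE x : F (E x) = E (F x) - H x by rewrite EF addrK.
have step q : exists c : nat, E (F (iter q E z)) = - (c%:R *: iter q E z).
  elim: q => [|q [c IH]]; first by exists 0; rewrite scale0r oppr0.
  exists (c + (k + 2 + 2 * q))%N.
  by rewrite iterS FE IH He -opprD -scalerDl -natrD linearN linearZ.
have down q : iter q.+1 E z = 0 -> iter q E z = 0.
  have [c hc] := step q; move=> h; have := FE (iter q E z).
  rewrite -iterS h linear0 hc He -opprD -scalerDl -natrD.
  have -> : (c + (k + 2 + 2 * q) = (c + k + 1 + 2 * q).+1)%N by lia.
  by move/esym/eqP; rewrite oppr_eq0 scaler_eq0 (negbTE (natr_neq0 _)) => /eqP.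
have : iter N E z = 0 by [].
by elim: (N) => // q IH /down.
Qed.

(** The vector [(H - (k + 2)) z] lies in [ker F], so some product of factors [H + m] kills it.
    Replacing [z] by [(H + m) z] absorbs a factor and only multiplies [F z] by [k + 2 + m], which is
    nonzero; in the end [z] is a weight vector of weight [k + 2]. *)
Lemma eigen_kerE_imF (k : nat) z : H (F z) = k%:R *: F z -> E (F z) = 0 -> F z = 0.
Proof.
move=> HFz EFz.
have kF : F (H z - (k + 2)%:R *: z) = 0.
  by rewrite linearB linearZ /= natrD scalerDl opprD addrA addrAC -HF HFz subrr.
have := raise_weights_kerF (m := N) kF (nilF _).
elim: (N) z HFz EFz {kF} => [|m IH] z HFz EFz /=.
  by move/eqP; rewrite subr_eq0 => /eqP Hz; rewrite (weight_vector_eq0 Hz EFz) linear0.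
have Fz' : F (H z + m%:R *: z) = (k + 2 + m)%:R *: F z.
  rewrite linearD linearZ /= natrD scalerDl natrD scalerDl; congr (_ + _).
  by rewrite -HFz HF subrK.
move=> h; have /eqP : F (H z + m%:R *: z) = 0.
  apply: IH.
  - by rewrite Fz' linearZ /= HFz !scalerA mulrC.
  - by rewrite Fz' linearZ /= EFz scaler0.
  rewrite -[RHS]h; congr (raise_weights _ _).
  have lD a b : H (a + b) = H a + H b by exact: linearD.
  have lZ c a : H (c *: a) = c *: H a by exact: linearZ.
  have lB a b : H (a - b) = H a - H b by exact: linearB.
  rewrite lD lB !lZ scalerBr scalerDr !scalerA [m%:R * _]mulrC opprD !addrA.
  by congr (_ - _); rewrite addrAC.
rewrite Fz' scaler_eq0 (_ : (k + 2 + m = (k + 1 + m).+1)%N); last by lia.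
by rewrite (negbTE (natr_neq0 _)) => /eqP.
Qed.

(** As [F] is nilpotent, a product of factors [H - i] kills [F z]. Each [(H - m) (F z)] again lies
    in [ker E] and in the image of [F], so the factors can be removed one by one, each time leaving
    an eigenvector. *)
Lemma kerE_imF_trivial z : E (F z) = 0 -> F z = 0.
Proof.
move=> EFz; have := lower_weights_kerE (m := N) EFz.
rewrite -[in iter N F _]iterSr iterS nilF linear0 lin0 => /(_ erefl).
elim: (N) z EFz => [|m IH] z EFz //= h.
have e : H (F z) - m%:R *: F z = F (H z - 2%:R *: z - m%:R *: z).
  by rewrite HF !linearB !linearZ.
apply: (eigen_kerE_imF (k := m)) (EFz).
apply/eqP; rewrite -subr_eq0 e; apply/eqP/IH; last by rewrite -e.
rewrite -e linearB linearZ /= EFz scaler0 subr0.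
by apply: (addIr (2%:R *: E (F z))); rewrite -HE EFz linear0 scaler0 addr0.
Qed.

End Sl2Module.

(** * The trace form on the centraliser *)

(** The rows of [1 - A * pinvmx A] lie in the left kernel of [A], so this matrix kills [u], and
    [pinvmx A * u] is a preimage. *)
Lemma colspace_of_kernel (K : fieldType) m n (A : 'M[K]_(m, n)) (u : 'cV[K]_m) :
  (forall v : 'rV_m, v *m A = 0 -> v *m u = 0) -> exists w, u = A *m w.
Proof.
move=> h; pose T := 1%:M - A *m pinvmx A.
have TA : T *m A = 0 by rewrite mulmxBl mul1mx mulmxKpV ?subrr.
have Tu : T *m u = 0.
  apply/row_matrixP=> i; rewrite row_mul row0; apply: h.
  by rewrite -row_mul TA row0.
exists (pinvmx A *m u); apply/eqP; rewrite mulmxA -subr_eq0.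
by rewrite -[X in X - _]mul1mx -mulmxBl Tu.
Qed.

Lemma row_full_of_trivial_kernel (K : fieldType) m n (A : 'M[K]_(m, n)) :
  (forall z : 'cV_n, A *m z = 0 -> z = 0) -> row_full A.
Proof.
move=> h; rewrite /row_full -mxrank_tr -/(row_free _) -kermx_eq0.
apply/eqP/row_matrixP => i; rewrite row0; apply: trmx_inj; rewrite trmx0; apply: h.
by apply: trmx_inj; rewrite trmx_mul trmxK -row_mul mulmx_ker row0 trmx0.
Qed.

Lemma mxvec_trace (K : fieldType) n (X Y : 'M[K]_n) :
  mxvec Y *m (mxvec X^T)^T = (\tr (X *m Y))%:M.
Proof.
apply/rowP=> i; rewrite !mxE (ord1 i) eqxx mulr1n.
rewrite (reindex _ (curry_mxvec_bij n n)) /= /mxtrace.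
rewrite (eq_bigr (fun k => Y k.1 k.2 * X k.2 k.1)); last first.
  by move=> [k l] _; rewrite /= !mxE !mxvecE mxE.
rewrite -(pair_bigA _ (fun k l => Y k l * X l k)) exchange_big /=.
by apply: eq_bigr => k _; rewrite mxE; apply: eq_bigr => l _; rewrite mulrC.
Qed.

Lemma trace_nondegenerate (K : fieldType) n (X : 'M[K]_n) :
  (forall Y, \tr (X *m Y) = 0) -> X = 0.
Proof.
move=> h; apply/matrixP=> i j; rewrite mxE -(h (delta_mx j i)).
rewrite /mxtrace (bigD1 i) //= big1 => [|k ki].
  rewrite addr0 mxE (bigD1 j) //= mxE !eqxx mulr1 big1 ?addr0 // => l lj.
  by rewrite mxE (negbTE lj) mulr0.
by rewrite mxE big1 // => l _; rewrite mxE (negbTE ki) andbF mulr0.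
Qed.

Lemma lie_is_linear (K : fieldType) n (x : 'M[K]_n) : linear (lie x).
Proof.
move=> a y z; rewrite /lie mulmxDr mulmxDl -scalemxAr -scalemxAl scalerBr opprD.
by rewrite !addrA; congr (_ - _); rewrite addrAC.
Qed.
HB.instance Definition _ (K : fieldType) n (x : 'M[K]_n) :=
  GRing.isLinear.Build K 'M[K]_n 'M[K]_n _ (lie x) (lie_is_linear x).

Section Ad.
Variables (K : fieldType) (n : nat).
Implicit Types x y : 'M[K]_n.

Lemma lie_jacobi x y z : lie x (lie y z) = lie y (lie x z) + lie (lie x y) z.
Proof.
rewrite /lie !mulmxBr !mulmxBl !mulmxA.
move: (x *m y *m z) (x *m z *m y) (y *m x *m z) (y *m z *m x) (z *m x *m y) (z *m y *m x).
by move=> a1 a2 a3 a4 a5 a6; apply/matrixP => i j; rewrite !mxE; ring.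
Qed.

Lemma trace_lie x y z : \tr (x *m lie y z) = \tr (lie x y *m z).
Proof.
rewrite /lie mulmxBr mulmxBl !linearB /= !mulmxA; congr (_ - _).
by rewrite mxtrace_mulC mulmxA.
Qed.

(** A nonzero power [F^k] is an eigenvector of the commutator with [H], with eigenvalue [- k a] in
    the row-vector convention; these are pairwise distinct, and a matrix has finitely many
    eigenvalues. *)
Lemma weight_operator_nilpotent (H F : {linear 'M[K]_n -> 'M[K]_n}) (a : K) :
  [pchar K] =i pred0 -> a != 0 -> (forall x, H (F x) = F (H x) + a *: F x) ->
  exists N, forall x, iter N F x = 0.
Proof.
move=> ch0 a0 HF.
pose N := (n * n)%N; pose MH := lin_mx H; pose MF := lin_mx F.
pose pw k := iter k (fun A : 'M_N => A *m MF) 1%:M.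
have pwE k x : mxvec x *m pw k = mxvec (iter k F x).
  elim: k => [|k IH]; first by rewrite mulmx1.
  by rewrite [pw _]/= mulmxA IH mul_vec_lin.
have comm k x : H (iter k F x) = iter k F (H x) + (k%:R * a) *: iter k F x.
  elim: k => [|k IH] /=; first by rewrite mul0r scale0r addr0.
  by rewrite HF IH linearD linearZ /= -addrA -scalerDl -natr1 mulrDl mul1r.
have comm' k : pw k *m MH - MH *m pw k = (k%:R * a) *: pw k.
  apply/row_matrixP=> i; rewrite -[row i _]/(row i _) !rowE -[delta_mx _ _]vec_mxK.
  rewrite mulmxBr -scalemxAr !mulmxA pwE !mul_vec_lin pwE comm linearD linearZ /=.
  by rewrite addrC addKr.
suff [k pk] : exists k, pw k = 0.
  exists k => x; apply: (can_inj mxvecK); rewrite -pwE pk mulmx0.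
  by rewrite linear0.
apply: NNPP => npw.
have pwn k : pw k != 0 by apply/negP => /eqP pk; apply: npw; exists k.
have rt k : root (char_poly (lin_mx (lie MH))) (- (k%:R * a)).
  rewrite -eigenvalue_root_char; apply/eigenvalueP; exists (mxvec (pw k)).
    by rewrite mul_vec_lin /= /lie -opprB comm' !linearN /= linearZ scaleNr.
  by rewrite mxvec_eq0.
have pn0 : char_poly (lin_mx (lie MH)) != 0 by rewrite -size_poly_eq0 size_char_poly.
pose rs := [seq - (k%:R * a) | k <- iota 0 (size (char_poly (lin_mx (lie MH))))].
have all_rs : all (root (char_poly (lin_mx (lie MH)))) rs by apply/allP=> _ /mapP [k _ ->].
have uniq_rs : uniq rs.
  rewrite map_inj_uniq ?iota_uniq // => i j /oppr_inj /(mulIf a0).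
  exact: natr_inj.
by have := max_poly_roots pn0 all_rs uniq_rs; rewrite size_map size_iota ltnn.
Qed.

Lemma centraliser_image_disjoint (e h f : 'M[K]_n) z :
  [pchar K] =i pred0 -> sl2_triple e h f -> lie e (lie f z) = 0 -> lie f z = 0.
Proof.
move=> ch0 [he [hf ef]].
have HE x : lie h (lie e x) = lie e (lie h x) + 2%:R *: lie e x.
  by rewrite lie_jacobi he /lie scalerBr -scalemxAl -scalemxAr.
have HF x : lie h (lie f x) = lie f (lie h x) - 2%:R *: lie f x.
  rewrite lie_jacobi hf; congr (_ + _).
  by rewrite /lie scalerBr mulNmx mulmxN -scalemxAl -scalemxAr [RHS]opprD.
have EF x : lie e (lie f x) = lie f (lie e x) + lie h x by rewrite lie_jacobi ef.
have n2 : (2%:R : K) != 0 by rewrite (pcharf0P _).1.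
have [N1 h1] := weight_operator_nilpotent ch0 n2 HE.
have HF' x : lie h (lie f x) = lie f (lie h x) + (- 2%:R) *: lie f x.
  by rewrite HF scaleNr.
have [N2 h2] : exists N, forall x, iter N (lie f) x = 0.
  by apply: (weight_operator_nilpotent ch0 _ HF'); rewrite oppr_eq0.
have lin0 y k : iter k (lie y) 0 = 0 by elim: k => //= k ->; rewrite linear0.
apply: (@kerE_imF_trivial _ _ (lie e) (lie h) (lie f) (N1 + N2)) => // x.
  by rewrite addnC iterD h1 lin0.
by rewrite iterD h2 lin0.
Qed.

End Ad.

Section Gedual.
Variables (K : fieldType) (n r : nat) (e : 'M[K]_n) (b : 'I_r -> 'M[K]_n).
Hypothesis bas : is_basis_of (centraliser e) b.

Lemma sum_gedual (t : 'I_r -> K) y :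
  \sum_j t j * gedual b y j = \tr ((\sum_j t j *: b j) *m y).
Proof.
by rewrite mulmx_suml linear_sum; apply: eq_bigr => j _; rewrite -scalemxAl linearZ.
Qed.

Lemma gedual_trace y z : gedual b y =1 gedual b z ->
  forall x, centraliser e x -> \tr (x *m y) = \tr (x *m z).
Proof.
move=> yz x ex; have [_ [_ /(_ x ex) [t ->]]] := bas.
by rewrite -!sum_gedual; apply: eq_bigr => j _; rewrite yz.
Qed.

(** By duality, a failure would give a nonzero [X] in the span of [b] orthogonal to the centraliser
    of [f]. Such an [X] lies in the image of [ad f] and in the kernel of [ad e], hence vanishes. *)
Lemma gedual_surjective f :
  (forall x, lie e (lie f x) = 0 -> lie f x = 0) ->
  forall t, exists2 y, centraliser f y & gedual b y =1 t.
Proof.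
move=> disj t.
pose A := lin_mx (lie f).
pose B : 'M[K]_(n * n, r) := \matrix_(k, j) (mxvec (b j)^T) 0 k.
have BE y j : (mxvec y *m B) 0 j = gedual b y j.
  transitivity ((mxvec y *m (mxvec (b j)^T)^T) 0 0).
    by rewrite !mxE; apply: eq_bigr => k _; rewrite !mxE.
  by rewrite mxvec_trace mxE eqxx.
have : row_full (kermx A *m B).
  apply: row_full_of_trivial_kernel => z Cz.
  have [w hw] : exists w, B *m z = A *m w.
    apply: colspace_of_kernel => v vA; rewrite mulmxA.
    have /submxP [D ->] : (v <= kermx A)%MS by apply/sub_kermxP.
    by rewrite -mulmxA -mulmxA [kermx A *m _]mulmxA Cz mulmx0.
  pose X := \sum_j z j 0 *: b j; pose Y := (vec_mx w^T)^T.
  have XY : X = - lie f Y.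
    apply/eqP; rewrite -subr_eq0; apply/eqP/trace_nondegenerate => y.
    rewrite mulmxBl mulNmx opprK linearD /=.
    have -> : \tr (X *m y) = (mxvec y *m (B *m z)) 0 0.
      rewrite -sum_gedual mulmxA mxE; apply: eq_bigr => j _.
      by rewrite BE mulrC.
    rewrite hw mulmxA mul_vec_lin /=.
    have -> : w = (mxvec Y^T)^T by rewrite trmxK vec_mxK trmxK.
    rewrite mxvec_trace mxE eqxx mulr1n trace_lie -linearD -mulmxDl /=.
    by rewrite /lie addrA subrK subrr mul0mx mxtrace0.
  have Xe : lie e X = 0.
    by rewrite linear_sum big1 // => j _; rewrite linearZ /= (bas.1 j) scaler0.
  have X0 : X = 0.
    by move: Xe; rewrite XY -linearN => /disj.
  by apply/colP=> j; rewrite mxE (bas.2.1 _ X0).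
case/row_fullP => C CE; pose u := (\row_j t j) *m C *m kermx A.
exists (vec_mx u).
  rewrite /centraliser; apply: (can_inj mxvecK).
  by rewrite -[mxvec (lie _ _)](mul_vec_lin (lie f)) vec_mxK -mulmxA mulmx_ker mulmx0 linear0.
move=> j; rewrite -BE vec_mxK -mulmxA -mulmxA CE mulmx1.
by rewrite mxE.
Qed.

End Gedual.

(** * Positions in a Jordan matrix *)

Section Positions.
Variables (n : nat) (ds : seq nat).

Definition blk (a : nat) : nat := reshape_index (map S ds) a.
Definition off (a : nat) : nat := reshape_offset (map S ds) a.
Definition blk_deg (a : nat) : nat := nth 0%N ds (blk a).
Definition is_end (a : nat) : bool := off a == blk_deg a.
Definition weight (a : nat) : nat := if is_end a then (blk_deg a).+1 else 0.

Hypothesis szn : (sumn ds + size ds)%N = n.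

Lemma sumn_mapS (s : seq nat) : sumn (map S s) = (sumn s + size s)%N.
Proof. by elim: s => //= x s ->; rewrite addnS addSn addnA. Qed.

Lemma blk_lt (a : 'I_n) : (blk a < size ds)%N.
Proof. by have := @reshape_indexP (map S ds) a; rewrite size_map sumn_mapS szn; apply. Qed.

Lemma off_le (a : 'I_n) : (off a <= blk_deg a)%N.
Proof.
have := @reshape_offsetP (map S ds) a; rewrite sumn_mapS szn => /(_ (ltn_ord a)).
by rewrite (nth_map 0%N) ?blk_lt // ltnS.
Qed.

Lemma flat_lt l c : (l < size ds)%N -> (c <= nth 0 ds l)%N ->
  (flatten_index (map S ds) l c < n)%N.
Proof.
by move=> hl hc; rewrite -szn -sumn_mapS; apply: flatten_indexP; rewrite (nth_map 0%N).
Qed.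

Lemma blk_flat l c : (l < size ds)%N -> (c <= nth 0 ds l)%N ->
  blk (flatten_index (map S ds) l c) = l.
Proof. by move=> hl hc; apply: flatten_indexKl; rewrite (nth_map 0%N). Qed.

Lemma off_flat l c : (l < size ds)%N -> (c <= nth 0 ds l)%N ->
  off (flatten_index (map S ds) l c) = c.
Proof. by move=> hl hc; apply: flatten_indexKr; rewrite (nth_map 0%N). Qed.

Lemma exists_pos l c : (l < size ds)%N -> (c <= nth 0 ds l)%N ->
  exists a : 'I_n, blk a = l /\ off a = c.
Proof.
by move=> hl hc; exists (Ordinal (flat_lt hl hc)); rewrite /= blk_flat ?off_flat.
Qed.

Lemma pos_flat a : flatten_index (map S ds) (blk a) (off a) = a.
Proof. exact: reshape_indexK. Qed.

Lemma pos_inj (a c : 'I_n) : blk a = blk c -> off a = off c -> a = c.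
Proof. by move=> h1 h2; apply: val_inj; rewrite /= -[LHS]pos_flat -[RHS]pos_flat h1 h2. Qed.

Lemma next_pos (a : 'I_n) : ~~ is_end a ->
  [/\ (a.+1 < n)%N, blk a.+1 = blk a & off a.+1 = (off a).+1].
Proof.
move=> na; have oa : ((off a).+1 <= nth 0 ds (blk a))%N.
  by have := off_le a; rewrite leq_eqVlt => /orP [] //; rewrite -/(is_end a) (negbTE na).
have e : a.+1 = flatten_index (map S ds) (blk a) (off a).+1.
  by rewrite -[in LHS](pos_flat a) /flatten_index addnS.
by rewrite e flat_lt ?blk_flat ?off_flat ?blk_lt.
Qed.

Lemma exists_end (a : 'I_n) : exists c : 'I_n, blk c = blk a /\ is_end c.
Proof.
have [c [h1 h2]] := @exists_pos (blk a) (blk_deg a) (blk_lt a) (leqnn _).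
by exists c; rewrite /is_end h2 /blk_deg h1.
Qed.

Lemma end_inj (a c : 'I_n) : is_end a -> is_end c -> blk a = blk c -> a = c.
Proof.
by move=> /eqP ha /eqP hc h; apply: pos_inj => //; rewrite ha hc /blk_deg h.
Qed.

Lemma block_startP (a : 'I_n) : (nat_of_ord a \in block_starts ds) = (off a == 0%N).
Proof.
apply/mapP/eqP => [[l]|oa].
  rewrite mem_iota add0n => /andP [_ hl] ->.
  by rewrite -[sumn _]addn0; apply: off_flat.
exists (blk a); first by rewrite mem_iota /= add0n blk_lt.
by rewrite -[LHS]pos_flat /flatten_index oa addn0.
Qed.

Lemma jordan_nilE (K : fieldType) (a c : 'I_n) :
  jordan_nil K n ds a c = ((blk a == blk c) && (off c == (off a).+1))%:R.
Proof.
rewrite mxE; congr (nat_of_bool _)%:R; apply/andP/andP.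
  move=> [/eqP ca st].
  have cst : nat_of_ord c \notin block_starts ds by rewrite ca.
  have na : ~~ is_end a.
    apply: contra cst => ea; apply/mapP.
    have hb : ((blk a).+1 < size ds)%N.
      rewrite ltn_neqAle blk_lt andbT; apply/eqP => e.
      have : (n <= c)%N.
        have sn : sumn (map S ds) = n by rewrite sumn_mapS.
        rewrite ca -(pos_flat a) (eqP ea) /flatten_index /blk_deg -addnS -[X in (X <= _)%N]sn.
        rewrite -[in leqLHS](cat_take_drop (blk a) (map S ds)) sumn_cat leq_add2l.
        rewrite (drop_nth 1%N) ?size_map ?blk_lt // (nth_map 0%N) ?blk_lt //=.
        by rewrite drop_oversize ?size_map ?e // addn0.
      by rewrite leqNgt ltn_ord.
    exists (blk a).+1; first by rewrite mem_iota.
    rewrite ca (take_nth 1%N) ?size_map ?blk_lt // sumn_rcons (nth_map 0%N) ?blk_lt //.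
    by rewrite -[in LHS](pos_flat a) (eqP ea) /flatten_index addnS.
  by have [_ h1 h2] := next_pos na; rewrite ca h1 h2 !eqxx.
move=> [/eqP h1 /eqP h2].
have e : nat_of_ord c = a.+1.
  by rewrite -(pos_flat c) -(pos_flat a) -h1 h2 /flatten_index addnS.
by rewrite e eqxx -e block_startP h2.
Qed.

(** When [ds] is sorted these are [q] heaviest positions, which makes them extremal in the weight
    estimates below. *)
Definition ends_below q : {set 'I_n} := [set a : 'I_n | is_end a && (blk a < q)%N].

Lemma ends_belowS q : (q < size ds)%N ->
  exists c : 'I_n, [/\ c \notin ends_below q, weight c = (nth 0 ds q).+1 &
    ends_below q.+1 = c |: ends_below q].
Proof.
move=> hq; have [c [h1 h2]] := exists_pos hq (leqnn _).
have ec : is_end c by rewrite /is_end /blk_deg h1 h2.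
exists c; rewrite inE ec h1 ltnn /weight ec /blk_deg h1; split=> //.
apply/setP => a; rewrite !inE ltnS leq_eqVlt andb_orr; congr orb.
apply/andP/eqP => [[ea /eqP ba]|->]; last by rewrite ec h1.
by apply: end_inj; rewrite // ba h1.
Qed.

Lemma ends_belowE q : (q <= size ds)%N ->
  #|ends_below q| = q /\ (\sum_(a in ends_below q) weight a)%N = sumn (take q (map S ds)).
Proof.
elim: q => [|q IH] hq.
  have -> : ends_below 0 = set0 by apply/setP => a; rewrite !inE andbF.
  by rewrite cards0 big_set0 take0.
have [c [h1 h2 ->]] := ends_belowS hq; have [IH1 IH2] := IH (ltnW hq).
rewrite cardsU1 h1 IH1 big_setU1 //= IH2 h2; split=> //.
by rewrite (take_nth 0%N) ?size_map // sumn_rcons (nth_map 0%N) // addnC.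
Qed.

Lemma sum_weight : (\sum_(a < n) weight a)%N = n.
Proof.
have [_ h] := ends_belowE (leqnn (size ds)).
rewrite -[RHS]szn -sumn_mapS -[map S ds]take_size size_map -h [RHS]big_mkcond /=.
apply: eq_bigr => a _; rewrite inE blk_lt andbT /weight.
by case: (is_end a).
Qed.

Hypothesis sds : sorted geq ds.

Lemma blk_deg_le (a c : 'I_n) : (blk a <= blk c)%N -> (blk_deg c <= blk_deg a)%N.
Proof.
move=> h; have tr : transitive geq by move=> x y z h1 h2; apply: leq_trans h2 h1.
by apply: (sorted_leq_nth tr leqnn) h; rewrite // inE blk_lt.
Qed.

(** Exchange argument against [ends_below q]: positions outside it weigh at most [th], the weight of
    the end of block [q], those inside at least [th], and [I] has no more elements outside than it
    misses inside. *)
Lemma weight_le (I : {set 'I_n}) q : (#|I| <= q)%N -> (q <= size ds)%N ->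
  (\sum_(a in I) weight a <= sumn (take q (map S ds)))%N.
Proof.
move=> cI hq; have [cE <-] := ends_belowE hq.
set E := ends_below q in cE *.
have [qk|] := ltnP q (size ds); last first.
  move=> kq; rewrite [leqRHS]big_mkcond [leqLHS]big_mkcond /=; apply: leq_sum => a _.
  rewrite inE (leq_trans (blk_lt a) kq) andbT /weight.
  by case: (is_end a); case: (a \in I).
have [c [hc1 hc2]] := exists_pos qk (leqnn _).
pose th := (blk_deg c).+1.
rewrite [leqLHS](big_setID E) [leqRHS](big_setID I) /= setIC leq_add2l.
have cDD : (#|I :\: E| <= #|E :\: I|)%N.
  by rewrite -(leq_add2l #|I :&: E|) cardsID setIC cardsID cE.
apply: (@leq_trans (#|I :\: E| * th)).
  rewrite -sum_nat_const; apply: leq_sum => a; rewrite !inE => /andP [aE _].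
  rewrite /weight; case: ifP aE => //= ea; rewrite -leqNgt => qa.
  by rewrite ltnS blk_deg_le // hc1.
apply: (@leq_trans (#|E :\: I| * th)); first by rewrite leq_mul2r cDD orbT.
rewrite -sum_nat_const; apply: leq_sum => a; rewrite !inE => /andP [_ /andP [ea aq]].
by rewrite /weight ea ltnS blk_deg_le // hc1 ltnW.
Qed.

Lemma pos_group (j : 'I_n) : (sumn (take (blk j) (map S ds)) <= j)%N.
Proof. by rewrite -[leqRHS]pos_flat leq_addr. Qed.

Lemma weight_lt (I : {set 'I_n}) (j : 'I_n) :
  (#|I| <= blk j)%N -> (\sum_(a in I) weight a <= j)%N.
Proof.
move=> cI; apply: leq_trans (pos_group j); apply: weight_le => //.
exact/ltnW/blk_lt.
Qed.

(* Without [a], the set [I] is too light to exceed [j]. *)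
Lemma weight_gt (I : {set 'I_n}) (j a : 'I_n) :
  #|I| = (blk j).+1 -> (j < \sum_(c in I) weight c)%N -> a \in I ->
  is_end a /\ (\sum_(c in I) weight c - j.+1 <= blk_deg a)%N.
Proof.
move=> cI wI aI.
have sj : (\sum_(c in I :\ a) weight c <= j)%N.
  by apply: weight_lt; have := cardsD1 a I; rewrite aI cI add1n => -[->].
have := big_setD1 a aI (F := weight) (aop := addn); rewrite /= => e.
move: wI; rewrite e [weight a]/weight; case: (is_end a) => /= wI.
  by split=> //; move: wI sj; set S := (\sum_(c in _) _)%N; lia.
by move: wI; rewrite add0n ltnNge sj.
Qed.

(** The excess is the mirrored offset of [j] within its block. It decides which slice coordinate is
    paired with [j]. *)
Lemma weight_ends_below (j : 'I_n) :
  (\sum_(a in ends_below (blk j).+1) weight a - j.+1 = blk_deg j - off j)%N /\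
  (j < \sum_(a in ends_below (blk j).+1) weight a)%N.
Proof.
have [_ ->] := ends_belowE (blk_lt j).
rewrite (take_nth 0%N) ?size_map ?blk_lt // sumn_rcons (nth_map 0%N) ?blk_lt //.
have := pos_flat j; rewrite /flatten_index -/(blk_deg j) => e.
by have := off_le j; split; lia.
Qed.

End Positions.

(** * The pencil of a Jordan matrix *)

Section JordanPencil.
Variables (K : fieldType) (n : nat) (ds : seq nat).
Hypothesis szn : (sumn ds + size ds)%N = n.

Local Notation J := (jordan_nil K n ds).
Local Notation blk := (blk ds).
Local Notation off := (off ds).
Local Notation deg := (blk_deg ds).
Local Notation is_end := (is_end ds).
Local Notation weight := (weight ds).

(* The rows of [left_mx] and the columns of [right_mx] at block ends are left and right kernel
   vectors of [X - J] modulo [X ^ (deg + 1)]. *)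
Definition left_mx : 'M[{poly K}]_n := \matrix_(a, c)
  if blk a == blk c then (if is_end a then 'X^(off a - off c) else (a == c)%:R) else 0.

Definition right_mx : 'M[{poly K}]_n := \matrix_(c, a)
  if blk c == blk a then
    (if is_end a then 'X^(off c)
     else if (off a < off c)%N then - 'X^((off c - off a).-1) else 0)
  else 0.

Lemma blk_neq (a c : 'I_n) : blk a != blk c -> (a == c) = false.
Proof. by apply: contraNF => /eqP ->. Qed.

Lemma jordan_row_end (c d : 'I_n) : is_end c -> J c d = 0.
Proof.
move=> /eqP ec; rewrite jordan_nilE //; case: eqP => //= bcd; case: eqP => // oc.
by have := off_le szn d; rewrite oc ec /blk_deg bcd ltnn.
Qed.

Lemma jordan_row_next (c : 'I_n) : ~~ is_end c ->
  exists c' : 'I_n, [/\ blk c' = blk c, off c' = (off c).+1 & forall d, J c d = (d == c')%:R].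
Proof.
move=> nc; have [h1 h2 h3] := next_pos szn nc.
exists (Ordinal h1); split=> // d; rewrite jordan_nilE //; congr (nat_of_bool _)%:R.
apply/andP/eqP => [[/eqP b /eqP o]|->]; last by rewrite /= h2 h3 !eqxx.
by apply: (@pos_inj n ds); rewrite /= ?h2 ?h3.
Qed.

Lemma jordan_col_start (c d : 'I_n) : off d = 0%N -> J c d = 0.
Proof. by move=> od; rewrite jordan_nilE // od andbF. Qed.

Lemma jordan_col_prev (d : 'I_n) : (0 < off d)%N ->
  exists d' : 'I_n, [/\ blk d' = blk d, off d = (off d').+1 & forall c, J c d = (c == d')%:R].
Proof.
move=> od; have [d' [h1 h2]] := exists_pos szn (blk_lt szn d) (leq_trans (leq_pred _) (off_le szn d)).
exists d'; split=> //; first by rewrite h2 prednK.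
move=> c; rewrite jordan_nilE //; congr (nat_of_bool _)%:R.
apply/andP/eqP => [[/eqP b /eqP o]|->]; last by rewrite h1 h2 prednK.
by apply: (@pos_inj n ds); rewrite ?h1 // h2 o.
Qed.

(** The columns telescope along a block. What remains besides the diagonal is a multiple of the
    block-end vector, which the end row of [left_mx] clears. *)
Lemma char_mx_right (a c : 'I_n) : (char_poly_mx J *m right_mx) c a =
  if is_end a then (c == a)%:R * 'X^(weight a)
  else (c == a)%:R - (if (blk c == blk a) && is_end c then 'X^(off c - off a) else 0).
Proof.
have -> : (char_poly_mx J *m right_mx) c a =
    'X * right_mx c a - \sum_d (J c d)%:P * right_mx d a.
  rewrite /char_poly_mx mulmxBl mul_scalar_mx !mxE; congr (_ - _).
  by apply: eq_bigr => d _; rewrite !mxE.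
have [ec|nc] := boolP (is_end c).
  rewrite big1 => [|d _]; last by rewrite jordan_row_end // mul0r.
  rewrite subr0 mxE; have [ea|na] := boolP (is_end a).
    have [b|b] := eqVneq (blk c) (blk a).
      by rewrite (end_inj ec ea b) eqxx mul1r /weight ea -exprS (eqP ea).
    by rewrite mulr0 blk_neq // mul0r.
  have -> : (c == a) = false by apply: contraNF na => /eqP <-.
  rewrite sub0r andbT; have [b|b] := eqVneq (blk c) (blk a); last by rewrite mulr0 oppr0.
  have oac : (off a < off c)%N.
    by rewrite (eqP ec) /blk_deg b ltn_neqAle na (off_le szn).
  by rewrite oac mulrN -exprS prednK ?subn_gt0.
have [c' [bc oc Jc]] := jordan_row_next nc.
rewrite (bigD1 c') //= big1 => [|d dc']; last by rewrite Jc (negbTE dc') mul0r.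
rewrite Jc eqxx mul1r addr0 !mxE bc oc.
have [ea|na] := boolP (is_end a).
  have -> : (c == a) = false by apply: contraNF nc => /eqP ->.
  by rewrite mul0r; case: eqP => _; rewrite ?mulr0 ?subr0 // -exprS subrr.
rewrite andbF subr0; have [b|b] := eqVneq (blk c) (blk a); last first.
  by rewrite mulr0 subr0 blk_neq.
case: (ltngtP (off a) (off c)) => oac.
- rewrite ltnW // mulrN -exprS prednK ?subn_gt0 // opprK subSn ?(ltnW oac) //= addNr.
  by case: eqP oac => // ->; rewrite ltnn.
- rewrite ltnS leqNgt oac /= mulr0 subr0.
  by case: eqP oac => // ->; rewrite ltnn.
- rewrite oac ltnSn subSn // subnn mulr0 sub0r opprK.
  by rewrite (pos_inj b (esym oac)) eqxx.
Qed.

Lemma left_mx_end (r a : 'I_n) : is_end a -> left_mx r a = (r == a)%:R.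
Proof.
move=> ea; rewrite mxE; have [b|b] := eqVneq (blk r) (blk a); last first.
  by rewrite blk_neq.
by case: ifP => // er; rewrite (end_inj er ea b) subnn expr0 eqxx.
Qed.

Lemma left_char_right :
  left_mx *m char_poly_mx J *m right_mx = diag_mx (\row_a 'X^(weight a)).
Proof.
apply/matrixP=> r a; rewrite -mulmxA mxE.
have [ea|na] := boolP (is_end a).
  rewrite (bigD1 a) //= big1 => [|c ca]; last first.
    by rewrite char_mx_right ea (negbTE ca) mul0r mulr0.
  rewrite addr0 char_mx_right ea eqxx mul1r left_mx_end // !mxE.
  by case: eqP => [->|_]; rewrite ?mul1r ?mul0r.
have [z [bz ez]] := exists_end szn a.
have za : z != a by apply: contraNneq na => <-.
rewrite (bigD1 a) //= (bigD1 z) //= big1 => [|c /andP [ca cz]]; last first.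
  rewrite char_mx_right (negbTE na) (negbTE ca) sub0r.
  case: ifP => [/andP [/eqP b ec]|_]; last by rewrite oppr0 mulr0.
  by rewrite (end_inj ec ez) ?b ?bz ?eqxx in cz.
rewrite addr0 !char_mx_right (negbTE na) eqxx (negbTE za) andbF subr0 mulr1.
rewrite bz eqxx ez /= sub0r (left_mx_end r ez) mulrN.
transitivity ((r == a)%:R : {poly K}); last first.
  rewrite !mxE; case: eqP => [->|//].
  by rewrite /weight (negbTE na) expr0.
rewrite [left_mx r a]mxE.
have [->|rz] := eqVneq r z; first by rewrite bz eqxx ez mul1r subrr (negbTE za).
rewrite mul0r subr0; have [b|b] := eqVneq (blk r) (blk a); last by rewrite blk_neq.
by case: ifP => // er; rewrite (end_inj er ez) ?b ?bz ?eqxx in rz.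
Qed.

Lemma char_poly_jordan : char_poly J = 'X^n.
Proof.
rewrite /char_poly -det_tr det_trig.
  rewrite (eq_bigr (fun _ => 'X)) ?prodr_const ?card_ord // => i _.
  rewrite !mxE eqxx mulr1n (_ : (_ == _.+1) = false) ?subr0 //.
  by apply/negbTE; rewrite neq_ltn ltnSn.
apply/is_trig_mxP => i j ij; rewrite !mxE.
have -> : (j == i) = false by apply/negbTE; rewrite -val_eqE neq_ltn ij orbT.
have -> : (nat_of_ord i == j.+1) = false by apply/negbTE; rewrite neq_ltn (ltn_trans ij).
by rewrite /= subr0.
Qed.

(** Taking determinants in [left_char_right] gives ['X^n] on both sides, because the weights add up
    to [n]; cancel it. *)
Lemma det_left_right : \det left_mx * \det right_mx = 1.
Proof.
have := congr1 determinant left_char_right.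
rewrite !det_mulmx det_diag (eq_bigr (fun a : 'I_n => 'X^(weight a))); last first.
  by move=> a _; rewrite mxE.
rewrite prodrXr sum_weight // -[\det (char_poly_mx J)]/(char_poly J) char_poly_jordan.
rewrite mulrAC -[RHS]mul1r => /mulIf; apply.
by rewrite -size_poly_eq0 size_polyXn.
Qed.

Definition reduced_mx (y : 'M[K]_n) : 'M[{poly K}]_n :=
  left_mx *m map_mx polyC y *m right_mx.

Lemma char_poly_expand (y : 'M[K]_n) (s : K) : char_poly (J + s *: y) =
  \sum_(I : {set 'I_n}) ((- s) ^+ #|I|)%:P *
    ('X^(n - (\sum_(a in I) weight a)) * prin_minor (reduced_mx y) I).
Proof.
have -> : char_poly (J + s *: y) =
    \det (diag_mx (\row_a 'X^(weight a)) + (- s)%:P *: reduced_mx y).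
  rewrite -left_char_right /reduced_mx scalemxAl scalemxAr -mulmxDl -mulmxDr.
  rewrite !det_mulmx mulrAC det_left_right mul1r; congr (\det _).
  by apply/matrixP=> i j; rewrite !mxE polyCN polyCD polyCM opprD addrA mulNr.
rewrite det_diag_add; apply: eq_bigr => I _.
rewrite prin_minorZ mulrCA rmorphXn; congr (_ * (_ * _)).
rewrite (eq_bigr (fun a : 'I_n => 'X^(weight a))); last by move=> a _; rewrite mxE.
rewrite prodrXr; congr ('X^_).
rewrite -[X in (X - _)%N](sum_weight szn) [X in (X - _)%N](bigID (fun a => a \in I)) /=.
by rewrite addKn; apply: eq_bigl => a; rewrite inE.
Qed.

(** The part of degree [q] in [y] of [Delta j.+1 (J + y)]; indices are zero-based. The sign combines
    [(- s)^q] with that of the coefficient of the characteristic polynomial. *)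
Definition component (q : nat) (j : 'I_n) (y : 'M[K]_n) : K :=
  (-1) ^+ (q + j.+1) * \sum_(I : {set 'I_n} | #|I| == q)
    ('X^(n - (\sum_(a in I) weight a)) * prin_minor (reduced_mx y) I)`_(n - j.+1).

Lemma Delta_component (j : 'I_n) (y : 'M[K]_n) (s : K) :
  Delta j.+1 (J + s *: y) = (\poly_(q < n.+1) component q j y).[s].
Proof.
have := @char_poly_coef_Delta K n (J + s *: y) j.+1 (ltn_ord j).
move/(congr1 (fun x => (-1) ^+ j.+1 * x)); rewrite signrMK => <-.
rewrite char_poly_expand coef_sum horner_poly mulr_sumr.
rewrite (partition_big (fun I : {set 'I_n} => inord #|I| : 'I_n.+1) predT) //=.
apply: eq_bigr => q _; rewrite /component mulr_sumr mulr_suml.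
have cI (I : {set 'I_n}) : (#|I| < n.+1)%N by rewrite ltnS -[leqRHS]card_ord max_card.
apply: eq_big => [I|I /eqP <-]; first by rewrite -val_eqE /= inordK.
by rewrite coefCM inordK // [(- s) ^+ _]exprNn exprD; ring.
Qed.

(** Sets of weight at most [j] contribute nothing to [component]; without the inequality, truncated
    subtraction would count their constant coefficients. [Y] is arbitrary so that slices can be
    inserted directly. *)
Definition leading_form (j : 'I_n) (Y : 'M[{poly K}]_n) : K :=
  \sum_(I : {set 'I_n} | (#|I| == (blk j).+1) && (j < \sum_(a in I) weight a)%N)
     (prin_minor Y I)`_((\sum_(a in I) weight a)%N - j.+1).

Hypothesis sds : sorted geq ds.

Lemma component_eq0 q (j : 'I_n) y : (q <= blk j)%N -> component q j y = 0.
Proof.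
move=> qj; rewrite /component big1 ?mulr0 // => I /eqP cI.
have : (\sum_(a in I) weight a <= j)%N by apply: weight_lt; rewrite // cI.
rewrite coefXnM => wI; case: ltnP => // h; have := ltn_ord j; lia.
Qed.

Lemma component_lead (j : 'I_n) y :
  component (blk j).+1 j y = (-1) ^+ ((blk j).+1 + j.+1) * leading_form j (reduced_mx y).
Proof.
rewrite /component /leading_form; congr (_ * _).
rewrite [RHS]big_mkcondr /=; apply: eq_bigr => I _; rewrite coefXnM.
have wn : (\sum_(a in I) weight a <= n)%N.
  by rewrite -[leqRHS](sum_weight szn) [leqRHS](bigID (fun a => a \in I)) leq_addr.
have := ltn_ord j; move: wn; set w := (\sum_(a in I) _)%N => wn jn.
case: ltnP => h; case: ltnP => h2 //; first by lia.
  by congr (_`_ _); lia.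
by lia.
Qed.

End JordanPencil.

(** Congruence modulo ['X^t.+1]. *)
Definition eq_upto (K : fieldType) (t : nat) (p q : {poly K}) : Prop :=
  forall s, (s <= t)%N -> p`_s = q`_s.

Lemma eq_uptoM (K : fieldType) t (p q p' q' : {poly K}) :
  eq_upto t p p' -> eq_upto t q q' -> eq_upto t (p * q) (p' * q').
Proof.
move=> hp hq s st; rewrite !coefM; apply: eq_bigr => i _.
by rewrite hp ?hq //; apply: leq_trans st; rewrite ?leq_subr // -ltnS.
Qed.

Lemma prin_minor_upto (K : fieldType) n t (Y Z : 'M[{poly K}]_n) (I : {set 'I_n}) :
  {in I &, forall a c, eq_upto t (Y a c) (Z a c)} ->
  eq_upto t (prin_minor Y I) (prin_minor Z I).
Proof.
move=> YZ s st; rewrite /prin_minor !coef_sum; apply: eq_bigr => g gI.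
apply: (@eq_uptoM _ t) st => //.
apply: (big_ind2 (eq_upto t)) => // [p p' q q' h1 h2|a aI]; first exact: eq_uptoM.
by apply: YZ; rewrite // perm_closed.
Qed.

(** * Truncated coefficients and the centraliser *)

Section Reduced.
Variables (K : fieldType) (n : nat) (ds : seq nat).
Hypothesis szn : (sumn ds + size ds)%N = n.
Hypothesis sds : sorted geq ds.

Local Notation J := (jordan_nil K n ds).
Local Notation blk := (blk ds).
Local Notation off := (off ds).
Local Notation deg := (blk_deg ds).
Local Notation is_end := (is_end ds).
Local Notation weight := (weight ds).
Local Notation left_mx := (left_mx K n ds).
Local Notation right_mx := (right_mx K n ds).
Local Notation reduced_mx := (@reduced_mx K n ds).

(** By [weight_gt], a contributing set consists of block ends, and the coefficient extracted has
    index at most [deg a] for each of its members [a]. *)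
Lemma leading_form_upto (j : 'I_n) (Y Z : 'M[{poly K}]_n) :
  (forall a c : 'I_n, is_end a -> is_end c -> eq_upto (minn (deg a) (deg c)) (Y a c) (Z a c)) ->
  leading_form ds j Y = leading_form ds j Z.
Proof.
move=> YZ; apply: eq_bigr => I /andP [/eqP cI wI].
apply: prin_minor_upto (leqnn _) => a c aI cI' s hs.
have [ea wa] := weight_gt szn sds cI wI aI.
have [ec wc] := weight_gt szn sds cI wI cI'.
apply: YZ => //.
by rewrite leq_min (leq_trans hs wa) (leq_trans hs wc).
Qed.

Lemma left_mx_jordan (a l : 'I_n) : is_end a ->
  \sum_d left_mx a d * (J d l)%:P =
  'X * left_mx a l - (if (blk l == blk a) && (off l == 0%N) then 'X^(weight a) else 0).
Proof.
move=> ea; have [ol|ol] := eqVneq (off l) 0%N.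
  rewrite big1 => [|d _]; last by rewrite jordan_col_start // mulr0.
  rewrite andbT eq_sym mxE ea ol subn0 /weight ea -(eqP ea) exprS.
  by case: ifP => _; rewrite ?subrr ?mulr0 ?subrr.
rewrite andbF subr0; move: ol; rewrite -lt0n => /(jordan_col_prev K szn) [d' [bd od Jd]].
rewrite (bigD1 d') //= big1 => [|d dd']; last by rewrite Jd (negbTE dd') mulr0.
rewrite Jd eqxx mulr1 addr0 !mxE bd; case: eqP => [b|_]; last by rewrite mulr0.
have ol : (off l <= off a)%N by rewrite (eqP ea) /blk_deg b off_le.
by rewrite ea -exprS -subSn // od subSS.
Qed.

Lemma right_mx_jordan (c i : 'I_n) : is_end c ->
  \sum_d (J i d)%:P * right_mx d c = 'X * right_mx i c - (i == c)%:R * 'X^(weight c).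
Proof.
move=> ec; have := char_mx_right K szn c i; rewrite ec => <-.
rewrite /char_poly_mx mulmxBl mul_scalar_mx !mxE opprB addrCA subrr addr0.
by apply: eq_bigr => d _; rewrite !mxE.
Qed.

Lemma reduced_mxE y (a c : 'I_n) :
  reduced_mx y a c = \sum_i \sum_l (y l i)%:P * (right_mx i c * left_mx a l).
Proof.
rewrite mxE; apply: eq_bigr => i _; rewrite mxE mulr_suml; apply: eq_bigr => l _.
by rewrite [map_mx _ _ _ _]mxE; ring.
Qed.

(* Low coefficients of [reduced_mx] pair with the centraliser, since a right kernel vector times
   a left kernel vector of the pencil, truncated, commutes with [J]. *)
Lemma reduced_mx_trace (a c : 'I_n) s :
  is_end a -> is_end c -> (s <= minn (deg a) (deg c))%N ->
  exists2 x, centraliser J x & forall y, (reduced_mx y a c)`_s = \tr (x *m y).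
Proof.
move=> ea ec; rewrite leq_min => /andP [sa sc].
pose x : 'M[K]_n := \matrix_(i, l) (right_mx i c * left_mx a l)`_s.
exists x; last first.
  move=> y; rewrite reduced_mxE coef_sum; apply: eq_bigr => i _.
  rewrite coef_sum [RHS]mxE; apply: eq_bigr => l _.
  by rewrite coefCM mulrC; congr (_ * _); rewrite [RHS]mxE.
apply/matrixP => i l; rewrite [LHS]mxE [X in _ + X]mxE [X in X - _]mxE [X in _ - X]mxE [RHS]mxE.
have -> : \sum_d J i d * x d l = ((\sum_d (J i d)%:P * right_mx d c) * left_mx a l)`_s.
  by rewrite mulr_suml coef_sum; apply: eq_bigr => d _; rewrite [x d l]mxE -mulrA coefCM.
have -> : \sum_d x i d * J d l = (right_mx i c * \sum_d left_mx a d * (J d l)%:P)`_s.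
  rewrite mulr_sumr coef_sum; apply: eq_bigr => d _.
  by rewrite [x i d]mxE mulrA coefMC.
rewrite left_mx_jordan // right_mx_jordan // mulrBl mulrBr !coefB.
have -> : ((i == c)%:R * 'X^(weight c) * left_mx a l)`_s = 0.
  by rewrite mulrAC coefMXn /weight ec ltnS sc.
have -> : (right_mx i c * (if (blk l == blk a) && (off l == 0%N) then 'X^(weight a) else 0))`_s = 0.
  case: ifP => _; last by rewrite mulr0 coef0.
  by rewrite coefMXn /weight ea ltnS sa.
by rewrite !subr0 mulrCA mulrA subrr.
Qed.

Lemma leading_form_trace (j : 'I_n) y z :
  (forall x, centraliser J x -> \tr (x *m y) = \tr (x *m z)) ->
  leading_form ds j (reduced_mx y) = leading_form ds j (reduced_mx z).
Proof.
move=> yz; apply: leading_form_upto => a c ea ec s hs.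
by have [x xJ xE] := reduced_mx_trace ea ec hs; rewrite !xE yz.
Qed.

Lemma reduced_mx_end_rows (y : 'M[K]_n) (a c : 'I_n) : is_end a -> is_end c ->
  (forall l i : 'I_n, ~~ is_end l -> y l i = 0) ->
  reduced_mx y a c = \sum_(i < n | blk i == blk c) (y a i)%:P * 'X^(off i).
Proof.
move=> ea ec y0; rewrite reduced_mxE [RHS]big_mkcond; apply: eq_bigr => i _.
rewrite (bigD1 a) //= big1 => [|l la].
  rewrite addr0 !mxE eqxx ea subnn mulr1 ec.
  by case: ifP => _; rewrite ?mulr0.
have [el|nl] := boolP (is_end l); last by rewrite y0 // mul0r.
rewrite left_mx_end // eq_sym (negbTE la) !mulr0 //.
Qed.

End Reduced.

(** * Hessenberg slices *)

Section Hessenberg.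
Variables (K : fieldType) (n : nat) (ds : seq nat).
Hypothesis szn : (sumn ds + size ds)%N = n.
Hypothesis sds : sorted geq ds.

Local Notation blk := (blk ds).
Local Notation off := (off ds).
Local Notation deg := (blk_deg ds).
Local Notation is_end := (is_end ds).
Local Notation weight := (weight ds).
Local Notation ends_below := (@ends_below n ds).

Variable C : nat -> nat -> K.
Hypothesis C_low : forall i l, (l.+1 < i)%N -> C i l = 0.
Hypothesis C_sub : forall i, (i.+1 < size ds)%N -> C i.+1 i != 0.

Definition row_poly (v : 'I_n -> K) (c : 'I_n) : {poly K} :=
  \sum_(i < n | blk i == blk c) (v i)%:P * 'X^(off i).

Definition slice_mx (v : 'I_n -> K) : 'M[{poly K}]_n :=
  \matrix_(a, c) ((C (blk a) (blk c))%:P + (if blk a == 0%N then row_poly v c else 0)).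

(** The cofactor of the entry in the row of block 0 and column [l]. *)
Definition unit_row_minor (l : 'I_n) (I : {set 'I_n}) : K :=
  prin_minor (\matrix_(a < n, c < n) if blk a == 0%N then (c == l)%:R else C (blk a) (blk c)) I.

Lemma prin_minor_slice v (I : {set 'I_n}) (e0 : 'I_n) :
  (forall a : 'I_n, a \in I -> is_end a) -> e0 \in I -> blk e0 = 0%N ->
  prin_minor (slice_mx v) I = prin_minor (slice_mx (fun=> 0)) I +
    \sum_(l in I) row_poly v l * (unit_row_minor l I)%:P.
Proof.
move=> endI e0I b0.
have ne0 a : a \in I -> a != e0 -> (blk a == 0%N) = false.
  move=> aI ae; apply: contraNF ae => /eqP ba; apply/eqP.
  by apply: (end_inj (endI a aI) (endI e0 e0I)); rewrite ba b0.
have row0 c : row_poly (fun=> 0) c = 0.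
  by rewrite /row_poly big1 // => i _; rewrite mul0r.
rewrite /unit_row_minor /prin_minor.
under [X in _ = _ + X]eq_bigr => l _ do rewrite raddf_sum mulr_sumr /=.
rewrite exchange_big -big_split /=; apply: eq_bigr => g gI.
rewrite (bigD1 e0) //= [X in _ = _ * X + _](bigD1 e0) //=.
set P := \prod_(i in I | i != e0) _; set Q := \prod_(i in I | i != e0) _.
have -> : Q = P.
  by apply: eq_bigr => a /andP [aI ae]; rewrite !mxE ne0 ?addr0.
rewrite !mxE b0 eqxx row0 addr0 mulrDl mulrDr; congr (_ + _).
rewrite (bigD1 (g e0)) ?perm_closed //= [X in _ = _ + X]big1 => [|l /andP [lI lg]]; last first.
  by rewrite (bigD1 e0) //= mxE b0 eqxx eq_sym (negbTE lg) mul0r mulr0 mulr0.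
rewrite addr0 (bigD1 e0) //= mxE b0 !eqxx mul1r rmorphM rmorph_sign rmorph_prod.
rewrite mulrCA; congr (_ * (_ * _)).
by apply: eq_bigr => a /andP [aI ae]; rewrite !mxE ne0 ?addr0.
Qed.

(** A contributing permutation sends [e0] to [l], and by the Hessenberg shape it lowers the block
    index by at most one, so it cannot come back across a block missing from [I]. *)
Lemma unit_row_minor_support (l e0 : 'I_n) (I : {set 'I_n}) :
  (forall a : 'I_n, a \in I -> is_end a) -> e0 \in I -> blk e0 = 0%N -> l \in I ->
  unit_row_minor l I != 0 -> ends_below (blk l).+1 \subset I.
Proof.
move=> endI e0I b0 lI; apply: contraR => /subsetPn [b]; rewrite inE ltnS => /andP [eb bl] bI.
rewrite /unit_row_minor /prin_minor big1 // => g gI.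
set P := (X in _ * X); have [->|] := eqVneq P 0; first by rewrite mulr0.
rewrite /P => /prodf_neq0 nz.
exfalso.
have ge0 : g e0 = l.
  by have := nz e0 e0I; rewrite mxE b0 eqxx; case: (g e0 =P l) => // _; rewrite eqxx.
have bl' : (blk b < blk l)%N.
  rewrite ltn_neqAle bl andbT; apply: contraNneq bI => h.
  by rewrite (end_inj eb (endI l lI) h).
(* The part of [I] beyond the missing block: [g] would map it together with [e0] injectively into
   itself. *)
pose S := [set a in I | (blk b < blk a)%N].
have gS : g @: (e0 |: S) \subset S.
  apply/subsetP => _ /imsetP [a aS ->].
  case/setU1P: aS => [->|]; first by rewrite inE ge0 lI.
  rewrite inE => /andP [aI ab].
  have gaI : g a \in I by rewrite perm_closed.
  rewrite inE gaI /= ltn_neqAle; apply/andP; split.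
    by apply: contraNneq bI => h; rewrite (end_inj eb (endI _ gaI) h).
  have := nz a aI; rewrite mxE.
  have -> : (blk a == 0%N) = false by case: (blk a) ab.
  by apply: contraNT; rewrite -ltnNge => h; rewrite C_low //; apply: leq_trans ab.
have e0S : e0 \notin S by rewrite inE b0 andbF.
have := subset_leq_card gS; rewrite card_imset; last exact: perm_inj.
by rewrite cardsU1 e0S add1n ltnn.
Qed.

(** Deleting the row of block 0 and column [l] leaves a triangular matrix with subdiagonal entries
    of [C] on its diagonal. A null vector is thus killed from block [blk l] downwards in index. *)
Lemma unit_row_minor_neq0 (l : 'I_n) : is_end l ->
  unit_row_minor l (ends_below (blk l).+1) != 0.
Proof.
move=> el; rewrite /unit_row_minor prin_minor_det -det_tr.
set I := ends_below _; apply/det0P => -[z zn0 zN]; case/eqP: zn0.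
have bk := blk_lt szn l.
have lI : l \in I by rewrite inE el ltnSn.
have {}zN a : \sum_c z 0 c * (if a \in I then
     if blk a == 0%N then (c == l)%:R else C (blk a) (blk c) else (a == c)%:R) = 0.
  have := congr1 (fun u : 'rV_n => u 0 a) zN; rewrite !mxE => e; rewrite -[RHS]e.
  by apply: eq_bigr => c _; rewrite !mxE.
have zout c : c \notin I -> z 0 c = 0.
  move=> cI; have := zN c; rewrite (negbTE cI) (bigD1 c) //= eqxx mulr1 big1 ?addr0 // => d dc.
  by rewrite eq_sym (negbTE dc) mulr0.
have zl : z 0 l = 0.
  have [e0 [b0 o0]] := exists_pos szn (leq_ltn_trans (leq0n _) bk) (leqnn _).
  have e0I : e0 \in I by rewrite inE /is_end o0 /blk_deg b0 eqxx.
  have := zN e0; rewrite e0I b0 eqxx (bigD1 l) //= eqxx mulr1 big1 ?addr0 // => d dl.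
  by rewrite (negbTE dl) mulr0.
suff H m : forall c, c \in I -> (blk l - blk c <= m)%N -> z 0 c = 0.
  by apply/rowP => c; rewrite mxE; have [cI|/zout //] := boolP (c \in I); apply: H cI (leqnn _).
elim: m => [|m IH] c cI; move: (cI); rewrite inE ltnS => /andP [ec cl].
  by rewrite leqn0 subn_eq0 => lc; rewrite (end_inj ec el) //; apply/eqP; rewrite eqn_leq cl lc.
move=> cm; have [/eqP e|ne] := eqVneq (blk c) (blk l).
  by rewrite (end_inj ec el (eqP e)).
have {}cl : (blk c < blk l)%N by rewrite ltn_neqAle ne cl.
have [a [ba oa]] := exists_pos szn (leq_ltn_trans cl bk) (leqnn _).
have aI : a \in I by rewrite inE /is_end oa /blk_deg ba eqxx /= ltnS.
have := zN a; rewrite aI ba /= (bigD1 c) //= big1 => [|d dc].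
  rewrite addr0 => /eqP; rewrite mulf_eq0 => /orP [/eqP //|].
  by rewrite (negbTE (C_sub _)) // (leq_ltn_trans cl bk).
have [dI|/zout ->] := boolP (d \in I); last by rewrite mul0r.
move: (dI); rewrite inE => /andP [ed _].
case: (ltngtP (blk d) (blk c)) => h.
- by rewrite C_low ?mulr0.
- by rewrite (IH d dI) ?mul0r // -ltnS (leq_trans _ cm) // ltn_sub2l.
- by rewrite (end_inj ed ec h) eqxx in dc.
Qed.

Definition slice_coef (j i : 'I_n) : K :=
  \sum_(I : {set 'I_n} | (#|I| == (blk j).+1) && (j < \sum_(a in I) weight a)%N)
    (if [exists e0 in I, blk e0 == 0%N] then
       \sum_(l in I | blk i == blk l)
         (if off i == ((\sum_(a in I) weight a)%N - j.+1)%N then unit_row_minor l I else 0)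
     else 0).

Lemma coef_row_poly v c t :
  (row_poly v c)`_t = \sum_(i < n | blk i == blk c) (if off i == t then v i else 0).
Proof.
rewrite coef_sum; apply: eq_bigr => i _; rewrite coefCM coefXn eq_sym.
by case: eqP; rewrite ?mulr1 ?mulr0.
Qed.

Lemma leading_form_slice (j : 'I_n) v :
  leading_form ds j (slice_mx v) =
  leading_form ds j (slice_mx (fun=> 0)) + \sum_i slice_coef j i * v i.
Proof.
under [X in _ = _ + X]eq_bigr => i _ do rewrite mulr_suml.
rewrite exchange_big -big_split /=; apply: eq_bigr => I /andP [/eqP cI wI].
have endI a : a \in I -> is_end a by move=> aI; have [] := weight_gt szn sds cI wI aI.
set t := (_ - j.+1)%N.
have [ex|ne] := boolP [exists e0 in I, blk e0 == 0%N].
  have [e0 e0I /eqP b0] := exists_inP ex.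
  rewrite (prin_minor_slice v endI e0I b0) coefD; congr (_ + _).
  rewrite coef_sum; under [RHS]eq_bigr => i _ do rewrite mulr_suml big_mkcondr /=.
  rewrite exchange_big /=; apply: eq_bigr => l lI.
  rewrite coefMC coef_row_poly mulr_suml [LHS]big_mkcond /=; apply: eq_bigr => i _.
  by case: eqP => // _; case: eqP; rewrite ?mul0r // mulrC.
rewrite big1 ?addr0 => [|i _]; last by rewrite mul0r.
rewrite (@eq_prin_minor _ _ _ (slice_mx (fun=> 0))) // => a c aI _; rewrite !mxE.
by move/exists_inPn: ne => /(_ a aI) /negbTE ->.
Qed.

(** [I] has [blk j + 1] elements and contains the first [blk l + 1] block ends. *)
Lemma slice_coef_term (I : {set 'I_n}) (j l : 'I_n) :
  #|I| = (blk j).+1 -> (j < \sum_(a in I) weight a)%N -> [exists e0 in I, blk e0 == 0%N] ->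
  l \in I -> unit_row_minor l I != 0 ->
  (blk l <= blk j)%N /\ (blk l = blk j -> I = ends_below (blk j).+1).
Proof.
move=> cI wI /exists_inP [e0 e0I /eqP b0] lI nz.
have endI a : a \in I -> is_end a by move=> aI; have [] := weight_gt szn sds cI wI aI.
have sub := unit_row_minor_support endI e0I b0 lI nz.
have [c _] := ends_belowE szn (blk_lt szn l).
split; first by have := subset_leq_card sub; rewrite c cI ltnS.
by move=> e; apply/esym/eqP; rewrite eqEcard -e sub cI c e ltnSn.
Qed.

Lemma slice_coef_eq0 (j i : 'I_n) :
  (blk j < blk i)%N \/ (blk i = blk j /\ off i != (deg j - off j)%N) -> slice_coef j i = 0.
Proof.
move=> h; apply: big1 => I /andP [/eqP cI wI]; case: ifP => // ex.
apply: big1 => l /andP [lI /eqP bil]; case: eqP => // oi; apply/eqP/negPn/negP => nz.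
have [h1 h2] := slice_coef_term cI wI ex lI nz.
case: h => [|[bij]]; first by rewrite bil ltnNge h1.
by rewrite oi h2 -?bil // (weight_ends_below szn sds j).1 eqxx.
Qed.

Lemma slice_coef_neq0 (j i : 'I_n) :
  blk i = blk j -> off i = (deg j - off j)%N -> slice_coef j i != 0.
Proof.
move=> bij oi; have [l [bl el]] := exists_end szn j.
set E := ends_below (blk j).+1.
have [cE _] := ends_belowE szn (blk_lt szn j).
have [w1 w2] := weight_ends_below szn sds j.
have lE : l \in E by rewrite inE el bl ltnSn.
have exE : [exists e0 in E, blk e0 == 0%N].
  have [e0 [b0 o0]] := exists_pos szn (leq_ltn_trans (leq0n _) (blk_lt szn j)) (leqnn _).
  by apply/exists_inP; exists e0; rewrite ?b0 // inE /is_end o0 /blk_deg b0 eqxx.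
rewrite /slice_coef (bigD1 E) /=; last by rewrite cE eqxx.
rewrite [X in _ + X]big1 => [|I /andP [/andP [/eqP cI wI] IE]]; last first.
  case: ifP => // ex; apply: big1 => l' /andP [lI /eqP bil]; case: eqP => // _.
  apply/eqP/negPn/negP => nz; have [_ h2] := slice_coef_term cI wI ex lI nz.
  by rewrite h2 ?eqxx // -?bil in IE.
rewrite addr0 exE (bigD1 l) /=; last by rewrite lE bij bl eqxx.
rewrite [X in _ + X]big1 => [|l' /andP [/andP [lI /eqP bil] ll]]; last first.
  move: lI; rewrite inE => /andP [el' _].
  by rewrite (end_inj el' el) ?eqxx // -?bil ?bij ?bl in ll.
by rewrite addr0 w1 oi eqxx /E -bl unit_row_minor_neq0.
Qed.

Definition slice_coef_mx : 'M[K]_n := \matrix_(j, i) slice_coef j i.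

(** The matrix is triangular with respect to blocks, and each diagonal block is antidiagonal with
    nonzero entries, pairing offset [o] with [deg - o]. *)
Lemma slice_coef_unit : slice_coef_mx \in unitmx.
Proof.
rewrite unitmxE -det_tr unitfE; apply/negP => /det0P [z zn0 zT]; case/eqP: zn0.
suff H m : forall i : 'I_n, (blk i <= m)%N -> z 0 i = 0.
  by apply/rowP => i; rewrite mxE; apply: H (leqnn _).
elim/ltn_ind: m => m IH i im.
have [j [bj oj]] := exists_pos szn (blk_lt szn i) (leq_subr (off i) (deg i)).
have oi : off i = (deg j - off j)%N by rewrite oj /blk_deg bj subKn // off_le.
have := congr1 (fun u : 'rV_n => u 0 j) zT; rewrite !mxE (bigD1 i) //= big1 => [|d di].
  rewrite addr0 !mxE => /eqP; rewrite mulf_eq0 (negbTE (slice_coef_neq0 _ _)) ?bj // orbF.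
  by move/eqP.
rewrite !mxE; case: (ltngtP (blk d) (blk i)) => h.
- by rewrite (IH (blk d)) ?mul0r // (leq_trans h).
- by rewrite slice_coef_eq0 ?mulr0 //; left; rewrite bj.
- rewrite slice_coef_eq0 ?mulr0 //; right; rewrite bj h; split=> //.
  by apply: contraNneq di => od; apply/eqP/(pos_inj h); rewrite od oi.
Qed.

End Hessenberg.

(** * Transversality *)

Section Slices.
Variables (K : fieldType) (n : nat) (ds : seq nat).
Hypothesis szn : (sumn ds + size ds)%N = n.
Hypothesis sds : sorted geq ds.

Local Notation J := (jordan_nil K n ds).
Local Notation blk := (blk ds).
Local Notation off := (off ds).
Local Notation deg := (blk_deg ds).
Local Notation is_end := (is_end ds).
Local Notation weight := (weight ds).
Local Notation left_mx := (left_mx K n ds).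
Local Notation right_mx := (right_mx K n ds).
Local Notation reduced_mx := (@reduced_mx K n ds).

(** Entries are placed in rows of block ends and columns of block starts, where [reduced_mx] reads
    them as constants. *)
Definition const_slice (C : nat -> nat -> K) : 'M[K]_n :=
  \matrix_(a, i) if is_end a && (off i == 0%N) then C (blk a) (blk i) else 0.

Definition row_direction (v : 'I_n -> K) : 'M[K]_n :=
  \matrix_(a, i) if is_end a && (blk a == 0%N) then v i else 0.

(** The transposed analogue of [row_direction], still supported on rows of block ends. The sum has
    at most one term and is empty when the offset of [i] exceeds the length of the block of [a]. *)
Definition col_direction (v : 'I_n -> K) : 'M[K]_n :=
  \matrix_(a, i) if is_end a && (blk i == 0%N) then
    \sum_(d < n | (blk d == blk a) && (off d == off i)) v d else 0.

Lemma reduced_mxD y z : reduced_mx (y + z) = reduced_mx y + reduced_mx z.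
Proof. by rewrite /reduced_mx map_mxD mulmxDr mulmxDl. Qed.

Lemma reduced_mxB y z : reduced_mx (y - z) = reduced_mx y - reduced_mx z.
Proof. by rewrite /reduced_mx map_mxB mulmxBr mulmxBl. Qed.

Lemma reduced_const_slice C (a c : 'I_n) : is_end a -> is_end c ->
  reduced_mx (const_slice C) a c = (C (blk a) (blk c))%:P.
Proof.
move=> ea ec; rewrite reduced_mx_end_rows // => [|l i nl]; last by rewrite mxE (negbTE nl).
have [d [bd od]] := exists_pos szn (blk_lt szn c) (leq0n _).
rewrite (bigD1 d) /=; last by rewrite bd.
rewrite big1 ?addr0 => [|i /andP [/eqP bi id]].
  by rewrite mxE ea od eqxx bd expr0 mulr1.
rewrite mxE ea /=; case: eqP => oi; last by rewrite mul0r.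
by rewrite (@pos_inj n ds i d) ?eqxx // ?bi ?bd ?oi ?od in id.
Qed.

Lemma reduced_row_direction v (a c : 'I_n) : is_end a -> is_end c ->
  reduced_mx (row_direction v) a c = if blk a == 0%N then row_poly ds v c else 0.
Proof.
move=> ea ec; rewrite reduced_mx_end_rows // => [|l i nl]; last by rewrite mxE (negbTE nl).
case: ifP => b0; last by apply: big1 => i _; rewrite mxE b0 andbF mul0r.
by apply: eq_bigr => i _; rewrite mxE b0 ea.
Qed.

Lemma reduced_col_direction v (a c : 'I_n) : is_end a -> is_end c ->
  reduced_mx (col_direction v) a c = if blk c == 0%N then row_poly ds v a else 0.
Proof.
move=> ea ec; rewrite reduced_mx_end_rows // => [|l i nl]; last by rewrite mxE (negbTE nl).
case: ifPn => [/eqP b0|b0]; last first.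
  by apply: big1 => i /eqP bi; rewrite mxE bi (negbTE b0) andbF mul0r.
rewrite b0 /row_poly.
under eq_bigr => i bi do rewrite mxE ea bi /= raddf_sum mulr_suml big_mkcondr /=.
rewrite exchange_big /=; apply: eq_bigr => d /eqP bd.
have hd : (off d <= nth 0 ds 0)%N.
  have dc : (deg d <= deg c)%N by apply: (blk_deg_le szn sds); rewrite b0.
  by move: dc; rewrite [deg c]/blk_deg b0; apply: leq_trans; exact: off_le.
have [i [bi oi]] := exists_pos szn (leq_ltn_trans (leq0n _) (blk_lt szn d)) hd.
rewrite (bigD1 i) /=; last by rewrite bi.
rewrite oi eqxx big1 ?addr0 // => i' /andP [/eqP bi' ii].
case: eqP => // od; case/eqP: ii; apply: (@pos_inj n ds); first by rewrite bi bi'.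
by rewrite oi od.
Qed.

Lemma leading_form_row_slice (j : 'I_n) C v :
  leading_form ds j (reduced_mx (const_slice C + row_direction v)) =
  leading_form ds j (slice_mx ds C v).
Proof.
apply: leading_form_upto => // a c ea ec; rewrite reduced_mxD mxE.
by rewrite reduced_const_slice // reduced_row_direction // mxE.
Qed.

Lemma leading_form_tr (j : 'I_n) (Y : 'M[{poly K}]_n) :
  leading_form ds j Y^T = leading_form ds j Y.
Proof. by apply: eq_bigr => I _; rewrite prin_minor_tr. Qed.

Lemma leading_form_col_slice (j : 'I_n) C v :
  leading_form ds j (reduced_mx (const_slice C + col_direction v)) =
  leading_form ds j (slice_mx ds (fun i l => C l i) v).
Proof.
rewrite -[RHS]leading_form_tr.
apply: leading_form_upto => // a c ea ec; rewrite reduced_mxD mxE.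
by rewrite reduced_const_slice // reduced_col_direction // !mxE.
Qed.

Lemma trace_row_direction (X : 'M[K]_n) (e0 i : 'I_n) : is_end e0 -> blk e0 = 0%N ->
  \tr (X *m row_direction (fun d => (d == i)%:R)) = X i e0.
Proof.
move=> ee b0; rewrite mxtrace_mulC /mxtrace (bigD1 e0) //= big1 => [|a ae]; last first.
  rewrite mxE big1 // => d _; rewrite mxE; case: ifP => [/andP [ea /eqP ba]|_]; last by rewrite mul0r.
  by rewrite (end_inj ea ee) ?eqxx ?ba ?b0 in ae.
rewrite addr0 mxE (bigD1 i) //= big1 => [|d di]; last first.
  by rewrite mxE ee b0 eqxx /= (negbTE di) mul0r.
by rewrite addr0 mxE ee b0 !eqxx mul1r.
Qed.

Section Transversality.
Variable X : 'M[K]_n.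
Hypothesis XJ : centraliser J X.

Local Notation XR := (map_mx polyC X *m right_mx).
Local Notation LX := (left_mx *m map_mx polyC X).

Lemma left_char_mx (a l : 'I_n) : is_end a -> (left_mx *m char_poly_mx J) a l =
  if (blk l == blk a) && (off l == 0%N) then 'X^(weight a) else 0.
Proof.
move=> ea; rewrite /char_poly_mx mulmxBr mul_mx_scalar !mxE.
have -> : \sum_d left_mx a d * (map_mx polyC J) d l = \sum_d left_mx a d * (J d l)%:P.
  by apply: eq_bigr => d _; rewrite [map_mx _ _ _ _]mxE.
by rewrite (left_mx_jordan K szn l ea) mxE opprB addrCA subrr addr0.
Qed.

(** Both sides are the entry [(a, c)] of [left_mx * X * ('X - J) * right_mx], since the matrix [X]
    commutes with the pencil ['X - J]. *)
Lemma LX_XR (a c d : 'I_n) : is_end a -> is_end c -> blk d = blk a -> off d = 0%N ->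
  LX a c * 'X^(weight c) = XR d c * 'X^(weight a).
Proof.
move=> ea ec bd od.
have -> : LX a c * 'X^(weight c) = (LX *m (char_poly_mx J *m right_mx)) a c.
  rewrite [RHS]mxE (bigD1 c) //= big1 => [|i ic]; last first.
    by rewrite char_mx_right // ec (negbTE ic) mul0r mulr0.
  by rewrite addr0 char_mx_right // ec eqxx mul1r.
have -> : XR d c * 'X^(weight a) = ((left_mx *m char_poly_mx J) *m XR) a c.
  rewrite [RHS]mxE (bigD1 d) //= big1 => [|i id]; last first.
    rewrite left_char_mx //; case: ifP => [/andP [/eqP bi /eqP oi]|_]; last by rewrite mul0r.
    by rewrite (@pos_inj n ds i d) ?eqxx // ?bi ?bd ?oi ?od in id.
  by rewrite addr0 left_char_mx // bd od !eqxx mulrC.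
congr ((_ : 'M_n) a c); rewrite !mulmxA; congr (_ *m _); rewrite -!mulmxA; congr (_ *m _).
rewrite /char_poly_mx mulmxBl mulmxBr mul_scalar_mx mul_mx_scalar -!map_mxM.
by congr (_ - map_mx _ _); apply/esym/eqP; rewrite -subr_eq0; apply/eqP.
Qed.

Lemma size_LX (a c : 'I_n) : is_end a -> (size (LX a c) <= (deg a).+1)%N.
Proof.
move=> ea; rewrite mxE; apply: (leq_trans (size_sum _ _ _)); apply/bigmax_leqP => l _.
rewrite !mxE ea; case: ifP => _; last by rewrite mul0r size_poly0.
rewrite mulrC mul_polyC; apply: leq_trans (size_scale_leq _ _) _.
by rewrite size_polyXn ltnS (eqP ea) leq_subr.
Qed.

Lemma size_XR (d c : 'I_n) : is_end c -> (size (XR d c) <= (deg c).+1)%N.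
Proof.
move=> ec; rewrite mxE; apply: (leq_trans (size_sum _ _ _)); apply/bigmax_leqP => i _.
rewrite !mxE ec; case: eqP => [b|_]; last by rewrite mulr0 size_poly0.
rewrite mul_polyC; apply: leq_trans (size_scale_leq _ _) _.
by rewrite size_polyXn ltnS /blk_deg -b -/(deg i) off_le.
Qed.

Lemma LX_coef (a c l : 'I_n) : is_end a -> blk l = blk a -> (LX a c)`_(deg a - off l) = X l c.
Proof.
move=> ea bl; rewrite mxE coef_sum (bigD1 l) //= big1 => [|i il].
  by rewrite addr0 !mxE bl eqxx ea coefMC coefXn (eqP ea) eqxx mul1r.
rewrite !mxE ea coefMC; case: eqP => b; last by rewrite coef0 mul0r.
rewrite coefXn (eqP ea); case: eqP => [o|]; last by rewrite mul0r.
case/eqP: il; apply: (@pos_inj n ds); first by rewrite bl.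
have h1 : (off l <= deg a)%N by rewrite /blk_deg -bl; exact: (off_le szn l).
have h2 : (off i <= deg a)%N by rewrite /blk_deg b; exact: (off_le szn i).
by rewrite -(subKn h2) -o subKn.
Qed.

(** Comparing [X J] and [J X] in the next column expresses each column of [X] through its successor
    in the block, so the end columns determine [X]. *)
Lemma centraliser_eq0_of_ends : (forall l c : 'I_n, is_end c -> X l c = 0) -> X = 0.
Proof.
move=> X0; suff H m : forall c : 'I_n, (deg c - off c <= m)%N -> forall l, X l c = 0.
  by apply/matrixP => l c; rewrite mxE; apply: H (leqnn _) l.
elim: m => [|m IH] c hc l.
  apply: X0; rewrite /is_end eqn_leq off_le //=.
  by rewrite leqn0 subn_eq0 in hc.
have [/X0 //|nc] := boolP (is_end c).
have [c' [bc oc Jc]] := jordan_row_next K szn nc.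
have := congr1 (fun A : 'M_n => A l c') XJ; rewrite /lie.
rewrite mxE [X in _ + X]mxE [X in X - _]mxE [X in _ - X]mxE [RHS]mxE => /eqP.
rewrite subr_eq0 => /eqP.
rewrite big1 => [|d _]; last by rewrite IH ?mulr0 // oc /blk_deg bc -/(deg c); lia.
rewrite (bigD1 c) //= big1 => [|d dc].
  by rewrite addr0 Jc eqxx mulr1 => <-.
rewrite jordan_nilE //; case: eqP => [b|_] /=; last by rewrite mulr0.
case: eqP => [o|_]; last by rewrite mulr0.
by case/eqP: dc; apply: (@pos_inj n ds); [rewrite b bc|move: o; rewrite oc => -[]].
Qed.

Lemma left_const_slice C (a d : 'I_n) : is_end a ->
  (left_mx *m map_mx polyC (const_slice C)) a d =
  if off d == 0%N then (C (blk a) (blk d))%:P else 0.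
Proof.
move=> ea; rewrite mxE (bigD1 a) //= big1 => [|l la].
  by rewrite left_mx_end // eqxx mul1r addr0 !mxE ea /=; case: ifP.
have [el|nl] := boolP (is_end l); first by rewrite left_mx_end // eq_sym (negbTE la) mul0r.
by rewrite !mxE (negbTE nl) mulr0.
Qed.

Lemma const_slice_right C (l c : 'I_n) : is_end c ->
  (map_mx polyC (const_slice C) *m right_mx) l c =
  if is_end l then (C (blk l) (blk c))%:P else 0.
Proof.
move=> ec; have [d [bd od]] := exists_pos szn (blk_lt szn c) (leq0n _).
rewrite mxE (bigD1 d) //= big1 => [|i id].
  by rewrite addr0 !mxE od bd !eqxx andbT ec expr0 mulr1; case: ifP.
rewrite !mxE ec; case: (off i =P 0%N) => [oi|_]; last by rewrite andbF mul0r.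
case: eqP => bi; last by rewrite mulr0.
by rewrite (@pos_inj n ds i d) ?eqxx // ?bi ?bd ?oi ?od in id.
Qed.

Lemma reduced_lie_const_slice C (a c : 'I_n) : is_end a -> is_end c ->
  reduced_mx (lie (const_slice C) X) a c =
  \sum_(d < n | off d == 0%N) (C (blk a) (blk d))%:P * XR d c -
  \sum_(l < n | is_end l) LX a l * (C (blk l) (blk c))%:P.
Proof.
move=> ea ec; rewrite /lie reduced_mxB mxE [X in _ + X]mxE; congr (_ - _).
  rewrite /reduced_mx map_mxM mulmxA -mulmxA mxE [RHS]big_mkcond; apply: eq_bigr => d _.
  by rewrite left_const_slice //; case: ifP; rewrite ?mul0r.
rewrite /reduced_mx map_mxM mulmxA -mulmxA mxE [RHS]big_mkcond; apply: eq_bigr => l _.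
by rewrite const_slice_right //; case: ifP; rewrite ?mulr0.
Qed.

End Transversality.

(** The diagonal entries [i + 1] are distinct and nonzero in characteristic 0; [poly_lowest_eq0]
    uses both properties. *)
Definition bidiagonal (i l : nat) : K :=
  if i == l then i.+1%:R else if i == l.+1 then 1 else 0.

Lemma poly_lowest_eq0 (p : {poly K}) (x y : K) (m d : nat) :
  x != 0 -> (m = 0%N -> x != y) -> (size p <= d.+1)%N ->
  (forall s, (s <= d)%N -> x * p`_s = y * (p * 'X^m)`_s) -> p = 0.
Proof.
move=> x0 xy sp h; apply/polyP => s; rewrite coef0.
elim/ltn_ind: s => s IH.
have [ds'|sd] := ltnP d s; first by rewrite nth_default //; apply: leq_trans sp ds'.
have := h s sd; rewrite coefMXn; case: m xy {h} => [|m] xy /=.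
  rewrite subn0 => /eqP; rewrite -subr_eq0 -mulrBl mulf_eq0 subr_eq0 (negbTE (xy erefl)).
  by move/eqP.
case: ltnP => hs; first by rewrite mulr0 => /eqP; rewrite mulf_eq0 (negbTE x0) => /eqP.
have ls : (s - m.+1 < s)%N by rewrite ltn_subrL (leq_trans _ hs).
rewrite (IH _ ls) mulr0.
by move/eqP; rewrite mulf_eq0 (negbTE x0) => /eqP.
Qed.

(* Block rows of [X] are killed from top to bottom; within a row, blocks right of the diagonal are
   killed from right to left by the distinct diagonal entries, the others from left to right by
   the subdiagonal ones. *)
Lemma bidiagonal_transversal (X : 'M[K]_n) : [pchar K] =i pred0 ->
  centraliser J X ->
  (forall i e0 : 'I_n, is_end e0 -> blk e0 = 0%N -> X i e0 = 0) ->
  (forall a c : 'I_n, is_end a -> is_end c -> forall s, (s <= minn (deg a) (deg c))%N ->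
     (reduced_mx (lie (const_slice bidiagonal) X) a c)`_s = 0) -> X = 0.
Proof.
move=> ch0 XJ X0 Xred; apply: (centraliser_eq0_of_ends XJ) => l c ec.
have nat0 m : (m.+1%:R : K) != 0 by rewrite (pcharf0P _).1.
suff H q : forall a c' : 'I_n, is_end a -> is_end c' -> blk a = q ->
    (left_mx *m map_mx polyC X) a c' = 0.
  have [a [ba ea]] := exists_end szn l.
  by rewrite -(LX_coef X c ea (esym ba)) (H _ a c ea ec erefl) coef0.
elim/ltn_ind: q => q IH a c' ea ec' ba {c ec l}.
have start (b : 'I_n) : exists d : 'I_n, blk d = blk b /\ off d = 0%N.
  by have [d hd] := exists_pos szn (blk_lt szn b) (leq0n _); exists d.
have [da [bda oda]] := start a.
have XR0 (b d c : 'I_n) : is_end b -> is_end c -> blk d = blk b -> off d = 0%N ->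
    (left_mx *m map_mx polyC X) b c = 0 -> (map_mx polyC X *m right_mx) d c = 0.
  move=> eb ec bd od h; have := LX_XR XJ eb ec bd od; rewrite h mul0r => /esym/eqP.
  by rewrite mulf_eq0 -[X in _ || X]size_poly_eq0 size_polyXn orbF => /eqP.
have first_sum (c : 'I_n) : is_end c ->
    \sum_(d < n | off d == 0%N) (bidiagonal (blk a) (blk d))%:P * (map_mx polyC X *m right_mx) d c =
    (q.+1%:R)%:P * (map_mx polyC X *m right_mx) da c.
  move=> ec; rewrite (bigD1 da) /=; last by rewrite oda.
  rewrite big1 ?addr0 => [|d /andP [/eqP od dda]]; first by rewrite /bidiagonal bda eqxx ba.
  rewrite /bidiagonal; case: eqP => bad.
    by rewrite (@pos_inj n ds d da) ?eqxx // -?bad ?bda ?od ?oda in dda.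
  case: eqP => bad'; last by rewrite mul0r.
  have [b [bb eb]] := exists_end szn d.
  rewrite (XR0 b d c) ?mulr0 //.
  by apply: (IH (blk d)); rewrite // -ba bad'.
have second_sum (c : 'I_n) : is_end c ->
    (forall c2 : 'I_n, is_end c2 -> blk c2 = (blk c).+1 -> (left_mx *m map_mx polyC X) a c2 = 0) ->
    \sum_(l < n | is_end l) (left_mx *m map_mx polyC X) a l * (bidiagonal (blk l) (blk c))%:P =
    (left_mx *m map_mx polyC X) a c * ((blk c).+1%:R)%:P.
  move=> ec h; rewrite (bigD1 c) //= big1 ?addr0 => [|l /andP [el lc]].
    by rewrite /bidiagonal eqxx.
  rewrite /bidiagonal; case: eqP => blc; first by rewrite (end_inj el ec blc) eqxx in lc.
  by case: eqP => blc'; [rewrite h ?mul0r | rewrite mulr0].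
have below m : forall c : 'I_n, is_end c -> (q < blk c)%N -> (size ds - blk c <= m)%N ->
    (left_mx *m map_mx polyC X) a c = 0.
  elim: m => [|m IHm] c ec qc hm.
    by have := blk_lt szn c; rewrite -subn_gt0; case: (_ - _)%N hm.
  have dca : (deg c <= deg a)%N by apply: (blk_deg_le szn sds); rewrite ba ltnW.
  have XR_LX : (left_mx *m map_mx polyC X) a c =
      (map_mx polyC X *m right_mx) da c * 'X^(deg a - deg c).
    have := LX_XR XJ ea ec bda oda; rewrite /weight ea ec /=.
    have -> : (deg a).+1 = (deg a - deg c + (deg c).+1)%N by rewrite addnS subnK.
    rewrite exprD mulrA.
    by move/mulIf; apply; rewrite -size_poly_eq0 size_polyXn.
  suff e : (map_mx polyC X *m right_mx) da c = 0 by rewrite XR_LX e mul0r.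
  (* The entry [(a, c)] reads [(q + 1) p = (blk c + 1) p 'X^m] up to degree [deg c], with
     [m = deg a - deg c]. For [m > 0] the lowest coefficient of [p] must vanish; for [m = 0] the two
     diagonal entries differ. *)
  apply: (@poly_lowest_eq0 _ q.+1%:R (blk c).+1%:R (deg a - deg c) (deg c)) => //.
  - by move=> _; apply/eqP => /(natr_inj ch0) [e]; move: qc; rewrite -e ltnn.
  - by apply: size_XR.
  - move=> s sc; have := Xred a c ea ec s; rewrite (minn_idPr dca) => /(_ sc).
    rewrite reduced_lie_const_slice // first_sum // second_sum //; last first.
      move=> c2 ec2 bc2; apply: IHm => //; first by rewrite bc2 ltnW.
      by rewrite bc2; move: hm; have := blk_lt szn c; lia.
    by rewrite coefB coefCM coefMC XR_LX => /eqP; rewrite subr_eq0 => /eqP ->; rewrite mulrC.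
have above m : forall c : 'I_n, is_end c -> (blk c <= q)%N -> blk c = m ->
    (left_mx *m map_mx polyC X) a c = 0.
  elim: m => [|m IHm] c ec cq bc.
    rewrite mxE big1 // => i _; by rewrite [map_mx _ _ _ _]mxE X0 // mulr0.
  have hm : (m < size ds)%N by rewrite -ltnS -bc ltnS ltnW ?blk_lt.
  have [c1 [bc1 oc1]] := exists_pos szn hm (leqnn _).
  have ec1 : is_end c1 by rewrite /is_end oc1 /blk_deg bc1.
  have c1q : (blk c1 <= q)%N by rewrite bc1 ltnW // -bc.
  have LX1 := IHm c1 ec1 c1q bc1.
  have dac : (deg a <= deg c1)%N by apply: (blk_deg_le szn sds); rewrite ba.
  apply/polyP => s; rewrite coef0.
  have [das|sda] := ltnP (deg a) s.
    by rewrite nth_default //; apply: leq_trans das; exact: size_LX.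
  have := Xred a c1 ea ec1 s; rewrite (minn_idPl dac) => /(_ sda).
  (* In the column [c1] of the preceding block all terms are already zero except the one at [c],
     where the subdiagonal entry is 1. *)
  rewrite reduced_lie_const_slice // first_sum // (XR0 a da c1) // mulr0 sub0r coefN.
  rewrite (bigD1 c) //= big1 ?addr0 => [|l /andP [el lc]].
    rewrite /bidiagonal bc bc1 eqxx -[m.+1 == m]negbK neq_ltn ltnSn orbT mulr1.
    by move/eqP; rewrite oppr_eq0 => /eqP.
  rewrite /bidiagonal; case: eqP => blc.
    by rewrite (end_inj el ec1 blc) LX1 mul0r.
  case: eqP => blc'; last by rewrite mulr0.
  by rewrite (end_inj el ec) ?eqxx // blc' bc1 bc in lc.
have [qc|cq] := ltnP q (blk c'); first exact: below ec' qc (leqnn _).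
exact: above ec' cq erefl.
Qed.

End Slices.

(** * Lowest components *)

Lemma mcoeff_pihomog (K : fieldType) r d (p : {mpoly K[r]}) m :
  (pihomog mdeg d p)@_m = if mdeg m == d then p@_m else 0.
Proof.
elim/mpolyind: p => [|c m' p _ _ IH]; first by rewrite pihomog0 !mcoeff0 if_same.
rewrite pihomogD !mcoeffD IH [pihomog _ _ (c *: _)]linearZ /= !mcoeffZ pihomogX.
have [<-|ne] := eqVneq m' m; last first.
  rewrite mcoeffX (negbTE ne) mulr0 add0r.
  by case: ifP => _; rewrite ?mcoeffX ?(negbTE ne) ?mcoeff0 mulr0 add0r.
by case: ifP => // _; rewrite mcoeff0 mulr0 add0r.
Qed.

Lemma foldr_minn_eq (a d : nat) (s : seq nat) :
  (d <= a)%N -> (forall x, x \in s -> (d <= x)%N) -> d \in s -> foldr minn a s = d.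
Proof.
move=> da; elim: s => //= x s IH hs; rewrite inE => /orP [/eqP dx|ds].
  rewrite -dx; apply/minn_idPl.
  have : forall y, y \in s -> (d <= y)%N by move=> y ys; apply: hs; rewrite inE ys orbT.
  elim: (s) => //= y s' IH' h; rewrite leq_min h ?mem_head //=.
  by apply: IH' => z zs; apply: h; rewrite inE zs orbT.
rewrite IH //; first by apply/minn_idPr/hs/mem_head.
by move=> y ys; apply: hs; rewrite inE ys orbT.
Qed.

Lemma mpoly_in_pihomog (K : fieldType) r d (p : {mpoly K[r]}) :
  (forall i, (i < d)%N -> pihomog mdeg i p = 0) -> pihomog mdeg d p != 0 ->
  mpoly_in p = pihomog mdeg d p.
Proof.
move=> p0 pd; suff <- : mindeg p = d by [].
have supp m : m \in msupp p -> (d <= mdeg m)%N.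
  rewrite mcoeff_msupp leqNgt; apply: contra => /p0 /(congr1 (mcoeff m)).
  by rewrite mcoeff_pihomog eqxx mcoeff0 => ->.
have [m mp md] : exists2 m, m \in msupp p & mdeg m = d.
  exists (mlead (pihomog mdeg d p)); have := mlead_supp pd; rewrite !mcoeff_msupp mcoeff_pihomog.
    by case: ifP => //; rewrite eqxx.
  by case: (mdeg _ =P d) => //; rewrite eqxx.
apply: foldr_minn_eq; last by rewrite -md; apply: map_f.
  by rewrite -md ltnW // msize_mdeg_lt.
by move=> x /mapP [m' /supp h ->].
Qed.

Lemma Delta_conj (K : fieldType) n (A g : 'M[K]_n) i : (i <= n)%N -> g \in unitmx ->
  Delta i (g *m A *m invmx g) = Delta i A.
Proof.
move=> hi gu.
have : char_poly (g *m A *m invmx g) = char_poly A.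
  rewrite /char_poly; have -> : char_poly_mx (g *m A *m invmx g) =
     map_mx polyC g *m char_poly_mx A *m map_mx polyC (invmx g).
    rewrite /char_poly_mx mulmxBr mulmxBl -!map_mxM; congr (_ - _).
    by rewrite mul_mx_scalar -scalemxAl -map_mxM mulmxV // map_mx1 scalemx1.
  by rewrite !det_mulmx mulrAC !det_map_mx -rmorphM -det_mulmx mulmxV // det1 mul1r.
move/(congr1 (fun p : {poly K} => p`_(n - i))); rewrite !char_poly_coef_Delta //.
by move/(congr1 (fun x => (-1) ^+ i * x)); rewrite !signrMK.
Qed.

Section LeadingTerm.
Variables (K : fieldType) (n : nat) (ds : seq nat).
Hypothesis ch0 : [pchar K] =i pred0.
Hypothesis szn : (sumn ds + size ds)%N = n.
Hypothesis sds : sorted geq ds.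

Local Notation J := (jordan_nil K n ds).
Local Notation blk := (blk ds).
Local Notation off := (off ds).
Local Notation deg := (blk_deg ds).
Local Notation reduced_mx := (@reduced_mx K n ds).

(** Since [g] commutes with [J], conjugating [y] conjugates [J + s y]; compare the coefficients of
    the powers of [s]. *)
Lemma component_conj q (j : 'I_n) (y g : 'M[K]_n) : Gcentraliser J g ->
  component ds q j (g *m y *m invmx g) = component ds q j y.
Proof.
move=> [gu gJ]; have [qn|qn] := ltnP q n.+1; last first.
  rewrite /component !big1 // => I /eqP cI;
  by have := max_card (mem I); rewrite card_ord cI leqNgt qn.
suff : \poly_(q < n.+1) component ds q j (g *m y *m invmx g) =
       \poly_(q < n.+1) component ds q j y.
  by move/(congr1 (fun p : {poly K} => p`_q)); rewrite !coef_poly qn.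
apply/eqP; rewrite -subr_eq0; apply/eqP/(poly_eq0_nat ch0) => s.
have e : J + s%:R *: (g *m y *m invmx g) = g *m (J + s%:R *: y) *m invmx g.
  by rewrite mulmxDr mulmxDl gJ mulmxK // -scalemxAr -scalemxAl.
by rewrite hornerD hornerN -!Delta_component // e Delta_conj // subrr.
Qed.

(** Guarantees that the lowest component really has degree [blk j + 1]: moving the slice coordinate
    paired with [j] changes the value. *)
Lemma leading_form_neq (j : 'I_n) :
  exists y z, leading_form ds j (reduced_mx y) != leading_form ds j (reduced_mx z).
Proof.
pose C := fun i l => if i == l.+1 then 1 else 0 : K.
have [i [bi oi]] := exists_pos szn (blk_lt szn j) (leq_subr (off j) (deg j)).
pose v d : K := (d == i)%:R.
exists (const_slice n ds C + row_direction ds v), (const_slice n ds C + row_direction ds (fun=> 0)).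
have C_low i' l : (l.+1 < i')%N -> C i' l = 0.
  by move=> h; rewrite /C; case: eqP h => // ->; rewrite ltnn.
have C_sub i' : (i'.+1 < size ds)%N -> C i'.+1 i' != 0 by rewrite /C eqxx oner_eq0.
rewrite !leading_form_row_slice // [in X in X != _]leading_form_slice // addrC -subr_eq0 addrK.
rewrite (bigD1 i) //= big1 => [|d di]; last by rewrite /v (negbTE di) mulr0.
by rewrite addr0 /v eqxx mulr1 slice_coef_neq0.
Qed.

Variables (r : nat) (b : 'I_r -> 'M[K]_n) (f : 'M[K]_n) (c : K).
Hypothesis bas : is_basis_of (centraliser J) b.
Hypothesis c_neq0 : c != 0.
Hypothesis surj : forall t, exists2 y, centraliser f y & gedual b y =1 t.

Lemma is_eF_leading (j : 'I_n) (P : {mpoly K[r]}) : is_eF c J f b j.+1 P ->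
  [/\ P != 0, P \is (blk j).+1.-homog & exists2 k, k != 0 &
    forall y, P.@[gedual b y] = k * leading_form ds j (reduced_mx y)].
Proof.
move=> [Q [hQ ->]].
have coefE y d : centraliser f y ->
    (pihomog mdeg d Q).@[fun i => c * gedual b y i] =
    (\poly_(q < n.+1) component ds q j y)`_d.
  move=> fy; rewrite -line_coef_homog; congr (_`_ _).
  congr polyseq; apply/eqP; rewrite -subr_eq0; apply/eqP/(poly_eq0_nat ch0) => s.
  rewrite hornerD hornerN horner_line -Delta_component // -hQ.
    apply/eqP; rewrite subr_eq0; apply/eqP/meval_eq => i.
    by rewrite add0r /gedual -scalemxAr linearZ /=; ring.
  by rewrite /centraliser linearZ /= fy scaler0.
have csurj t : exists2 y, centraliser f y & forall i, c * gedual b y i = t i.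
  have [y fy yt] := surj (fun i => c^-1 * t i); exists y => // i.
  by rewrite yt mulrA divff // mul1r.
have low d : (d < (blk j).+1)%N -> pihomog mdeg d Q = 0.
  move=> dj; apply: mpoly_eq0_meval => // t; have [y fy yt] := csurj t.
  rewrite -(meval_eq _ yt) coefE // coef_poly; case: ifP => // _.
  exact: component_eq0.
have jn : ((blk j).+1 < n.+1)%N.
  have sn : (size ds <= n)%N by rewrite -[leqRHS]szn leq_addl.
  by rewrite ltnS; apply: leq_trans (blk_lt szn j) sn.
(* The defining identity of [Q] holds on the centraliser of [f] only; an arbitrary [y] is replaced
   by some [z] there inducing the same functional on [g_e]. *)
have leadE y : (pihomog mdeg (blk j).+1 Q).@[fun i => c * gedual b y i] =
    (-1) ^+ ((blk j).+1 + j.+1) * leading_form ds j (reduced_mx y).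
  have [z fz zy] := surj (gedual b y).
  have -> : leading_form ds j (reduced_mx y) = leading_form ds j (reduced_mx z).
    by apply: leading_form_trace => //; apply: (gedual_trace bas) => i; rewrite zy.
  rewrite -component_lead // -[RHS](_ : (\poly_(q < n.+1) component ds q j z)`_(blk j).+1 = _).
    by rewrite -coefE //; apply: meval_eq => i; rewrite zy.
  by rewrite coef_poly jn.
have P0 : pihomog mdeg (blk j).+1 Q != 0.
  apply/eqP => P0; have [y [z]] := leading_form_neq j; case/eqP.
  have := leadE y; rewrite P0 meval0 -[X in X = _](meval0 (fun i => c * gedual b z i)) -P0 leadE.
  by move/(congr1 (fun x => (-1) ^+ ((blk j).+1 + j.+1) * x)); rewrite !signrMK.
rewrite (mpoly_in_pihomog low P0).
have hP := pihomogP mdeg (blk j).+1 Q.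
(* The power of [c] undoes the scaling of the trace form in a form of degree [blk j + 1]; the sign
   is that of [component]. *)
split=> //; exists (c ^- (blk j).+1 * (-1) ^+ ((blk j).+1 + j.+1)).
  by rewrite mulf_neq0 ?signr_eq0 // invr_eq0 expf_neq0.
move=> y; rewrite -mulrA -leadE (meval_homog _ _ hP) mulrA mulVf ?mul1r //.
exact: expf_neq0.
Qed.

End LeadingTerm.

(** * Jets of invariants *)

Section DirectionalDerivatives.
Variables (K : fieldType) (r : nat).
Implicit Types (p q : {mpoly K[r]}) (u v t : 'I_r -> K).

Definition dir_deriv u p : {mpoly K[r]} := \sum_j u j *: p^`M(j).

Lemma dir_deriv_is_linear u : linear (dir_deriv u).
Proof.
move=> a p q; rewrite /dir_deriv scaler_sumr -big_split; apply: eq_bigr => j _ /=.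
by rewrite mderivD mderivZ scalerDr !scalerA mulrC.
Qed.
HB.instance Definition _ u :=
  GRing.isLinear.Build K {mpoly K[r]} {mpoly K[r]} _ (dir_deriv u) (dir_deriv_is_linear u).

Lemma mderiv_dir_deriv i v p : (dir_deriv v p)^`M(i) = \sum_j v j *: p^`M(j)^`M(i).
Proof. by rewrite /dir_deriv raddf_sum; apply: eq_bigr => j _; exact: mderivZ. Qed.

Lemma dir_deriv_comm u v p : dir_deriv u (dir_deriv v p) = dir_deriv v (dir_deriv u p).
Proof.
rewrite {1}/dir_deriv [RHS]/dir_deriv.
under eq_bigr => i _ do rewrite mderiv_dir_deriv scaler_sumr.
under [RHS]eq_bigr => i _ do rewrite mderiv_dir_deriv scaler_sumr.
rewrite exchange_big; apply: eq_bigr => j _ /=.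
by apply: eq_bigr => i _; rewrite mderiv_comm !scalerA mulrC.
Qed.

Lemma meval_dir_deriv u p t : (dir_deriv u p).@[t] = \sum_j u j * (p^`M(j)).@[t].
Proof. by rewrite linear_sum; apply: eq_bigr => j _; exact: mevalZ. Qed.

Definition dir_derivs (L : seq ('I_r -> K)) p := foldr dir_deriv p L.

Lemma dir_derivs_cons_mid L1 u L2 p :
  dir_derivs (L1 ++ u :: L2) p = dir_deriv u (dir_derivs (L1 ++ L2) p).
Proof. by elim: L1 => //= v L1 ->; rewrite dir_deriv_comm. Qed.

(** The derivation sending ['X_j] to the linear form with coefficients [A j]. For the structure
    constants of [ad x] it is the derivation in [ge_invariant]. *)
Definition linear_field (A : 'I_r -> 'I_r -> K) p : {mpoly K[r]} :=
  \sum_j p^`M(j) * (\sum_i A j i *: 'X_i).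

Lemma mderivXU (i j : 'I_r) : ('X_i)^`M(j) = (i == j)%:R :> {mpoly K[r]}.
Proof.
rewrite mderivX mnm1E; case: eqP => [->|_]; last by rewrite scale0r.
rewrite scale1r (_ : (_ - _)%MM = 0%MM) ?mpolyX0 //.
by apply/mnmP => k; rewrite mnmBE mnm0E subnn.
Qed.

Lemma linear_field_dir_deriv A u p :
  linear_field A (dir_deriv u p) = dir_deriv u (linear_field A p) -
    dir_deriv (fun j => \sum_i A j i * u i) p.
Proof.
have key (l : 'I_r) : (linear_field A p)^`M(l) =
    linear_field A p^`M(l) + \sum_j A j l *: p^`M(j).
  rewrite /linear_field raddf_sum -big_split; apply: eq_bigr => j _ /=.
  rewrite mderivM mderiv_comm; congr (_ + _).
  rewrite raddf_sum (bigD1 l) //= mderivZ mderivXU eqxx big1 => [|i il].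
    by rewrite addr0 -scalerAr mulr1.
  by rewrite mderivZ mderivXU (negbTE il) scaler0.
have lin : linear_field A (dir_deriv u p) = \sum_l u l *: linear_field A p^`M(l).
  rewrite /linear_field; under [RHS]eq_bigr => l _ do rewrite scaler_sumr.
  rewrite exchange_big; apply: eq_bigr => j _ /=.
  rewrite /dir_deriv raddf_sum mulr_suml; apply: eq_bigr => l _ /=.
  by rewrite mderivZ scalerAl mderiv_comm.
rewrite lin /dir_deriv; apply/eqP; rewrite eq_sym subr_eq; apply/eqP.
under eq_bigr => l _ do rewrite key scalerDr.
rewrite big_split /=; congr (_ + _).
under eq_bigr => l _ do rewrite scaler_sumr.
rewrite exchange_big; apply: eq_bigr => j _ /=.
by rewrite scaler_suml; apply: eq_bigr => l _; rewrite scalerA mulrC.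
Qed.

(* Moving a linear vector field past a derivative only produces derivatives of the same order. *)
Lemma linear_field_jet A p t k :
  linear_field A p = 0 ->
  (forall L, size L = k -> (dir_derivs L p).@[t] = 0) ->
  forall L, size L = k -> (linear_field A (dir_derivs L p)).@[t] = 0.
Proof.
move=> Ap jet L sL; suff H : forall L M, (size M + size L = k)%N ->
    (dir_derivs M (linear_field A (dir_derivs L p))).@[t] = 0 by exact: (H L [::]).
elim=> [|u {sL}L IH] M sM.
  rewrite /= Ap; suff -> : dir_derivs M 0 = 0 by rewrite meval0.
  by elim: M {sM} => //= v M ->; rewrite linear0.
have lin q1 q2 : dir_derivs M (q1 - q2) = dir_derivs M q1 - dir_derivs M q2.
  by elim: (M) => //= v M' ->; rewrite linearB.
rewrite /= linear_field_dir_deriv lin mevalB.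
have -> q : dir_derivs M (dir_deriv u q) = dir_derivs (rcons M u) q.
  by rewrite /dir_derivs foldr_rcons.
rewrite IH ?size_rcons ?addSnnS // sub0r.
have -> v q : dir_derivs M (dir_deriv v (dir_derivs L q)) = dir_derivs (M ++ v :: L) q.
  by rewrite /dir_derivs foldr_cat.
by rewrite jet ?oppr0 // size_cat.
Qed.

Lemma mpoly_eq0_jets p t : [pchar K] =i pred0 ->
  (forall L, (dir_derivs L p).@[t] = 0) -> p = 0.
Proof.
move=> ch0 jet.
apply: (@mpoly_eq0_mderiv_closed K r (fun q => exists L, q = dir_derivs L p) t) => //.
- move=> _ j [L ->]; exists ((fun i => (i == j)%:R) :: L).
  rewrite /= /dir_deriv (bigD1 j) //= eqxx scale1r big1 ?addr0 // => i ij.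
  by rewrite (negbTE ij) scale0r.
- by move=> _ [L ->].
- by exists [::].
Qed.

End DirectionalDerivatives.

(** * Invariants vanishing on a slice *)

Section SliceVanishing.
Variables (K : fieldType) (n : nat) (ds : seq nat).
Hypothesis ch0 : [pchar K] =i pred0.
Hypothesis szn : (sumn ds + size ds)%N = n.
Hypothesis sds : sorted geq ds.

Local Notation J := (jordan_nil K n ds).
Local Notation reduced_mx := (@reduced_mx K n ds).
Variables (r : nat) (b : 'I_r -> 'M[K]_n).
Hypothesis bas : is_basis_of (centraliser J) b.
Hypothesis surj : forall t, exists y, gedual b y =1 t.

Lemma lie_structure_constants x : centraliser J x -> exists A : 'I_r -> 'I_r -> K,
  forall j, lie x (b j) = \sum_i A j i *: b i.
Proof.
move=> Jx.
apply: (fin_all_exists (P := fun j a => lie x (b j) = \sum_i a i *: b i)) => j.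
apply: bas.2.2.
rewrite /centraliser lie_jacobi (bas.1 j) linear0 add0r.
by rewrite (_ : lie J x = 0) // /lie mul0mx mulmx0 subrr.
Qed.

Lemma meval_linear_field x A p y : (forall j, lie x (b j) = \sum_i A j i *: b i) ->
  (linear_field A p).@[gedual b y] =
  \sum_j (p^`M(j)).@[gedual b y] * \tr (lie x (b j) *m y).
Proof.
move=> hA; rewrite /linear_field raddf_sum; apply: eq_bigr => j _.
rewrite [LHS]mevalM; congr (_ * _).
rewrite hA -sum_gedual raddf_sum; apply: eq_bigr => i _ /=.
by rewrite mevalZ mevalXU.
Qed.

Local Notation y0 := (const_slice n ds (bidiagonal K)).

(* Transversality of the slice at [y0] propagates the vanishing of [P] on the slice to all its
   jets at [y0]: along the slice by restriction, along the orbit by invariance. *)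
Lemma ge_invariant_eq0_of_slice P : ge_invariant J b P ->
  (forall v, P.@[gedual b (y0 + row_direction ds v)] = 0) -> P = 0.
Proof.
move=> invP P0.
have field0 x A : centraliser J x -> (forall j, lie x (b j) = \sum_i A j i *: b i) ->
    linear_field A P = 0.
  move=> Jx hA; apply: mpoly_eq0_meval => // t; have [y yt] := surj t.
  by rewrite -(meval_eq _ yt) (meval_linear_field _ _ hA); apply: invP.
pose inV (u : 'I_r -> K) := exists v, u = gedual b (row_direction ds v).
have slice0 L : (forall u, List.In u L -> inV u) -> forall v,
    (dir_derivs L P).@[gedual b (y0 + row_direction ds v)] = 0.
  elim: L => [|u L IH] hL v; first exact: P0.
  have [w uw] : inV u by apply: hL; left.
  have {}IH := IH (fun u' h => hL u' (or_intror h)).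
  rewrite /= meval_dir_deriv -line_coef1.
  suff -> : line (gedual b (y0 + row_direction ds v)) u (dir_derivs L P) = 0 by rewrite coef0.
  apply: (poly_eq0_nat ch0) => s; rewrite horner_line.
  rewrite -[RHS](IH (fun i => v i + s%:R * w i)); apply: meval_eq => i; rewrite uw /gedual.
  have -> : row_direction ds (fun i => v i + s%:R * w i) =
      row_direction ds v + s%:R *: row_direction ds w.
    by apply/matrixP => k l; rewrite !mxE; case: ifP; rewrite ?mulr0 ?addr0.
  by rewrite addrA [in RHS]mulmxDr [RHS]mxtraceD -scalemxAr mxtraceZ [_ * s%:R]mulrC.
apply: (@mpoly_eq0_jets _ _ _ (gedual b y0)) => // L.
move: {-1}(size L) (erefl (size L)) => k; elim/ltn_ind: k L => -[|k] IH L sL.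
  case: L sL => // _; have := P0 (fun=> 0); congr (_ = 0); apply: meval_eq => i.
  rewrite (_ : row_direction _ _ = 0) ?addr0 //.
  by apply/matrixP => a c; rewrite !mxE if_same.
(* At fixed order [k + 1], a second induction on the number [i] of directions not yet known to lie
   along the slice. *)
suff H i : forall L1 L2, size L1 = i -> (size L1 + size L2 = k.+1)%N ->
    (forall u, List.In u L2 -> inV u) -> (dir_derivs (L1 ++ L2) P).@[gedual b y0] = 0.
  by rewrite -[L]cats0; apply: (H (size L)); rewrite ?addn0.
elim: i => [|i IHi] [|u L1] L2 // sL1 sL' hL2.
  have := slice0 L2 hL2 (fun=> 0); congr (_ = 0); apply: meval_eq => i.
  rewrite (_ : row_direction _ _ = 0) ?addr0 //.
  by apply/matrixP => a c; rewrite !mxE if_same.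
move: sL1 => [sL1]; rewrite /= meval_dir_deriv; set q := dir_derivs _ _.
(* The gradient of [q] at the base point is read as an element [X] of [g_e]. It is orthogonal to
   slice directions by the inner induction and to orbit directions because the jets of order [k]
   vanish; transversality gives [X = 0]. *)
pose z j := (q^`M(j)).@[gedual b y0]; pose X := \sum_j z j *: b j.
suff X0 : X = 0.
  by apply: big1 => j _; rewrite -/(z j) (bas.2.1 z X0) mulr0.
have JX : centraliser J X.
  rewrite /centraliser /X linear_sum big1 // => j _.
  by rewrite linearZ /= (bas.1 j) scaler0.
have trV v : \tr (X *m row_direction ds v) = 0.
  rewrite -sum_gedual.
  have := IHi L1 (gedual b (row_direction ds v) :: L2) sL1.
  rewrite dir_derivs_cons_mid meval_dir_deriv => h; rewrite -[RHS]h.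
  - by apply: eq_bigr => j _; rewrite mulrC.
  - by rewrite -sL' /= addnS.
  - by move=> w [<-|/hL2 //]; exists v.
have trO x : centraliser J x -> \tr (x *m lie y0 X) = 0.
  move=> Jx; have [A hA] := lie_structure_constants Jx.
  have := linear_field_jet (field0 x A Jx hA) (fun L h => IH k (ltnSn k) L h).
  move/(_ (L1 ++ L2)); rewrite (meval_linear_field _ _ hA) size_cat => h.
  have {}h : \sum_j z j * \tr (lie x (b j) *m y0) = 0 by apply: h; case: sL'.
  have e : \tr (lie x X *m y0) = 0.
    rewrite -[RHS]h /X linear_sum mulmx_suml linear_sum; apply: eq_bigr => j _ /=.
    by rewrite linearZ /= -scalemxAl linearZ.
  have -> : lie y0 X = - lie X y0 by rewrite /lie opprB.
  by rewrite mulmxN linearN /= trace_lie e oppr0.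
apply: (bidiagonal_transversal szn sds ch0 JX) => [i' e0 ee b0|a c ea ec s hs].
  by rewrite -(trace_row_direction X i' ee b0) trV.
by have [x Jx ->] := reduced_mx_trace K szn ea ec hs; exact: trO.
Qed.

End SliceVanishing.

(** * Invariants *)

(** The group elements used are [g = 1 + s x]. Invariance at [y g] equates [P] at [g y] and at
    [y g], both affine in [s]; the factor [D] discards the finitely many singular [g]. Comparing
    coefficients of [s] gives the infinitesimal statement. *)
Lemma Ge_invariant_ge (K : fieldType) n r (e : 'M[K]_n) (b : 'I_r -> 'M[K]_n) (P : {mpoly K[r]}) :
  [pchar K] =i pred0 -> Ge_invariant e b P -> ge_invariant e b P.
Proof.
move=> ch0 inv x y ex.
pose p1 := line (gedual b y) (gedual b (x *m y)) P.
pose p2 := line (gedual b y) (gedual b (y *m x)) P.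
pose D : {poly K} := \det (1%:M + 'X *: map_mx polyC x).
have DE s : D.[s] = \det (1%:M + s *: x).
  rewrite /D -horner_evalE -det_map_mx; congr (\det _).
  apply/matrixP => i j; rewrite !mxE /= /horner_eval hornerD hornerM hornerX hornerC.
  by rewrite hornerMn hornerC.
have D0 : D != 0.
  apply/eqP => D0; have := DE 0; rewrite D0 horner0 scale0r addr0 det1 => /esym/eqP.
  by rewrite oner_eq0.
have p12 : p1 = p2.
  apply/eqP; rewrite -subr_eq0; have /eqP : (p1 - p2) * D = 0.
    apply: (poly_eq0_nat ch0) => s; rewrite hornerM DE.
    set g := 1%:M + s%:R *: x.
    have [->|dg] := eqVneq (\det g) 0; first by rewrite mulr0.
    have gu : g \in unitmx by rewrite unitmxE unitfE.
    have ge : g *m e = e *m g.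
      rewrite mulmxDl mulmxDr mul1mx mulmx1 -scalemxAl -scalemxAr; congr (_ + _ *: _).
      by apply/esym/eqP; rewrite -subr_eq0; apply/eqP.
    have := inv g (y *m g) (conj gu ge); rewrite mulmxA mulmxK // => h.
    rewrite hornerD hornerN !horner_line (_ : _.@[_] = P.@[gedual b (g *m y)]); last first.
      apply: meval_eq => i; rewrite /gedual mulmxDl mul1mx -scalemxAl mulmxDr -scalemxAr.
      by rewrite mxtraceD mxtraceZ mulrC.
    rewrite h (_ : _.@[_] = P.@[gedual b (y *m g)]) ?subrr ?mul0r //.
    apply: meval_eq => i; rewrite /gedual mulmxDr mulmx1 -scalemxAr mulmxDr -scalemxAr.
    by rewrite mxtraceD mxtraceZ mulrC.
  by rewrite mulf_eq0 (negbTE D0) orbF.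
have := congr1 (fun p : {poly K} => p`_1) p12; rewrite !line_coef1 => /esym/eqP.
rewrite -subr_eq0 => /eqP h; rewrite -[RHS]h -sumrB; apply: eq_bigr => j _.
rewrite -mulrBl mulrC; congr (_ * _); rewrite /gedual /lie mulmxBl linearB /=.
by congr (_ - _); rewrite -!mulmxA // mxtrace_mulC mulmxA.
Qed.

Lemma ge_invariantB (K : fieldType) n r (e : 'M[K]_n) (b : 'I_r -> 'M[K]_n) (P Q : {mpoly K[r]}) :
  ge_invariant e b P -> ge_invariant e b Q -> ge_invariant e b (P - Q).
Proof.
move=> hP hQ x y ex; have := hP x y ex; have := hQ x y ex => h1 h2.
rewrite -[RHS](subrr 0) -[X in _ = X - _]h2 -[X in _ = _ - X]h1 -sumrB.
by apply: eq_bigr => j _; rewrite mderivB mevalB mulrBl.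
Qed.

Section Assembly.
Variables (K : fieldType) (n : nat) (ds : seq nat).
Hypothesis ch0 : [pchar K] =i pred0.
Hypothesis szn : (sumn ds + size ds)%N = n.
Hypothesis sds : sorted geq ds.

Local Notation J := (jordan_nil K n ds).
Local Notation blk := (blk ds).
Local Notation reduced_mx := (@reduced_mx K n ds).
Variables (r : nat) (b : 'I_r -> 'M[K]_n).
Hypothesis bas : is_basis_of (centraliser J) b.
Hypothesis surj : forall t, exists y, gedual b y =1 t.
Variables (F : 'I_n -> {mpoly K[r]}) (k : 'I_n -> K).
Hypothesis k_neq0 : forall j, k j != 0.
Hypothesis homF : forall j, F j \is (blk j).+1.-homog.
Hypothesis FE : forall j y, (F j).@[gedual b y] = k j * leading_form ds j (reduced_mx y).

Lemma F_Ge_invariant j : Ge_invariant J b (F j).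
Proof.
move=> g y gJ; rewrite !FE; congr (_ * _).
have := component_conj ch0 szn (blk j).+1 j y gJ.
rewrite (component_lead szn sds j) (component_lead szn sds j y).
by apply: mulfI; rewrite signr_eq0.
Qed.

Lemma comp_Ge_invariant (Q : {mpoly K[n]}) : Ge_invariant J b (Q \mPo [tuple F i | i < n]).
Proof.
move=> g y gJ; rewrite !comp_mpoly_meval; apply: meval_eq => i.
by rewrite tnth_mktuple; apply: F_Ge_invariant.
Qed.

Let bidiagonal_low i l : (l.+1 < i)%N -> bidiagonal K i l = 0.
Proof.
move=> h; rewrite /bidiagonal; case: eqP => [e|_]; first by move: h; rewrite e ltnNge leqnSn.
by case: eqP h => // ->; rewrite ltnn.
Qed.

Let bidiagonal_sub i : (i.+1 < size ds)%N -> bidiagonal K i.+1 i != 0.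
Proof. by rewrite /bidiagonal eqxx -[i.+1 == i]negbK neq_ltn ltnSn orbT oner_eq0. Qed.

Lemma gedual_row_direction y v l :
  gedual b (y + row_direction ds v) l =
  gedual b y l + \sum_i v i * gedual b (row_direction ds (fun d => (d == i)%:R)) l.
Proof.
have -> : row_direction ds v = \sum_i v i *: row_direction ds (fun d : 'I_n => (d == i)%:R) :> 'M[K]_n.
  apply/matrixP => a c; rewrite summxE mxE.
  case: ifP => h; last by rewrite big1 // => i _; rewrite !mxE h mulr0.
  rewrite (bigD1 c) //= big1 => [|i ic]; rewrite !mxE h ?eqxx ?mulr1 ?addr0 //.
  by rewrite eq_sym (negbTE ic) mulr0.
rewrite /gedual mulmxDr mxtraceD; congr (_ + _).
rewrite mulmx_sumr linear_sum; apply: eq_bigr => i _.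
by rewrite -scalemxAr linearZ.
Qed.

(** On the slice, the values of the [F j] determine the coordinates [v] through the inverse of [T].
    This inverse is [vp], and [Q] is the restriction of [P] to the slice written in it. The
    invariant [P - Q (F)] then vanishes on the slice. *)
Lemma ge_invariant_comp (P : {mpoly K[r]}) : ge_invariant J b P ->
  exists Q : {mpoly K[n]}, P = Q \mPo [tuple F i | i < n].
Proof.
move=> invP.
pose T := slice_coef_mx n ds (bidiagonal K).
have uT : T \in unitmx := slice_coef_unit szn sds bidiagonal_low bidiagonal_sub.
pose y0 : 'M[K]_n := const_slice n ds (bidiagonal K).
pose c j := leading_form ds j (slice_mx ds (bidiagonal K) (fun=> 0) : 'M_n).
pose vp i : {mpoly K[n]} := \sum_j invmx T i j *: ((k j)^-1 *: 'X_j - (c j)%:MP).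
pose D i : 'M[K]_n := row_direction ds (fun d => (d == i)%:R).
pose Q : {mpoly K[n]} :=
  P \mPo [tuple (gedual b y0 l)%:MP + \sum_i gedual b (D i) l *: vp i | l < r].
exists Q; apply/eqP; rewrite -subr_eq0; apply/eqP.
apply: (ge_invariant_eq0_of_slice ch0 szn sds bas surj).
  exact/(ge_invariantB invP)/(Ge_invariant_ge ch0)/comp_Ge_invariant.
move=> v; rewrite mevalB comp_mpoly_meval /Q comp_mpoly_meval.
apply/eqP; rewrite subr_eq0; apply/eqP/meval_eq => l.
rewrite tnth_mktuple mevalD mevalC gedual_row_direction; congr (_ + _).
rewrite raddf_sum; apply: eq_bigr => i _ /=; rewrite mevalZ mulrC; congr (_ * _).
rewrite raddf_sum /=.
have -> : v i = \sum_j invmx T i j * \sum_d T j d * v d.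
  transitivity ((invmx T *m (T *m \col_d v d)) i 0); first by rewrite mulKmx // mxE.
  rewrite mxE; apply: eq_bigr => j _; congr (_ * _); rewrite mxE.
  by apply: eq_bigr => d _; rewrite [X in _ * X]mxE.
apply: eq_bigr => j _; rewrite mevalZ mevalB mevalZ mevalXU mevalC tnth_mktuple FE.
rewrite mulKf // leading_form_row_slice // (leading_form_slice szn sds (bidiagonal K) j v).
by congr (_ * _); rewrite /c [RHS]addrAC subrr add0r; apply: eq_bigr => d _; rewrite mxE.
Qed.

Lemma invariants_comp (P : {mpoly K[r]}) :
  (ge_invariant J b P <-> Ge_invariant J b P) /\
  (Ge_invariant J b P <-> exists Q : {mpoly K[n]}, P = Q \mPo [tuple F i | i < n]).
Proof.
split; split.
- by move/ge_invariant_comp => [Q ->]; apply: comp_Ge_invariant.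
- exact: Ge_invariant_ge.
- by move/(Ge_invariant_ge ch0)/ge_invariant_comp.
- by move=> [Q ->]; apply: comp_Ge_invariant.
Qed.

(** Derivatives along the directions [D v] reproduce the matrix [T] with rows scaled by [k], so a
    relation between the rows of the Jacobian is a relation between the rows of [T]. *)
Lemma jacobian_row_free (y : 'M[K]_n) (T : 'M[K]_n) (c : 'I_n -> K)
    (D : ('I_n -> K) -> 'M[K]_n) :
  T \in unitmx ->
  (forall j v s, leading_form ds j (reduced_mx (y + s *: D v)) = c j + s * \sum_i T j i * v i) ->
  row_free (jacobian F (gedual b y)).
Proof.
move=> uT hT; rewrite -kermx_eq0; apply/eqP/row_matrixP => i0; rewrite row0.
set z := row i0 _.
have z0 : z *m jacobian F (gedual b y) = 0 by rewrite /z -row_mul mulmx_ker row0.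
have dF j v : \sum_l gedual b (D v) l * ((F j)^`M(l)).@[gedual b y] =
    k j * \sum_i T j i * v i.
  rewrite -line_coef1; suff -> : line (gedual b y) (gedual b (D v)) (F j) =
      (k j * c j)%:P + (k j * \sum_i T j i * v i)%:P * 'X.
    by rewrite coefD coefC add0r coefCM coefX mulr1.
  apply/eqP; rewrite -subr_eq0; apply/eqP/(poly_eq0_nat ch0) => s.
  rewrite hornerD hornerN horner_line (_ : _.@[_] = (F j).@[gedual b (y + s%:R *: D v)]).
    by rewrite FE hT !hornerE; ring.
  by apply: meval_eq => l; rewrite /gedual mulmxDr -scalemxAr mxtraceD mxtraceZ mulrC.
pose u : 'rV_n := \row_j (z 0 j * k j).
have uT0 : u *m T = 0.
  apply/rowP => i; rewrite [RHS]mxE.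
  pose v d : K := (d == i)%:R.
  have : \sum_l gedual b (D v) l * (z *m jacobian F (gedual b y)) 0 l = 0.
    by rewrite z0 big1 // => l _; rewrite mxE mulr0.
  under eq_bigr => l _ do rewrite mxE mulr_sumr.
  rewrite exchange_big /= => h; rewrite -[RHS]h mxE; apply: eq_bigr => j _.
  have Tv : \sum_d T j d * v d = T j i.
    rewrite (bigD1 i) //= big1 => [|d di]; last by rewrite /v (negbTE di) mulr0.
    by rewrite /v eqxx mulr1 addr0.
  rewrite [u 0 j]mxE -mulrA -Tv -dF mulr_sumr; apply: eq_bigr => l _.
  by rewrite [jacobian _ _ _ _]mxE mulrCA.
have u0 : u = 0 by rewrite -[u](mulmxK uT) uT0 mul0mx.
apply/rowP => j; rewrite [RHS]mxE; have := congr1 (fun u : 'rV_n => u 0 j) u0.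
by rewrite !mxE => /eqP; rewrite mulf_eq0 (negbTE (k_neq0 j)) orbF => /eqP.
Qed.

End Assembly.

(** * Singular locus *)

Lemma mderiv_homog (K : fieldType) r d (p : {mpoly K[r]}) i :
  p \is d.+1.-homog -> p^`M(i) \is d.-homog.
Proof.
move=> /dhomogP hp; apply/dhomogP => m; rewrite mcoeff_msupp mcoeff_mderiv => nz.
have : (m + U_(i))%MM \in msupp p.
  by rewrite mcoeff_msupp; apply: contraNneq nz => ->; rewrite mul0rn.
by move/hp => /= h; move: h; rewrite mdegD mdeg1 addn1 => -[].
Qed.

Lemma det_homog (K : fieldType) r n (M : 'M[{mpoly K[r]}]_n) (d : 'I_n -> nat) :
  (forall i j, M i j \is (d i).-homog) -> \det M \is (\sum_i d i)%N.-homog.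
Proof.
move=> hM; apply: rpred_sum => s _; rewrite mulr_sign.
suff h : \prod_i M i (s i) \is (\sum_i d i)%N.-homog by case: (s : bool); rewrite ?rpredN.
apply: (big_rec2 (fun (p : {mpoly K[r]}) e => p \is e.-homog)); first exact: dhomog1.
by move=> i p e _ hp; apply: dhomogM.
Qed.

(** Column choices range over all functions, which form a finite type; repeated columns merely give
    zero minors. *)
Lemma row_free_minor (K : fieldType) n r (A : 'M[K]_(n, r)) :
  row_free A <-> exists f : {ffun 'I_n -> 'I_r}, \det (\matrix_(i, j) A i (f j)) != 0.
Proof.
split=> [fA|[f]].
  have fT : row_full A^T by rewrite /row_full mxrank_tr.
  exists (fullrankfun fT); have := fullrowsub_unit fT.
  rewrite unitmxE unitfE -det_tr; congr (~~ (\det _ == _)).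
  by apply/matrixP => i j; rewrite !mxE.
rewrite -unitfE -unitmxE => uf; rewrite -kermx_eq0; apply/eqP/row_matrixP => i; rewrite row0.
set z := row i _.
have zA : z *m A = 0 by rewrite /z -row_mul mulmx_ker row0.
rewrite -[z](mulmxK uf).
have -> : z *m (\matrix_(i, j) A i (f j)) = 0; last by rewrite mul0mx.
apply/rowP => j; have := congr1 (fun u : 'rV_r => u 0 (f j)) zA; rewrite !mxE => h.
by rewrite -[RHS]h; apply: eq_bigr => l _; rewrite [X in _ * X]mxE.
Qed.

Section Codim.
Variables (K : closedFieldType) (n : nat) (ds : seq nat).
Hypothesis ch0 : [pchar K] =i pred0.
Hypothesis szn : (sumn ds + size ds)%N = n.
Hypothesis sds : sorted geq ds.

Local Notation J := (jordan_nil K n ds).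
Local Notation blk := (blk ds).
Local Notation reduced_mx := (@reduced_mx K n ds).
Variables (r : nat) (b : 'I_r -> 'M[K]_n).
Variables (F : 'I_n -> {mpoly K[r]}) (k : 'I_n -> K).
Hypothesis k_neq0 : forall j, k j != 0.
Hypothesis homF : forall j, F j \is (blk j).+1.-homog.
Hypothesis FE : forall j y, (F j).@[gedual b y] = k j * leading_form ds j (reduced_mx y).

Lemma row_slice_row_free (C : nat -> nat -> K) :
  (forall i l, (l.+1 < i)%N -> C i l = 0) -> (forall i, (i.+1 < size ds)%N -> C i.+1 i != 0) ->
  row_free (jacobian F (gedual b (const_slice n ds C))).
Proof.
move=> Cl Cs.
apply: (jacobian_row_free ch0 k_neq0 FE (D := row_direction ds) (slice_coef_unit szn sds Cl Cs)
  (c := fun j => leading_form ds j (slice_mx ds C (fun=> 0) : 'M_n))) => j v s.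
have -> : s *: row_direction ds v = row_direction ds (fun i => s * v i).
  by apply/matrixP => a i; rewrite !mxE; case: ifP; rewrite ?mulr0.
rewrite leading_form_row_slice // (leading_form_slice szn sds C); congr (_ + _).
by rewrite mulr_sumr; apply: eq_bigr => i _; rewrite mxE mulrCA.
Qed.

Lemma col_slice_row_free (C : nat -> nat -> K) :
  (forall i l, (l.+1 < i)%N -> C l i = 0) -> (forall i, (i.+1 < size ds)%N -> C i i.+1 != 0) ->
  row_free (jacobian F (gedual b (const_slice n ds C))).
Proof.
move=> Cl Cs; pose C' i l := C l i.
apply: (jacobian_row_free ch0 k_neq0 FE (D := col_direction ds)
  (@slice_coef_unit K n ds szn sds C' Cl Cs)
  (c := fun j => leading_form ds j (slice_mx ds C' (fun=> 0) : 'M_n))) => j v s.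
have -> : s *: col_direction ds v = col_direction ds (fun i => s * v i).
  apply/matrixP => a i; rewrite !mxE; case: ifP => _; rewrite ?mulr0 //.
  by rewrite mulr_sumr.
rewrite leading_form_col_slice // [LHS](leading_form_slice szn sds C'); congr (_ + _).
by rewrite mulr_sumr; apply: eq_bigr => i _; rewrite mxE mulrCA.
Qed.

Lemma eq_jacobian t t' : t =1 t' -> jacobian F t = jacobian F t'.
Proof. by move=> tt; apply/matrixP => i j; rewrite !mxE; apply: meval_eq. Qed.

(** Here [v] is the subdiagonal point and [w] the superdiagonal one. The row slice handles [v]; the
    column slice handles every [w + s v], whose superdiagonal stays 1. *)
Lemma codim_jacobian : codim_ge2 (fun t => ~~ row_free (jacobian F t)).
Proof.
pose G (g : {ffun 'I_n -> 'I_r}) : {mpoly K[r]} := \det (\matrix_(i, j) (F i)^`M(g j)).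
have GE g t : (G g).@[t] = \det (\matrix_(i, j) jacobian F t i (g j)).
  rewrite /G -[LHS](det_map_mx (meval t)); congr (\det _).
  by apply/matrixP => i j; rewrite !mxE.
have rfG t : row_free (jacobian F t) -> exists g, (G g).@[t] != 0.
  by move/row_free_minor => [g hg]; exists g; rewrite GE.
pose Cv i l : K := (i == l.+1)%:R; pose Cw i l : K := (l == i.+1)%:R.
apply: (@codim_ge2_cone K r _ G (\sum_(i < n) blk i)%N (gedual b (const_slice n ds Cv))
  (gedual b (const_slice n ds Cw))) => //.
- by move=> g; apply: det_homog => i j; rewrite mxE; apply: mderiv_homog.
- move=> t; split=> [nr g|hG].
    by apply/eqP/negPn/negP => hg; case/negP: nr; apply/row_free_minor; exists g; rewrite -GE.
  by apply/negP => /rfG [g]; rewrite hG eqxx.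
- apply: rfG; apply: row_slice_row_free => [i l h|i _].
    by rewrite /Cv; case: eqP h => // ->; rewrite ltnn.
  by rewrite /Cv eqxx oner_eq0.
- move=> s; apply: rfG.
  pose C i l : K := Cw i l + s * Cv i l.
  rewrite (@eq_jacobian _ (gedual b (const_slice n ds C))).
    apply: col_slice_row_free => [i l h|i _].
      rewrite /C /Cw /Cv; case: eqP h => [->|_ h]; first by rewrite ltnn.
      by case: eqP h => [->|_ _]; rewrite ?mulr0 ?addr0 // ltnNge ltnW.
    have -> : C i i.+1 = 1; last by rewrite oner_eq0.
    rewrite /C /Cw /Cv eqxx; have -> : (i == i.+2) = false by apply/negbTE; rewrite neq_ltn ltnW.
    by rewrite mulr0 addr0.
  move=> l; rewrite /gedual.
  have -> : const_slice n ds C = const_slice n ds Cw + s *: const_slice n ds Cv.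
    by apply/matrixP => a i; rewrite !mxE; case: ifP; rewrite ?mulr0 ?addr0.
  by rewrite mulmxDr -scalemxAr mxtraceD mxtraceZ mulrC.
Qed.

End Codim.

Lemma theorem_jordan (K : closedFieldType) (n : nat) (f : 'M[K]_n) (c : K)
    (ds : seq nat) (r : nat) (b : 'I_r -> 'M[K]_n) (eF : nat -> {mpoly K[r]}) :
  [pchar K] =i pred0 ->
  (sumn ds + size ds)%N = n -> sorted geq ds ->
  c != 0 ->
  is_basis_of (centraliser (jordan_nil K n ds)) b ->
  (forall t, exists2 y, centraliser f y & gedual b y =1 t) ->
  (forall i, (1 <= i <= n)%N -> is_eF c (jordan_nil K n ds) f b i (eF i)) ->
  codim_ge2 (fun t : 'I_r -> K =>
    ~~ row_free (jacobian (fun i : 'I_n => eF i.+1) t)) /\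
  (forall P : {mpoly K[r]},
     (ge_invariant (jordan_nil K n ds) b P <-> Ge_invariant (jordan_nil K n ds) b P) /\
     (Ge_invariant (jordan_nil K n ds) b P <->
        exists Q : {mpoly K[n]}, P = Q \mPo [tuple eF i.+1 | i < n])) /\
  (forall i, (i < size ds)%N ->
     forall j, (sumn (take i ds) + i + 1 <= j <= sumn (take i ds) + nth 0 ds i + i + 1)%N ->
       eF j != 0 /\ eF j \is (i.+1).-homog).
Proof.
move=> ch0 szn sds c0 bas surj hF.
have lead (j : 'I_n) := is_eF_leading ch0 szn sds bas c0 surj (hF j.+1 (ltn_ord j)).
have [k hk] : exists k : 'I_n -> K, forall j, k j != 0 /\
    forall y, (eF j.+1).@[gedual b y] = k j * leading_form ds j (reduced_mx ds y).
  apply: (@fin_all_exists 'I_n (fun=> K : Type) (fun j x => x != 0 /\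
    forall y, (eF j.+1).@[gedual b y] = x * leading_form ds j (reduced_mx ds y))) => j.
  by have [_ _ [x x0 hx]] := lead j; exists x.
have k0 j := (hk j).1; have kE j := (hk j).2.
have hom (j : 'I_n) : eF j.+1 \is (blk ds j).+1.-homog by have [] := lead j.
have surj' t : exists y, gedual b y =1 t by have [y _ ?] := surj t; exists y.
split; first exact: (codim_jacobian ch0 szn sds k0 hom kE).
split; first exact: (invariants_comp ch0 szn sds bas surj' k0 kE).
move=> i hi j /andP [j1 j2].
have jn : exists j0 : 'I_n, j = j0.+1 /\ blk ds j0 = i.
  have e : (sumn (take i (map S ds)) = sumn (take i ds) + i)%N.
    by rewrite -map_take sumn_mapS size_takel // ltnW.
  pose o := (j - (sumn (take i ds) + i + 1))%N.
  have ho : (o <= nth 0 ds i)%N by rewrite /o; lia.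
  exists (Ordinal (flat_lt szn hi ho)); rewrite /= blk_flat //; split=> //.
  by rewrite /flatten_index e /o; lia.
have [j0 [-> <-]] := jn.
by have [h1 h2 _] := lead j0.
Qed.

(** * Conjugation *)

Section Conjugation.
Variables (K : fieldType) (n : nat) (g : 'M[K]_n).
Hypothesis gu : g \in unitmx.

Local Notation conj x := (invmx g *m x *m g).
Local Notation unconj x := (g *m x *m invmx g).

Lemma conj_unconj x : conj (unconj x) = x.
Proof. by rewrite !mulmxA mulVmx // mul1mx -mulmxA mulVmx // mulmx1. Qed.

Lemma unconj_conj x : unconj (conj x) = x.
Proof. by rewrite !mulmxA mulmxV // mul1mx -mulmxA mulmxV // mulmx1. Qed.

Lemma conj_mul x y : conj (x *m y) = conj x *m conj y.
Proof. by rewrite !mulmxA mulmxK. Qed.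

Lemma unconj_mul x y : unconj (x *m y) = unconj x *m unconj y.
Proof. by rewrite !mulmxA mulmxKV. Qed.

Lemma conj_lie x y : lie (conj x) (conj y) = conj (lie x y).
Proof. by rewrite /lie -!conj_mul mulmxBr mulmxBl. Qed.

Lemma unconj_lie x y : lie (unconj x) (unconj y) = unconj (lie x y).
Proof. by rewrite /lie -!unconj_mul mulmxBr mulmxBl. Qed.

Lemma centraliser_conj x y : centraliser x y -> centraliser (conj x) (conj y).
Proof. by rewrite /centraliser conj_lie => ->; rewrite mulmx0 mul0mx. Qed.

Lemma centraliser_unconj x y : centraliser x y -> centraliser (unconj x) (unconj y).
Proof. by rewrite /centraliser unconj_lie => ->; rewrite mulmx0 mul0mx. Qed.

Variables (r : nat) (b : 'I_r -> 'M[K]_n) (e : 'M[K]_n).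
Local Notation b' := (fun j => conj (b j)).

Lemma trace_conj x y : \tr (conj x *m y) = \tr (x *m unconj y).
Proof. by rewrite -[in LHS]mulmxA -[in LHS]mulmxA mxtrace_mulC !mulmxA. Qed.

Lemma gedual_conj y : gedual b' y =1 gedual b (unconj y).
Proof. by move=> j; apply: trace_conj. Qed.

Lemma is_basis_of_conj : is_basis_of (centraliser e) b -> is_basis_of (centraliser (conj e)) b'.
Proof.
have sumE (t : 'I_r -> K) : \sum_j t j *: conj (b j) = conj (\sum_j t j *: b j).
  rewrite mulmx_sumr mulmx_suml; apply: eq_bigr => j _.
  by rewrite -scalemxAr -scalemxAl.
move=> [h1 [h2 h3]]; split; first by move=> j; apply: centraliser_conj.
split=> [t|x].
  by rewrite sumE => h; apply: h2; rewrite -[LHS]unconj_conj h mulmx0 mul0mx.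
move/centraliser_unconj; rewrite unconj_conj => /h3 [t ht]; exists t.
by rewrite sumE -ht conj_unconj.
Qed.

(** Coordinates are taken in the conjugated basis, so the polynomial itself does not change. *)
Lemma is_eF_conj c f i P : (i <= n)%N -> is_eF c e f b i P -> is_eF c (conj e) (conj f) b' i P.
Proof.
move=> hi [Q [hQ ->]]; exists Q; split=> // y /centraliser_unconj; rewrite unconj_conj => fy.
have := hQ _ fy; rewrite -(Delta_conj (conj e + y) hi gu) mulmxDr mulmxDl unconj_conj => <-.
by apply: meval_eq => j; rewrite trace_conj.
Qed.

Lemma unitmx_unconj h : h \in unitmx -> unconj h \in unitmx.
Proof. by move=> hu; rewrite !unitmx_mul gu hu unitmx_inv. Qed.

Lemma unitmx_conj h : h \in unitmx -> conj h \in unitmx.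
Proof. by move=> hu; rewrite !unitmx_mul gu hu unitmx_inv gu. Qed.

Lemma unconj_act h y : h \in unitmx ->
  unconj (h *m y *m invmx h) = unconj h *m unconj y *m invmx (unconj h).
Proof.
move=> hu; rewrite !unconj_mul; congr (_ *m _).
rewrite -[LHS](mulKmx (unitmx_unconj hu)) -unconj_mul mulmxV // mulmx1 mulmxV //.
by rewrite mulmx1.
Qed.

Lemma Ge_invariant_conj P : Ge_invariant e b P <-> Ge_invariant (conj e) b' P.
Proof.
split=> inv h y [hu he].
  rewrite !(meval_eq _ (gedual_conj _)) unconj_act //; apply: inv; split.
    exact: unitmx_unconj.
  by rewrite -[e]unconj_conj -!unconj_mul he.
have := inv (conj h) (conj y); rewrite !(meval_eq _ (gedual_conj _)).
rewrite unconj_act ?unitmx_conj // !unconj_conj; apply; split; first exact: unitmx_conj.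
by rewrite -!conj_mul he.
Qed.

Lemma ge_invariant_conj P : ge_invariant e b P <-> ge_invariant (conj e) b' P.
Proof.
have E x y : \sum_(j < r) (P^`M(j)).@[gedual b' y] * \tr (lie (conj x) (conj (b j)) *m y) =
    \sum_(j < r) (P^`M(j)).@[gedual b (unconj y)] * \tr (lie x (b j) *m unconj y).
  apply: eq_bigr => j _; rewrite (meval_eq _ (gedual_conj _)); congr (_ * _).
  by rewrite conj_lie trace_conj.
split=> inv x y xe.
  rewrite -[x]conj_unconj E; apply: inv.
  by rewrite -[e]unconj_conj; apply: centraliser_unconj.
by rewrite -[y]unconj_conj -E; apply: inv; apply: centraliser_conj.
Qed.

End Conjugation.

Theorem theorem4p3 (K : closedFieldType) (n : nat) (e h f : 'M[K]_n) (c : K)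
    (ds : seq nat) (r : nat) (b : 'I_r -> 'M[K]_n) (eF : nat -> {mpoly K[r]}) :
  [pchar K] =i pred0 ->
  (2 <= n)%N ->
  nil_jordan_type e ds ->
  c != 0 ->
  (e != 0 -> sl2_triple e h f /\ c * \tr (e *m f) = 1) ->
  (e = 0 -> f = 0) ->
  is_basis_of (centraliser e) b ->
  (forall i, (1 <= i <= n)%N -> is_eF c e f b i (eF i)) ->
  (* very good generating system *)
  codim_ge2 (fun t : 'I_r -> K =>
    ~~ row_free (jacobian (fun i : 'I_n => eF i.+1) t)) /\
  (* S(g_e)^{g_e} = S(g_e)^{G_e} = K[^eF_1, ..., ^eF_n] *)
  (forall P : {mpoly K[r]},
     (ge_invariant e b P <-> Ge_invariant e b P) /\
     (Ge_invariant e b P <->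
        exists Q : {mpoly K[n]}, P = Q \mPo [tuple eF i.+1 | i < n])) /\
  (* degrees *)
  (forall i, (i < size ds)%N ->
     forall j, (sumn (take i ds) + i + 1 <= j <= sumn (take i ds) + nth 0 ds i + i + 1)%N ->
       eF j != 0 /\ eF j \is (i.+1).-homog).
Proof.
move=> ch0 _ [sds [szn [g [gu eE]]]] c0 triple e0f0 bas hF.
(* For [e = 0] there is no triple, but then [f = 0] and [ad f] vanishes. *)
have disj x : lie e (lie f x) = 0 -> lie f x = 0.
  have [e0|/triple [sl2 _]] := eqVneq e 0; last exact: centraliser_image_disjoint ch0 sl2.
  by rewrite (e0f0 e0) /lie mul0mx mulmx0 subrr.
have surj := gedual_surjective bas disj.
have eJ : invmx g *m e *m g = jordan_nil K n ds by rewrite eE conj_unconj.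
have bas' := is_basis_of_conj gu bas.
have hF' i (hi : (1 <= i <= n)%N) :=
  is_eF_conj gu (proj2 (andP hi)) (hF i hi).
have surj' t : exists2 y, centraliser (invmx g *m f *m g) y &
    gedual (fun j => invmx g *m b j *m g) y =1 t.
  have [y fy yt] := surj t; exists (invmx g *m y *m g); first exact: centraliser_conj.
  by move=> j; rewrite gedual_conj unconj_conj.
rewrite eJ in bas' hF'.
have [h1 [h2 h3]] := theorem_jordan ch0 szn sds c0 bas' surj' hF'.
split=> //; split=> // P.
have i1 := ge_invariant_conj gu b e P; have i2 := Ge_invariant_conj gu b e P.
rewrite eJ in i1 i2; have [k1 k2] := h2 P.
by split; [rewrite i1 i2 | rewrite i2].
Qed.
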